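(* Let $\varphi:\mathbb P^1\to\mathbb P^1$ be a branched Galois covering of degree $4$ with Galois group $C_4$; up to Möbius transformations, $\varphi$ is $w\mapsto w^4$, $w=x/y$. Let $g([x,y]):\mathbb P^1\to\mathbb P^3$ be a holomorphic curve which is a Galois lift, with covering $\varphi$, of a sextic curve $F$ in $\mathcal V_5$, so $f_1\circ g=F\circ\varphi$. Then $\deg g=5$, and up to Möbius transformations on $\mathbb P^1$, $g$ is $PSL_2$-equivalent to $$\begin{pmatrix}1&a_2&0&a_4\\0&b_2&1&b_4\end{pmatrix}\begin{pmatrix}x^5&0&xy^4&0\\0&x^4y&0&y^5\end{pmatrix}^T,$$ where $\begin{pmatrix}1&a_2&0&a_4\\0&b_2&1&b_4\end{pmatrix}\in G(2,4)$ is a $2$-plane that is perpendicular to $(1,-1,1,-1)$ under the bilinear inner product. This class depends on two free parameters $a_4,b_4$ and belongs to the generally ramified family.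
   Context: The ground field is $\mathbb C$. $V_n$ is the space of binary forms of degree $n$ in $u,v$, with $SL_2=SL_2(\mathbb C)$ acting by $(A\cdot f)(u,v)=f(A^{-1}(u,v)^T)$. $\mathcal V_5\subset\mathbb P(V_6)=\mathbb P^6$ is the closure of $PSL_2\cdot[uv(u^4-v^4)]$; it is the disjoint union of this open orbit, the $2$-dimensional orbit $PSL_2\cdot[u^5v]$ and the $1$-dimensional orbit $PSL_2\cdot[u^6]$. A sextic curve is a holomorphic curve $F:\mathbb P^1\to\mathcal V_5\subset\mathbb P^6$ of degree $6$, linearly full in $\mathbb P^6$, not contained in $\overline{PSL_2\cdot[u^5v]}$. It is in the generally ramified family if it is tangent to the $1$-dimensional orbit at some point where it meets that orbit; otherwise it is in the exceptional transversal family. A class of curves $g$ is said to belong to one of these families if the corresponding curves $F$ do. Points of $\mathbb P^3$ are nonzero $2\times2$ matrices $\begin{pmatrix}a&b\\c&d\end{pmatrix}$ up to scale, and $f_1:\mathbb P^3\dashrightarrow\mathbb P(V_6)$ sends this matrix to $[(du-bv)(av-cu)((du-bv)^4-(av-cu)^4)]$; on $PSL_2$ it is the orbit map of $[uv(u^4-v^4)]$. $S_4^*\subset SU(2)$ is the binary octahedral group (order $48$) generated by $\mathrm{diag}(e^{\pi i/4},e^{-\pi i/4})$ and $\frac1{\sqrt2}\begin{pmatrix}1&-1\\1&1\end{pmatrix}$; its image in $PSL_2$ is the stabilizer of $[uv(u^4-v^4)]$. A branched covering $\varphi$ is Galois if its group $G=\{\sigma:\varphi\circ\sigma=\varphi\}$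 has order $\deg\varphi$. A map $g:\mathbb P^1\to\mathbb P^3$ of degree $n$ is a $2\times2$ matrix of degree-$n$ forms in $x,y$ without common factor. It is a Galois lift of $F$ with covering $\varphi$ if $f_1\circ g=F\circ\varphi$ and the homomorphism $\sigma\mapsto g(\sigma(q))^{-1}g(q)$ (independent of generic $q$) from $G$ to the stabilizer of $[uv(u^4-v^4)]$ is injective. Two curves $g,\tilde g:\mathbb P^1\to\mathbb P^3$ are $PSL_2$-equivalent if $AgB^T=\tilde g$ for some $A\in SL_2$, $B\in S_4^*$. Möbius transformations may be applied to both copies of $\mathbb P^1$ (source and target of $\varphi$). $G(2,k)$ is the Grassmannian of $2$-planes in $\mathbb C^k$; a $2\times k$ matrix of rank $2$ denotes its row space. The bilinear inner product is $\sum_i p_iq_i$ (no conjugation). *)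

(* Defs.v *)
(* The ground field of the theorem is R[i] with R : realType. *)
From mathcomp Require Import all_boot all_order all_algebra.
From mathcomp Require Import mpoly complex reals.

Set Implicit Arguments.
Unset Strict Implicit.
Unset Printing Implicit Defensive.

Import Order.TTheory GRing.Theory Num.Theory.

Local Open Scope ring_scope.

Definition mx_of_rows (T : nmodType) (m n : nat) (rows : seq (seq T)) :
    'M[T]_(m, n) :=
  \matrix_(i < m, j < n) nth 0 (nth [::] rows i) j.

(* A point of the projective space P(V) is a nonzero vector of V;
   [proj_eq v w] says that v and w are nonzero and represent the same point. *)
Definition proj_eq (C : fieldType) (V : lmodType C) (v w : V) : Prop :=
  [/\ v != 0, w != 0 & exists2 c : C, c != 0 & v = c *: w].

(* ---- Binary forms ---------------------------------------------------- *)

(* V_n is the set of f : {mpoly C[2]} with f \is n.-homog.  The same type is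
   used for forms in (u, v) and for forms in (x, y). *)
Definition var0 (C : numClosedFieldType) : {mpoly C[2]} := 'X_(0 : 'I_2).
Definition var1 (C : numClosedFieldType) : {mpoly C[2]} := 'X_(1 : 'I_2).

Definition lin_subst (C : numClosedFieldType) (S : 'M[C]_2) (f : {mpoly C[2]}) :
    {mpoly C[2]} :=
  f \mPo [tuple \sum_(j < 2) S i j *: 'X_j | i < 2].

(* (A . f)(u, v) = f (A^-1 (u, v)^T) *)
Definition act (C : numClosedFieldType) (A : 'M[C]_2) (f : {mpoly C[2]}) :
    {mpoly C[2]} := lin_subst (invmx A) f.

(* p represents a point of the orbit PSL_2 . [f] *)
Definition in_orbit (C : numClosedFieldType) (f p : {mpoly C[2]}) : Prop :=
  exists2 A : 'M[C]_2, \det A = 1 & proj_eq p (act A f).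

(* Identification of C^7 with V_6 through the basis u^(6-i) v^i. *)
Definition sextic_of (C : numClosedFieldType) (c : 'rV[C]_7) : {mpoly C[2]} :=
  \sum_(i < 7) c 0 i *: (var0 C ^+ (6 - i) * var1 C ^+ i).

(* Points of the Zariski closure in P(V_6) of a set S of points of P(V_6):
   every homogeneous polynomial on V_6 vanishing on S vanishes at the point.
   The orbits to which this is applied are constructible, so that this is also
   their closure for the classical topology. *)
Definition in_closure (C : numClosedFieldType) (S : {mpoly C[2]} -> Prop)
    (c : 'rV[C]_7) : Prop :=
  c != 0 /\
  forall (d : nat) (h : {mpoly C[7]}), h \is d.-homog ->
    (forall s : 'rV[C]_7, S (sextic_of s) -> h.@[s 0] = 0) ->
    h.@[c 0] = 0.

(* u v (u^4 - v^4) *)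
Definition octa (C : numClosedFieldType) : {mpoly C[2]} :=
  var0 C * var1 C * (var0 C ^+ 4 - var1 C ^+ 4).

Definition in_V5 (C : numClosedFieldType) (c : 'rV[C]_7) : Prop :=
  in_closure (in_orbit (octa C)) c.

(* ---- Holomorphic maps from P^1 to projective spaces of matrices -------- *)

Definition peval (C : numClosedFieldType) (m k : nat) (G : 'M[{mpoly C[2]}]_(m, k))
    (q : 'cV[C]_2) : 'M[C]_(m, k) :=
  map_mx (meval (fun i => q i 0)) G.

(* A map of degree n from P^1 to P('M_(m, k)): a matrix of forms of degree n
   without common factor.  If all the entries are zero, then every polynomial
   is a common factor. *)
Definition pmap_deg (C : numClosedFieldType) (m k n : nat)
    (G : 'M[{mpoly C[2]}]_(m, k)) : Prop :=
  (forall i j, G i j \is n.-homog) /\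
  (forall d : {mpoly C[2]}, (forall i j, exists h, G i j = d * h) ->
     exists c : C, d = c%:MP).

Definition same_map (C : numClosedFieldType) (m k : nat)
    (G H : 'M[{mpoly C[2]}]_(m, k)) : Prop :=
  forall q : 'cV[C]_2, q != 0 -> proj_eq (peval G q) (peval H q).

(* The composite of G with the Moebius transformation of the source P^1 given
   by the matrix mu. *)
Definition precomp (C : numClosedFieldType) (m k : nat) (mu : 'M[C]_2)
    (G : 'M[{mpoly C[2]}]_(m, k)) : 'M[{mpoly C[2]}]_(m, k) :=
  map_mx (lin_subst mu) G.

Definition mpolyC_mx (C : numClosedFieldType) (m k : nat) (M : 'M[C]_(m, k)) :
    'M[{mpoly C[2]}]_(m, k) :=
  map_mx (fun c => c%:MP) M.

(* ---- Galois coverings -------------------------------------------------- *)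

(* S represents an element of the group of all sigma in PGL_2(C) = Aut P^1
   such that phi o sigma = phi. *)
Definition deck (C : numClosedFieldType) (phi : 'cV[{mpoly C[2]}]_2) (S : 'M[C]_2) :
    Prop :=
  S \in unitmx /\
  forall q : 'cV[C]_2, q != 0 -> proj_eq (peval phi (S *m q)) (peval phi q).

Definition deck_order (C : numClosedFieldType) (phi : 'cV[{mpoly C[2]}]_2) (n : nat) :
    Prop :=
  exists s : 'I_n -> 'M[C]_2,
    [/\ forall i, deck phi (s i),
        forall i j, proj_eq (s i) (s j) -> i = j
      & forall S, deck phi S -> exists i, proj_eq S (s i)].

Definition deck_cyclic (C : numClosedFieldType) (phi : 'cV[{mpoly C[2]}]_2) : Prop :=
  exists2 S0 : 'M[C]_2, deck phi S0 &
    forall S, deck phi S -> exists k : nat, proj_eq S (S0 ^+ k).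

Definition galois_covering (C : numClosedFieldType) (d : nat)
    (phi : 'cV[{mpoly C[2]}]_2) : Prop :=
  [/\ (0 < d)%N, pmap_deg d phi & deck_order phi d].

(* ---- Sextic curves in V_5 ---------------------------------------------- *)

Definition linearly_full (C : numClosedFieldType) (F : 'rV[{mpoly C[2]}]_7) : Prop :=
  forall l : 'cV[C]_7, (forall q : 'cV[C]_2, peval F q *m l = 0) -> l = 0.

Definition sextic_curve (C : numClosedFieldType) (F : 'rV[{mpoly C[2]}]_7) : Prop :=
  [/\ pmap_deg 6 F,
      forall q : 'cV[C]_2, q != 0 -> in_V5 (peval F q),
      linearly_full F
    & exists2 q : 'cV[C]_2, q != 0 &
        ~ in_closure (in_orbit (var0 C ^+ 5 * var1 C)) (peval F q)].

(* By Euler's formula, the projectivization of the row space of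
   (dF/dx, dF/dy)(q) is the tangent line to F at q (if F is immersed at q). *)
Definition jacobian (C : numClosedFieldType) (F : 'rV[{mpoly C[2]}]_7)
    (q : 'cV[C]_2) : 'M[C]_(2, 7) :=
  \matrix_(i < 2, j < 7) ((F 0 j)^`M(i)).@[fun k => q k 0].

Definition coords6 (C : numClosedFieldType) (f : {mpoly C[2]}) : 'rV[C]_7 :=
  \row_(i < 7) f@_(U_(ord0) *+ (6 - i) + U_(ord_max) *+ i)%MM.

(* F is tangent to the orbit PSL_2 . [u^6] at a point A . [u^6] where it meets
   it.  The orbit is parametrized near that point by t |-> A . [(u + t v)^6],
   so that its tangent line there is spanned by A . u^6 and A . (u^5 v). *)
Definition generally_ramified (C : numClosedFieldType) (F : 'rV[{mpoly C[2]}]_7) :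
    Prop :=
  exists (q : 'cV[C]_2) (A : 'M[C]_2),
    [/\ q != 0, \det A = 1,
        proj_eq (sextic_of (peval F q)) (act A (var0 C ^+ 6))
      & (jacobian F q == col_mx (coords6 (act A (var0 C ^+ 6)))
                                (coords6 (act A (var0 C ^+ 5 * var1 C))))%MS].

(* ---- Galois lifts ------------------------------------------------------ *)

(* The rational map f_1 : P^3 --> P(V_6), undefined where the value is 0. *)
Definition f1 (C : numClosedFieldType) (M : 'M[C]_2) : {mpoly C[2]} :=
  let p := M 1 1 *: var0 C - M 0 1 *: var1 C in
  let r := M 0 0 *: var1 C - M 1 0 *: var0 C in
  p * r * (p ^+ 4 - r ^+ 4).

(* f_1 o g = F o phi as rational maps *)
Definition lifts (C : numClosedFieldType) (phi : 'cV[{mpoly C[2]}]_2)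
    (F : 'rV[{mpoly C[2]}]_7) (g : 'M[{mpoly C[2]}]_2) : Prop :=
  (exists2 q : 'cV[C]_2, q != 0 & f1 (peval g q) != 0) /\
  (forall q : 'cV[C]_2, q != 0 -> f1 (peval g q) != 0 ->
     proj_eq (f1 (peval g q)) (sextic_of (peval F (peval phi q)))).

Definition octa_stabilizer (C : numClosedFieldType) (T : 'M[C]_2) : Prop :=
  \det T = 1 /\ proj_eq (act T (octa C)) (octa C).

(* g(S q)^-1 g(q) = T in PSL_2 for generic q *)
Definition lift_monodromy (C : numClosedFieldType) (g : 'M[{mpoly C[2]}]_2)
    (S T : 'M[C]_2) : Prop :=
  forall q : 'cV[C]_2, q != 0 ->
    peval g q \in unitmx -> peval g (S *m q) \in unitmx ->
    proj_eq (invmx (peval g (S *m q)) *m peval g q) T.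

Definition galois_lift (C : numClosedFieldType) (phi : 'cV[{mpoly C[2]}]_2)
    (F : 'rV[{mpoly C[2]}]_7) (g : 'M[{mpoly C[2]}]_2) : Prop :=
  [/\ lifts phi F g,
      forall S, deck phi S ->
        exists2 T, octa_stabilizer T & lift_monodromy g S T
    & forall S S' T, deck phi S -> deck phi S' ->
        lift_monodromy g S T -> lift_monodromy g S' T -> proj_eq S S'].

(* ---- Equivalence of lifts ---------------------------------------------- *)

(* The binary octahedral group; exp(+- i pi / 4) = (1 +- i) / sqrt 2. *)
Inductive S4star (C : numClosedFieldType) : 'M[C]_2 -> Prop :=
| S4star_diag : S4star (mx_of_rows 2 2
    [:: [:: (1 + 'i) / sqrtC 2; 0]; [:: 0; (1 - 'i) / sqrtC 2]])
| S4star_rot : S4star ((sqrtC 2)^-1 *: mx_of_rows 2 2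
    [:: [:: 1; -1]; [:: 1; 1]])
| S4star_one : S4star 1%:M
| S4star_inv B : S4star B -> S4star (invmx B)
| S4star_mul B B' : S4star B -> S4star B' -> S4star (B *m B').

Definition PSL2_equiv (C : numClosedFieldType) (g g' : 'M[{mpoly C[2]}]_2) :
    Prop :=
  exists A B : 'M[C]_2, [/\ \det A = 1, S4star B &
    same_map (mpolyC_mx A *m g *m (mpolyC_mx B)^T) g'].

(* nu o phi o mu = phi' *)
Definition moebius_conj (C : numClosedFieldType) (mu nu : 'M[C]_2)
    (phi phi' : 'cV[{mpoly C[2]}]_2) : Prop :=
  [/\ mu \in unitmx, nu \in unitmx &
      same_map (mpolyC_mx nu *m precomp mu phi) phi'].

(* Up to Moebius transformations mu of the source and nu of the target of the
   coverings, phi is phi' and g is PSL_2-equivalent to g'. *)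
Definition moebius_PSL2_equiv (C : numClosedFieldType)
    (phi : 'cV[{mpoly C[2]}]_2) (g : 'M[{mpoly C[2]}]_2)
    (phi' : 'cV[{mpoly C[2]}]_2) (g' : 'M[{mpoly C[2]}]_2) : Prop :=
  exists mu nu : 'M[C]_2,
    moebius_conj mu nu phi phi' /\ PSL2_equiv (precomp mu g) g'.

(* ---- The normal form --------------------------------------------------- *)

(* w |-> w^4, w = x / y *)
Definition power4 (C : numClosedFieldType) : 'cV[{mpoly C[2]}]_2 :=
  mx_of_rows 2 1 [:: [:: var0 C ^+ 4]; [:: var1 C ^+ 4]].

Definition plane (C : numClosedFieldType) (a2 a4 b2 b4 : C) : 'M[C]_(2, 4) :=
  mx_of_rows 2 4 [:: [:: 1; a2; 0; a4]; [:: 0; b2; 1; b4]].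

Definition perp_alt (C : numClosedFieldType) (M : 'M[C]_(2, 4)) : Prop :=
  M *m (mx_of_rows 1 4 [:: [:: 1; -1; 1; -1]])^T = 0.

Definition normal_form (C : numClosedFieldType) (M : 'M[C]_(2, 4)) :
    'M[{mpoly C[2]}]_2 :=
  let x := var0 C in let y := var1 C in
  mpolyC_mx M *m (mx_of_rows 2 4
    [:: [:: x ^+ 5; 0; x * y ^+ 4; 0]; [:: 0; x ^+ 4 * y; 0; y ^+ 5]])^T.

(* Main.v *)
Require Import Defs.
From mathcomp Require Import all_boot all_order all_algebra.
From mathcomp Require Import mpoly complex reals ring zify.

(** The covering. The deck group is cyclic of order four, and a transformation of
    order four of the projective line has two fixed points. Taking them as coordinate
    points makes a generator [w |-> 'i w], and the forms that represent [phi] become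
    combinations of [x^4] and [y^4] ([diag_order4], [covering_normal]).

    The shape of the lift. At generic points the relation between [g (S q)] and [g q]
    is given by the monodromy; by the uniqueness of representations without common
    factor ([prop_common]) it holds identically ([equivariant]). For a generator the
    monodromy is an element of order four of the octahedral group, whose fixed points
    are antipodal vertices of the octahedron, so an element of the binary octahedral
    group makes it diagonal ([octa_fixed_points], [octa_diagonalize]). Then each column
    of [g] only contains exponents of one residue class modulo four. The degree [n] is
    bounded as follows: [f1 o g = h * (F o phi)] for a form [h] of degree [6 n - 24], and
    [h] divides [det g], because [24 u^9] and [24 v^9] lie in the ideal of the partial
    derivatives of [u v (u^4 - v^4)] ([det_pow9], [content_degree]). Hence
    [4 <= n <= 6], and the residue classes leave only [n = 5] with columns
    [x (al X + be Y)] and [y (ga X + de Y)], where [X = x^4] and [Y = y^4]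
    ([lift_shape]). The form [h] has degree six and is divisible by [x y]; at another
    zero of [h] the columns are proportional, which after a rescaling of [x] is the
    orthogonality relation of the normal form ([normalize]).

    The ramification. For the normal form with parameters [a = a4] and [b = b4], put
    [l = a v - (b - 1) u], [r = X v - Y u] and [p = (X - Y) l - r]. The columns give the
    linear forms [y p] and [x r], and dividing [f1 o g] by [x y (X - Y)] yields
    [F = p r (Y l (p - r) (p^2 + r^2) - r^4)] ([nf_curve], [curve_unique]). At
    [(X, Y) = (a, b - 1)] both [p] and [r] are multiples of [l], so that [F] is a
    multiple of [l^6] and its derivatives are multiples of [l^5]
    ([curve_first_order]). Being linearly full of degree six, [F] is a rational normal
    curve and thus immersed ([jacobian_rank]); hence its tangent line at this point is
    the tangent line of the one-dimensional orbit ([ramified]).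

    The parameters. Conversely, let [F] be given by this formula. In a coordinate on the
    parameter line with pole at [(a, b - 1)] its matrix of coefficients is bidiagonal,
    and therefore invertible for generic [(a, b)] ([curve_full]). The curve lies in the
    closure of the open orbit since [f1 o g] meets that orbit ([curve_in_V5]), and an
    invariant quadratic form shows that it is not contained in the closure of the
    two-dimensional orbit ([curve_sextic]). The deck transformations [diag (s, d)] have
    monodromy [diag (d, s)] ([nf_galois_lift]). Finally, a Moebius transformation that
    preserves [w |-> w^4] fixes or exchanges the ramification points, and a comparison of
    monomials shows that at most two pairs of parameters are equivalent
    ([power4_conj], [equiv_partners]). *)

Set Implicit Arguments.
Unset Strict Implicit.
Unset Printing Implicit Defensive.
Import Order.TTheory GRing.Theory Num.Theory.
Local Open Scope ring_scope.


(** * Polynomials in two variables and binary forms *)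

Notation "f .@( q )" := (meval (fun i => q i 0) f)
  (at level 2, left associativity, q at level 200, format "f .@( q )") : ring_scope.

Section Forms.
Variable C : numClosedFieldType.
Implicit Types (f h d : {mpoly C[2]}) (q : 'cV[C]_2).

Definition pt (x y : C) : 'cV[C]_2 := \col_i (if i == 0 then x else y).

Lemma ptE q : q = pt (q 0 0) (q 1 0).
Proof.
apply/matrixP=> i j; rewrite !mxE (ord1 j).
by case: i => [[|[|//]] Hi] /=; congr (q _ _); apply/val_inj.
Qed.

Lemma pt0E x y : (pt x y) 0 0 = x. Proof. by rewrite mxE. Qed.
Lemma pt1E x y : (pt x y) 1 0 = y. Proof. by rewrite mxE. Qed.

Lemma pt_eq0 x y : (pt x y == 0) = (x == 0) && (y == 0).
Proof.
apply/eqP/andP=> [/matrixP E|[/eqP-> /eqP->]].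
  by have:= (E 0 0, E 1 0); rewrite !mxE /= => -[-> ->]; rewrite eqxx.
by apply/matrixP=> i j; rewrite !mxE; case: ifP.
Qed.

Lemma cV2_neq0 q : (q != 0) = (q 0 0 != 0) || (q 1 0 != 0).
Proof. by rewrite {1}[q]ptE pt_eq0 negb_and. Qed.

Lemma poly_all0 (p : {poly C}) : (forall x, p.[x] = 0) -> p = 0.
Proof.
move=> p0; apply: (@roots_geq_poly_eq0 _ _ [seq n%:R | n <- iota 0 (size p)]).
- by apply/allP=> x _; apply/rootP.
- by rewrite map_inj_uniq ?iota_uniq // => m n /eqP; rewrite eqr_nat => /eqP.
- by rewrite size_map size_iota.
Qed.

Lemma var0_ev q : (var0 C).@(q) = q 0 0. Proof. exact: mevalXU. Qed.
Lemma var1_ev q : (var1 C).@(q) = q 1 0. Proof. exact: mevalXU. Qed.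

Lemma var0_neq0 : var0 C != 0.
Proof.
by apply/eqP=> /(congr1 (fun h => h.@(pt 1 0))); rewrite var0_ev meval0 pt0E => /eqP;
   rewrite oner_eq0.
Qed.

Lemma var1_neq0 : var1 C != 0.
Proof.
by apply/eqP=> /(congr1 (fun h => h.@(pt 0 1))); rewrite var1_ev meval0 pt1E => /eqP;
   rewrite oner_eq0.
Qed.

Lemma meval_all0 f : (forall q, f.@(q) = 0) -> f = 0.
Proof.
move=> f0.
pose P y := \sum_(m <- msupp f) (f@_m * y ^+ m 1) *: 'X^(m 0) : {poly C}.
have P0 y : P y = 0.
  apply: poly_all0 => x; rewrite -[RHS](f0 (pt x y)) mevalE horner_sum.
  apply: eq_bigr => m _; rewrite big_ord_recl big_ord1 hornerZ hornerXn.
  rewrite -mulrA [y ^+ _ * _]mulrC; congr (_ * (_ * _)).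
    by rewrite mxE.
  rewrite mxE /=; congr (_ ^+ m _). exact/eqP.
pose Q k := \sum_(m <- msupp f) (f@_m * (k == m 0)%:R) *: 'X^(m 1) : {poly C}.
have Q0 k : Q k = 0.
  apply: poly_all0 => y; rewrite -[RHS](coef0 C k) -(P0 y) coef_sum horner_sum.
  apply: eq_bigr => m _; rewrite hornerZ hornerXn coefZ coefXn.
  by rewrite mulrAC.
apply/mpolyP=> m; rewrite mcoeff0.
have [mf|] := boolP (m \in msupp f); last by rewrite mcoeff_msupp negbK => /eqP.
have := congr1 (fun p : {poly C} => p`_(m 1)) (Q0 (m 0)).
rewrite coef0 coef_sum (bigD1_seq m) ?msupp_uniq //= coefZ coefXn !eqxx !mulr1.
rewrite big1 ?addr0 // => m' ne; rewrite coefZ coefXn.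
case: eqP => [E0|]; last by rewrite !(mulr0, mul0r).
case: eqP => [E1|]; last by rewrite !(mulr0, mul0r).
case/eqP: ne; apply/mnmP=> -[[|[|//]] Hi].
  by have <- : 0 = Ordinal Hi by apply/eqP.
by have <- : 1 = Ordinal Hi by apply/eqP.
Qed.

Lemma meval_inj f h : (forall q, f.@(q) = h.@(q)) -> f = h.
Proof.
by move=> E; apply/eqP; rewrite -subr_eq0; apply/eqP/meval_all0 => q;
   rewrite mevalB E subrr.
Qed.

(** The source of all density arguments: multiplying [f] by [d] makes it vanish
    everywhere. It replaces any appeal to generic points in a topology. *)
Lemma meval_dense f d : d != 0 ->
  (forall q, d.@(q) != 0 -> f.@(q) = 0) -> f = 0.
Proof.
move=> d0 f0; have /eqP : d * f = 0.
  apply: meval_all0 => q; rewrite mevalM.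
  by have [->|/f0->] := eqVneq d.@(q) 0; rewrite ?mul0r ?mulr0.
by rewrite mulf_eq0 (negPf d0) => /eqP.
Qed.

Definition fcoef n f (i : nat) : C :=
  f@_(U_(ord0) *+ (n - i) + U_(ord_max) *+ i)%MM.

Lemma monomE (a b : nat) :
  var0 C ^+ a * var1 C ^+ b = 'X_[(U_(ord0) *+ a + U_(ord_max) *+ b)%MM].
Proof.
rewrite mpolyXD /var0 /var1 -!mpolyXn; congr (_ * 'X_ _ ^+ _).
Qed.

Lemma mnm2E (m : 'X_{1..2}) :
  m = (U_(ord0) *+ m ord0 + U_(ord_max) *+ m ord_max)%MM.
Proof.
apply/mnmP=> i; rewrite mnmDE !mulmnE !mnm1E.
case: i => [[|[|//]] Hi].
  have -> : Ordinal Hi = ord0 by apply/eqP.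
  by rewrite mul1n mul0n addn0.
have -> : Ordinal Hi = ord_max by apply/eqP.
by rewrite mul1n mul0n.
Qed.

Lemma mdeg2 (m : 'X_{1..2}) : mdeg m = (m ord0 + m ord_max)%N.
Proof. by rewrite mdegE big_ord_recr big_ord1 /=; congr (m _ + _)%N; apply/eqP. Qed.

Lemma mnm2_inj (a b a' b' : nat) :
  (U_(ord0) *+ a + U_(ord_max) *+ b = U_(ord0) *+ a' + U_(ord_max) *+ b' :> 'X_{1..2})%MM ->
  a = a' /\ b = b'.
Proof.
move=> /mnmP E; have := (E ord0, E ord_max).
by rewrite !mnmDE !mulmnE !mnm1E /= !mul1n !mul0n !addn0 !add0n => -[].
Qed.

Lemma form_coefE n f : f \is n.-homog ->
  f = \sum_(i < n.+1) fcoef n f i *: (var0 C ^+ (n - i) * var1 C ^+ i).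
Proof.
move=> hf; apply/mpolyP=> m; rewrite raddf_sum /=.
have [dm|dm] := eqVneq (mdeg m) n; last first.
  rewrite (dhomog_nemf_coeff hf dm) big1 // => i _.
  rewrite monomE mcoeffZ mcoeffX; case: eqP => [E|]; last by rewrite mulr0.
  case/eqP: dm; rewrite -E mdegD !mdegMn !mdeg1 !mul1n subnK //.
  by rewrite -ltnS.
have lm : (m ord_max < n.+1)%N by rewrite ltnS -dm mdeg2 leq_addl.
have m0 : (n - m ord_max = m ord0)%N by rewrite -dm mdeg2 addnK.
rewrite (bigD1 (Ordinal lm)) //= big1 ?addr0; last first.
  move=> i ne; rewrite monomE mcoeffZ mcoeffX; case: eqP => [E|]; last by rewrite mulr0.
  case/eqP: ne; apply: ord_inj => /=.
  by move: E; rewrite {1}[m]mnm2E => /mnm2_inj[].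
by rewrite monomE mcoeffZ mcoeffX /fcoef m0 -mnm2E eqxx mulr1.
Qed.

Lemma form_ev n f q : f \is n.-homog ->
  f.@(q) = \sum_(i < n.+1) fcoef n f i * (q 0 0 ^+ (n - i) * q 1 0 ^+ i).
Proof.
move=> hf; rewrite {1}(form_coefE hf) rmorph_sum /=; apply: eq_bigr => i _.
by rewrite mevalZ mevalM !rmorphXn /= var0_ev var1_ev.
Qed.

Lemma homog_cast m n f : m = n -> f \is m.-homog -> f \is n.-homog.
Proof. by move=> ->. Qed.

Lemma homog_var0 : var0 C \is 1.-homog. Proof. by rewrite dhomogX; apply/eqP; exact: mdeg1. Qed.
Lemma homog_var1 : var1 C \is 1.-homog. Proof. by rewrite dhomogX; apply/eqP; exact: mdeg1. Qed.
Lemma homogXn k n f : f \is k.-homog -> f ^+ n \is (k * n).-homog.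
Proof. exact: dhomogMn. Qed.

Lemma homog_monom a b : var0 C ^+ a * var1 C ^+ b \is (a + b).-homog.
Proof.
have E : mdeg (U_(ord0) *+ a + U_(ord_max) *+ b : 'X_{1..2})%MM = (a + b)%N.
  by rewrite mdegD !mdegMn !mdeg1 !mul1n.
by rewrite monomE dhomogX; apply/eqP.
Qed.

Lemma homog_sum_monom n (c : nat -> C) :
  \sum_(i < n.+1) c i *: (var0 C ^+ (n - i) * var1 C ^+ i) \is n.-homog.
Proof.
apply: rpred_sum => i _; apply: rpredZ.
have := homog_monom (n - i) i.
by rewrite subnK // -ltnS.
Qed.

Lemma fcoef_sum n (c : nat -> C) j : (j <= n)%N ->
  fcoef n (\sum_(i < n.+1) c i *: (var0 C ^+ (n - i) * var1 C ^+ i)) j = c j.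
Proof.
move=> jn; rewrite /fcoef raddf_sum /=.
rewrite (bigD1 (Ordinal (jn : (j < n.+1)%N))) //= big1 ?addr0.
  by rewrite monomE mcoeffZ mcoeffX eqxx mulr1.
move=> i ne; rewrite monomE mcoeffZ mcoeffX; case: eqP => [E|]; last by rewrite mulr0.
by case/eqP: ne; apply: ord_inj => /=; case: (mnm2_inj E).
Qed.

Lemma homog_scale n f (t : C) q : f \is n.-homog -> f.@(t *: q) = t ^+ n * f.@(q).
Proof.
move=> hf; rewrite !(form_ev _ hf) mulr_sumr; apply: eq_bigr => i _.
rewrite !mxE !exprMn.
have -> : t ^+ n = t ^+ (n - i) * t ^+ i by rewrite -exprD subnK // -ltnS.
ring.
Qed.

Lemma form_ev10 n f : f \is n.-homog -> f.@(pt 1 0) = fcoef n f 0.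
Proof.
move=> hf; rewrite (form_ev _ hf) big_ord_recl big1 => [|l _].
  by rewrite pt0E pt1E expr1n expr0 !mulr1 addr0.
by rewrite pt1E exprS mul0r !mulr0.
Qed.

Lemma form_ev01 n f : f \is n.-homog -> f.@(pt 0 1) = fcoef n f n.
Proof.
move=> hf; rewrite (form_ev _ hf) big_ord_recr big1 /= => [|l _].
  by rewrite pt0E pt1E expr1n subnn expr0 !mulr1 add0r.
have ln := ltn_ord l; have -> : (n - l = (n - l).-1.+1)%N by lia.
by rewrite pt0E exprS mul0r mul0r mulr0.
Qed.

Lemma homog_pos0 n f : f \is n.+1.-homog -> f.@(0 : 'cV[C]_2) = 0.
Proof. by move=> hf; rewrite -(scale0r 0) (homog_scale _ _ hf) exprS !mul0r. Qed.

Lemma homog0_const f : f \is 0.-homog -> f = (fcoef 0 f 0)%:MP.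
Proof.
by move=> /form_coefE{1}->; rewrite big_ord1 !expr0 mulr1 -mul_mpolyC mulr1.
Qed.

(** The origin carries no information on a form, except on a constant, whence the
    restriction to representatives of points of the projective line. *)
Lemma form_eq0 n f : f \is n.-homog -> (forall q, q != 0 -> f.@(q) = 0) -> f = 0.
Proof.
move=> hf f0; apply: (meval_dense var0_neq0).
by move=> q; rewrite var0_ev => q0; apply: f0; rewrite cV2_neq0 q0.
Qed.

Lemma form_zero n f : f \is n.+1.-homog -> exists2 q : 'cV[C]_2, q != 0 & f.@(q) = 0.
Proof.
move=> hf; pose p := \poly_(i < n.+2) fcoef n.+1 f i.
have pE x : p.[x] = f.@(pt 1 x).
  rewrite horner_poly (form_ev _ hf); apply: eq_bigr => i _.
  by rewrite pt0E pt1E expr1n mul1r.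
have [l0|l0] := eqVneq (fcoef n.+1 f n.+1) 0.
  exists (pt 0 1); first by rewrite pt_eq0 oner_eq0 andbF.
  rewrite (form_ev _ hf) big1 // => i _; rewrite pt0E pt1E expr1n mulr1 expr0n.
  case: eqP => [E|]; last by rewrite mulr0.
  suff -> : i = n.+1 :> nat by rewrite l0 mul0r.
  have := ltn_ord i; lia.
have sp : size p != 1%N.
  by rewrite size_poly_eq.
have [x /rootP px] := closed_rootP _ sp.
by exists (pt 1 x); [rewrite pt_eq0 oner_eq0 | rewrite -pE].
Qed.

(** * Linear factors and common zeros *)

Definition lin q : {mpoly C[2]} := q 1 0 *: var0 C - q 0 0 *: var1 C.

Lemma lin_homog q : lin q \is 1.-homog.
Proof. by rewrite rpredB // rpredZ // ?homog_var0 // homog_var1. Qed.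

Lemma lin_ev q q' : (lin q).@(q') = q 1 0 * q' 0 0 - q 0 0 * q' 1 0.
Proof. by rewrite mevalB !mevalZ var0_ev var1_ev. Qed.

Lemma lin_neq0 q : q != 0 -> lin q != 0.
Proof.
move=> q0; apply/eqP=> E.
have := congr1 (fun h => h.@(pt 1 0)) E; have := congr1 (fun h => h.@(pt 0 1)) E.
rewrite !lin_ev !meval0 !pt0E !pt1E mulr0 mulr1 add0r mulr1 mulr0 subr0.
move=> /eqP; rewrite oppr_eq0 => /eqP a0 b0.
by move: q0; rewrite cV2_neq0 a0 b0 eqxx.
Qed.

(** Modulo [q1 * x - q0 * y] one may replace [q1 * x] by [q0 * y], which turns
    [q1 ^ n * f] into [f q * y ^ n]. The case [q1 = 0] is that of the factor [y]. *)
Lemma lin_factor n f q : f \is n.+1.-homog -> q != 0 -> f.@(q) = 0 ->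
  exists2 k, k \is n.-homog & f = lin q * k.
Proof.
move=> hf q0 fq; pose c := fcoef n.+1 f.
have fE := form_coefE hf; move: (fq); rewrite (form_ev _ hf) => fs.
have [q10|q10] := eqVneq (q 1 0) 0.
  have q00 : q 0 0 != 0 by move: q0; rewrite cV2_neq0 q10 eqxx orbF.
  have c0 : c 0%N = 0.
    move: fs; rewrite big_ord_recl big1 => [|i _]; last by rewrite q10 exprS mul0r !mulr0.
    by rewrite addr0 expr0 mulr1 => /eqP; rewrite mulf_eq0 expf_eq0 (negPf q00) andbF orbF => /eqP.
  exists (- (q 0 0)^-1 *: \sum_(i < n.+1) c i.+1 *: (var0 C ^+ (n - i) * var1 C ^+ i)).
    by apply: rpredZ; apply: (homog_sum_monom n (fun i => c i.+1)).
  rewrite {1}fE big_ord_recl -/(c _) c0 scale0r add0r /lin q10 scale0r sub0r.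
  rewrite mulNr -scalerAl scalerAr scalerA mulrN mulfV // scaleN1r mulrN opprK mulr_sumr.
  by apply: eq_bigr => i _; rewrite -/(c _) -scalerAr subSS exprS; congr (_ *: _); ring.
pose X := q 1 0 *: var0 C; pose Y := q 0 0 *: var1 C.
pose k i := (\sum_(j < n.+1 - i) X ^+ ((n.+1 - i).-1 - j) * Y ^+ j) * var1 C ^+ i.
have hk (i : 'I_n.+2) : k i \is n.-homog.
  have [E|ne] := eqVneq (i : nat) n.+1.
    by rewrite /k E subnn big_ord0 mul0r rpred0.
  have lt : (i < n.+1)%N by have := ltn_ord i; lia.
  apply: (@homog_cast ((n.+1 - i).-1 + 1 * i)); first by lia.
  apply: dhomogM; last by apply: homogXn; apply: homog_var1.
  apply: rpred_sum => j _.
  apply: (@homog_cast (1 * ((n.+1 - i).-1 - j) + 1 * j)).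
    by have := ltn_ord j; lia.
  by apply: dhomogM; apply: homogXn; rewrite rpredZ ?homog_var0 ?homog_var1 //; lia.
have E (i : 'I_n.+2) : q 1 0 ^+ (n.+1 - i) *: (var0 C ^+ (n.+1 - i) * var1 C ^+ i)
    = lin q * k i + q 0 0 ^+ (n.+1 - i) *: var1 C ^+ n.+1.
  have YE : Y ^+ (n.+1 - i) * var1 C ^+ i = q 0 0 ^+ (n.+1 - i) *: var1 C ^+ n.+1.
    by rewrite /Y exprZn -scalerAl -exprD subnK // -ltnS.
  by rewrite /lin /k mulrA -subrXX mulrBl YE subrK /X exprZn -scalerAl.
exists (\sum_(i < n.+2) (c i / q 1 0 ^+ (n.+1 - i)) *: k i).
  by apply: rpred_sum => i _; apply: rpredZ; apply: hk.
have Z : \sum_(i < n.+2) ((q 1 0 ^+ n.+1)^-1 *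
    (c i * (q 0 0 ^+ (n.+1 - i) * q 1 0 ^+ i))) *: var1 C ^+ n.+1 = 0.
  by rewrite -scaler_suml -mulr_sumr fs mulr0 scale0r.
rewrite mulr_sumr {1}fE; apply/eqP; rewrite -subr_eq0; apply/eqP.
rewrite -[RHS]Z -sumrB; apply: eq_bigr => i _; rewrite -/(c i) -scalerAr.
have u : q 1 0 ^+ (n.+1 - i) != 0 by rewrite expf_neq0.
have -> : lin q * k i = q 1 0 ^+ (n.+1 - i) *: (var0 C ^+ (n.+1 - i) * var1 C ^+ i)
    - q 0 0 ^+ (n.+1 - i) *: var1 C ^+ n.+1 by rewrite E addrK.
rewrite scalerBr !scalerA divfK // opprB addrCA subrr addr0; congr (_ *: _).
have -> : q 1 0 ^+ n.+1 = q 1 0 ^+ (n.+1 - i) * q 1 0 ^+ i.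
  by rewrite -exprD subnK // -ltnS.
by field; rewrite u expf_neq0.
Qed.

Section Common.
Variables (I : finType) (n : nat) (a : I -> {mpoly C[2]}).
Hypothesis ha : forall i, a i \is n.-homog.
Hypothesis za : forall q, q != 0 -> exists i, (a i).@(q) != 0.

(** A form that divides [d * a i] for all [i] divides [d]: over an algebraically
    closed field it has a linear factor, which divides [d] because some [a i] does
    not vanish at its zero, and linear factors can be cancelled one at a time. *)
Lemma dvd_common m e h d : h \is e.-homog -> h != 0 -> d \is m.-homog -> d != 0 ->
  (forall i, exists k, d * a i = h * k) ->
  (e <= m)%N /\ exists2 k, k \is (m - e).-homog & d = h * k.
Proof.
elim: e m h d => [|e IH] m h d hh h0 hd d0 H.
  split=> //; rewrite subn0.
  have hE := homog0_const hh; set c := fcoef 0 h 0 in hE.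
  have c0 : c != 0 by apply: contra_neq h0 => c0; rewrite hE c0 mpolyC0.
  exists (c^-1 *: d); first by rewrite rpredZ.
  by rewrite hE mul_mpolyC scalerA mulfV // scale1r.
have [q q0 hq] := form_zero hh.
have [h' hh' hE] := lin_factor hh q0 hq.
have dq : d.@(q) = 0.
  have [i ai] := za q0; have [k E] := H i.
  have := congr1 (meval (fun i => q i 0)) E; rewrite !mevalM hq mul0r => /eqP.
  by rewrite mulf_eq0 (negPf ai) orbF => /eqP.
case: m hd => [|m] hd.
  case/eqP: d0; move: dq; rewrite (homog0_const hd) mevalC => ->.
  by rewrite mpolyC0.
have [d' hd' dE] := lin_factor hd q0 dq.
have l0 := lin_neq0 q0.
have h'0 : h' != 0 by apply: contra_neq h0 => h'0; rewrite hE h'0 mulr0.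
have d'0 : d' != 0 by apply: contra_neq d0 => d'0; rewrite dE d'0 mulr0.
have [|em [k hk E]] := IH m h' d' hh' h'0 hd' d'0.
  move=> i; have [k E] := H i; exists k; apply: (mulfI l0).
  by rewrite !mulrA -dE -hE.
by split=> //; exists k; rewrite ?subSS // dE hE E mulrA.
Qed.

(** The uniqueness of the representation of a map to projective space by forms
    without common zeros; it turns every pointwise proportionality below into an
    identity of forms. *)
Lemma prop_common m (b : I -> {mpoly C[2]}) :
  (forall i, b i \is m.-homog) -> (exists i, b i != 0) ->
  (forall i j, b i * a j = b j * a i) ->
  (n <= m)%N /\ exists2 k, k \is (m - n).-homog & forall i, b i = k * a i.
Proof.
move=> hb [i0 bi0] E.
have q1 : pt 1 1 != 0 by rewrite pt_eq0 oner_eq0.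
have [j aj] : exists j, a j != 0.
  have [j aj] := za q1; exists j; apply: contra_neq aj => ->; exact: meval0.
have bj : b j != 0.
  apply: contra_neq bi0 => bj; have := E i0 j; rewrite bj mul0r => /eqP.
  by rewrite mulf_eq0 (negPf aj) orbF => /eqP.
have [|nm [k hk kE]] := dvd_common (ha j) aj (hb j) bj.
  by move=> i; exists (b i); rewrite -E mulrC.
split=> //; exists k => // i; apply: (mulIf aj).
by rewrite E kE -mulrA mulrC.
Qed.

End Common.

End Forms.


(** * Restriction to lines and maps without common factor *)

Section Lines.
Variable C : numClosedFieldType.
Implicit Types (f h d : {mpoly C[2]}) (q : 'cV[C]_2).

Definition line q0 q1 : {mpoly C[2]} -> {poly C} :=
  mmap (@polyC C) (fun i => (q0 i 0)%:P + q1 i 0 *: 'X).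

Lemma horner_line q0 q1 f t : (line q0 q1 f).[t] = f.@(q0 + t *: q1).
Proof.
rewrite /line /mmap horner_sum mevalE; apply: eq_bigr => m _.
rewrite hornerM hornerC /mmap1 horner_prod; congr (_ * _).
apply: eq_bigr => i _; rewrite horner_exp hornerD hornerC hornerZ hornerX !mxE.
by rewrite mulrC.
Qed.

Lemma nonvanishing_const (p : {poly C}) t : (forall x, p.[x] != 0) -> p.[t] = p.[0].
Proof.
move=> np; suff /eqP/size_poly1P[c _ ->] : size p = 1%N by rewrite !hornerC.
apply/eqP; apply: contraT => /closed_rootP[x /rootP E].
by have := np x; rewrite E eqxx.
Qed.

(** On a line that misses the origin such a [d] restricts to a polynomial of one
    variable without zeros, hence to a constant; two such lines join any point off
    [y = 0] to [(1, 0)]. *)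
Lemma nonvanishing_mpoly d : (forall q, q != 0 -> d.@(q) != 0) ->
  exists c, d = c%:MP.
Proof.
move=> nd; exists d.@(pt 1 0); apply/eqP; rewrite -subr_eq0; apply/eqP.
apply: (meval_dense (var1_neq0 C)).
move=> q; rewrite var1_ev mevalB mevalC => q1.
have H1 x y : y != 0 -> d.@(pt x y) = d.@(pt 0 y).
  move=> y0; have E t : pt 0 y + t *: pt 1 0 = pt t y.
    by rewrite [LHS]ptE !mxE /= !(mulr0, mulr1, addr0, add0r).
  have := @nonvanishing_const (line (pt 0 y) (pt 1 0) d) x.
  rewrite !horner_line !E; apply=> t; rewrite horner_line E; apply: nd.
  by rewrite pt_eq0 (negPf y0) andbF.
have H2 y : d.@(pt 1 y) = d.@(pt 1 0).
  have E t : pt 1 0 + t *: pt 0 1 = pt 1 t.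
    by rewrite [LHS]ptE !mxE /= !(mulr0, mulr1, addr0, add0r).
  have := @nonvanishing_const (line (pt 1 0) (pt 0 1) d) y.
  rewrite !horner_line !E; apply=> t; rewrite horner_line E; apply: nd.
  by rewrite pt_eq0 oner_eq0.
by rewrite [q]ptE H1 // -(H1 1) // H2 subrr.
Qed.

End Lines.

Section Pmaps.
Variable C : numClosedFieldType.
Implicit Types (f h d : {mpoly C[2]}) (q : 'cV[C]_2).

(** A common zero of forms gives the common factor [lin q]; conversely, a common
    factor without zeros is constant. So being a map of degree [n] in the sense of
    common factors may be tested on points. *)
Lemma pmap_nozero m k n (G : 'M[{mpoly C[2]}]_(m, k)) : pmap_deg n G ->
  forall q, q != 0 -> exists i j, (G i j).@(q) != 0.
Proof.
move=> [hG cG] q q0.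
have [/existsP[i /existsP[j ?]]|N] := boolP [exists i, exists j, (G i j).@(q) != 0].
  by exists i, j.
have Z i j : (G i j).@(q) = 0.
  by apply/eqP; apply: contraNT N => ne; apply/existsP; exists i; apply/existsP; exists j.
have [|c E] := cG (lin q).
  move=> i j; case: n hG {cG} => [|n] hG.
    exists 0; rewrite mulr0 (homog0_const (hG i j)).
    by have := Z i j; rewrite {1}(homog0_const (hG i j)) mevalC => ->; rewrite mpolyC0.
  by have [h _ ->] := lin_factor (hG i j) q0 (Z i j); exists h.
have := homog_pos0 (lin_homog q); rewrite E mevalC => c0.
by have := lin_neq0 q0; rewrite E c0 mpolyC0 eqxx.
Qed.

Lemma nozero_pmap m k n (G : 'M[{mpoly C[2]}]_(m, k)) :
  (forall i j, G i j \is n.-homog) ->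
  (forall q, q != 0 -> exists i j, (G i j).@(q) != 0) -> pmap_deg n G.
Proof.
move=> hG zG; split=> // d D; apply: nonvanishing_mpoly => q q0.
have [i [j ne]] := zG q q0; have [h E] := D i j.
by apply: contra_neq ne => dq; rewrite E mevalM dq mul0r.
Qed.

Lemma lin_subst_ev (S : 'M[C]_2) f q : (lin_subst S f).@(q) = f.@(S *m q).
Proof.
rewrite /lin_subst comp_mpoly_meval; apply: meval_eq => i.
rewrite tnth_mktuple rmorph_sum /= !mxE; apply: eq_bigr => j _.
by rewrite mevalZ mevalXU.
Qed.

Lemma lin_subst_homog (S : 'M[C]_2) n f : f \is n.-homog -> lin_subst S f \is n.-homog.
Proof.
move=> hf; rewrite (form_coefE hf) /lin_subst rmorph_sum /=.
have hl (i : 'I_2) : 'X_i \mPo [tuple \sum_(j < 2) S i0 j *: 'X_j | i0 < 2] \is 1.-homog.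
  rewrite comp_mpolyXU -tnth_nth tnth_mktuple.
  by apply: rpred_sum => j _; apply: rpredZ; rewrite dhomogX; apply/eqP; exact: mdeg1.
apply: rpred_sum => i _; rewrite linearZ /=; apply: rpredZ.
rewrite rmorphM !rmorphXn /=.
apply: (@homog_cast _ (1 * (n - i) + 1 * i)); first by have := ltn_ord i; lia.
by apply: dhomogM; apply: homogXn; apply: hl.
Qed.

Lemma pevalE m k (G : 'M[{mpoly C[2]}]_(m, k)) q i j : peval G q i j = (G i j).@(q).
Proof. by rewrite mxE. Qed.

Lemma pevalM m k l (G : 'M[{mpoly C[2]}]_(m, k)) (H : 'M_(k, l)) q :
  peval (G *m H) q = peval G q *m peval H q.
Proof. exact: map_mxM. Qed.

Lemma peval_const m k (M : 'M[C]_(m, k)) q : peval (mpolyC_mx M) q = M.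
Proof. by apply/matrixP=> i j; rewrite !mxE mevalC. Qed.

Lemma peval_precomp m k (mu : 'M[C]_2) (G : 'M[{mpoly C[2]}]_(m, k)) q :
  peval (precomp mu G) q = peval G (mu *m q).
Proof. by apply/matrixP=> i j; rewrite !mxE lin_subst_ev. Qed.

Lemma peval_scale m k n (G : 'M[{mpoly C[2]}]_(m, k)) t q :
  (forall i j, G i j \is n.-homog) -> peval G (t *: q) = t ^+ n *: peval G q.
Proof. by move=> hG; apply/matrixP=> i j; rewrite !mxE (homog_scale _ _ (hG i j)). Qed.

Lemma unitmx_mul_neq0 (S : 'M[C]_2) q : S \in unitmx -> q != 0 -> S *m q != 0.
Proof.
by move=> Su; apply: contra_neq => E; rewrite -[q](mulKmx Su) E mulmx0.
Qed.

Lemma pmap_neq0 m k n (G : 'M[{mpoly C[2]}]_(m, k)) q : pmap_deg n G -> q != 0 ->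
  peval G q != 0.
Proof.
move=> pG q0; have [i [j ne]] := pmap_nozero pG q0.
by apply: contra_neq ne => /matrixP/(_ i j); rewrite pevalE mxE.
Qed.

Lemma pmap_of_neq0 m k n (G : 'M[{mpoly C[2]}]_(m, k)) :
  (forall i j, G i j \is n.-homog) -> (forall q, q != 0 -> peval G q != 0) ->
  pmap_deg n G.
Proof.
move=> hG nz; apply: nozero_pmap => // q q0.
have /existsP[i /existsP[j ne]] : [exists i, exists j, (G i j).@(q) != 0].
  apply: contraNT (nz q q0); rewrite negb_exists => /forallP E; apply/eqP/matrixP=> i j.
  rewrite pevalE [RHS]mxE; apply/eqP.
  by have := E i; rewrite negb_exists => /forallP/(_ j); rewrite negbK.
by exists i, j.
Qed.

End Pmaps.

(** * Projective equality *)

Section Proj.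
Variables (C : fieldType) (V : lmodType C).
Implicit Types (u v w : V).

Lemma proj_eq_refl v : v != 0 -> proj_eq v v.
Proof. by move=> v0; split=> //; exists 1; rewrite ?oner_eq0 ?scale1r. Qed.

Lemma proj_eq_sym v w : proj_eq v w -> proj_eq w v.
Proof.
move=> [v0 w0 [c c0 E]]; split=> //; exists c^-1; rewrite ?invr_eq0 //.
by rewrite E scalerA mulVf // scale1r.
Qed.

Lemma proj_eq_trans u v w : proj_eq u v -> proj_eq v w -> proj_eq u w.
Proof.
move=> [u0 _ [c c0 E]] [_ w0 [d d0 E']]; split=> //; exists (c * d).
  by rewrite mulf_neq0.
by rewrite E E' scalerA.
Qed.

Lemma proj_eqZ c v : c != 0 -> v != 0 -> proj_eq (c *: v) v.
Proof. by move=> c0 v0; split=> //; [rewrite scaler_eq0 negb_or c0 | exists c]. Qed.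

End Proj.

(** * Coordinates of products of linear forms *)

Section Homogenize.
Variable R : comNzRingType.
Implicit Types (p : {poly R}) (u v : R).

(** The homogenization of degree [n], evaluated at [(u, v)]. Binary sextics are
    multiplied as polynomials in one variable and evaluated through [homv]. *)
Definition homv n p u v : R := \sum_(i < n.+1) p`_i * (u ^+ (n - i) * v ^+ i).

Lemma homv1 u v : homv 0 1 u v = 1.
Proof. by rewrite /homv big_ord1 coef1 !expr0 !mulr1. Qed.

Lemma homvB n p p' u v : homv n (p - p') u v = homv n p u v - homv n p' u v.
Proof. by rewrite /homv -sumrB; apply: eq_bigr => i _; rewrite coefB mulrBl. Qed.

Lemma homv_lin n p a b u v : (size p <= n.+1)%N ->
  homv n.+1 ((a%:P + b *: 'X) * p) u v = (a * u + b * v) * homv n p u v.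
Proof.
move=> sp; have pn : p`_n.+1 = 0 by rewrite nth_default.
have E i : ((a%:P + b *: 'X) * p)`_i = a * p`_i + b * (if i is j.+1 then p`_j else 0).
  by rewrite mulrDl coefD coefCM -scalerAl coefZ coefXM; case: i.
rewrite /homv (eq_bigr (fun i : 'I_n.+2 => a * p`_i * (u ^+ (n.+1 - i) * v ^+ i) +
   b * (if i : nat is j.+1 then p`_j else 0) * (u ^+ (n.+1 - i) * v ^+ i))); last first.
  by move=> i _; rewrite E mulrDl.
rewrite big_split /= mulrDl; congr (_ + _).
  rewrite big_ord_recr /= pn mulr0 mul0r addr0 mulr_sumr; apply: eq_bigr => i _.
  by rewrite subSn ?exprS; [ring | rewrite -ltnS].
rewrite big_ord_recl /= mulr0 mul0r add0r mulr_sumr; apply: eq_bigr => i _.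
by rewrite /= /bump /= add1n subSS exprS; ring.
Qed.

Lemma size_lin_mul n p a b : (size p <= n)%N -> (size ((a%:P + b *: 'X) * p)%R <= n.+1)%N.
Proof.
move=> sp; apply: leq_trans (size_polyMleq _ _) _.
have : (size (a%:P + b *: 'X)%R <= 2)%N.
  apply: leq_trans (size_polyD _ _) _; rewrite geq_max.
  rewrite (leq_trans (size_polyC_leq1 _)) //=.
  by rewrite (leq_trans (size_scale_leq _ _)) // size_polyX.
lia.
Qed.

Definition oct (p r : R) : R := p * r * (p ^+ 4 - r ^+ 4).

(** The expression [oct p r] for [p = d - b T] and [r = a T - c], as nested products
    of linear factors in the shape that [homv_lin] evaluates. *)
Definition f1poly (a b c d : R) : {poly R} :=
  let p := d%:P + (- b) *: 'X in let r := (- c)%:P + a *: 'X in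
  p * (p * (p * (p * (p * (r * 1))))) - p * (r * (r * (r * (r * (r * 1))))).

Lemma homv_f1poly a b c d u v :
  homv 6 (f1poly a b c d) u v = oct (d * u - b * v) (a * v - c * u).
Proof.
rewrite /f1poly homvB !homv_lin ?homv1 ?size_lin_mul ?size_poly1 //.
by rewrite /oct; ring.
Qed.

End Homogenize.

Section F1.
Variable C : numClosedFieldType.
Implicit Types (q z : 'cV[C]_2) (M : 'M[C]_2) (g : 'M[{mpoly C[2]}]_2).

(** The coordinates of [f1 M] as polynomials in the entries of [M], over any ring:
    for a matrix [g] of forms, [f1c g] is the vector of forms that represents
    [f1 o g]. *)
Definition f1c (R : comNzRingType) (M : 'M[R]_2) : 'rV[R]_7 :=
  \row_i (f1poly (M 0 0) (M 0 1) (M 1 0) (M 1 1))`_i.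

Definition sval (c : 'rV[C]_7) z : C :=
  \sum_(i < 7) c 0 i * (z 0 0 ^+ (6 - i) * z 1 0 ^+ i).

Lemma sextic_ev c z : (sextic_of c).@(z) = sval c z.
Proof.
rewrite /sextic_of rmorph_sum /=; apply: eq_bigr => i _.
by rewrite mevalZ mevalM !rmorphXn /= var0_ev var1_ev.
Qed.

Lemma sval_f1c M z :
  sval (f1c M) z = oct (M 1 1 * z 0 0 - M 0 1 * z 1 0) (M 0 0 * z 1 0 - M 1 0 * z 0 0).
Proof.
by rewrite -homv_f1poly /sval /homv; apply: eq_bigr => i _; rewrite mxE.
Qed.

Lemma f1_ev M z :
  (f1 M).@(z) = oct (M 1 1 * z 0 0 - M 0 1 * z 1 0) (M 0 0 * z 1 0 - M 1 0 * z 0 0).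
Proof.
by rewrite /f1 !(mevalM, mevalB, rmorphXn) /= !(mevalM, mevalB, mevalZ) var0_ev var1_ev.
Qed.

Lemma sextic_f1c M : sextic_of (f1c M) = f1 M.
Proof. by apply: meval_inj => z; rewrite sextic_ev sval_f1c f1_ev. Qed.

Lemma coords6_sextic (c : 'rV[C]_7) : coords6 (sextic_of c) = c.
Proof.
apply/rowP=> j; rewrite mxE.
have := @fcoef_sum C 6 (fun i => c 0 (inord i)) j; rewrite inord_val => <-.
  by rewrite /fcoef; congr (_@_ _); apply: eq_bigr => i _; rewrite inord_val.
by rewrite -ltnS.
Qed.

Lemma sextic_coords6 (f : {mpoly C[2]}) : f \is 6.-homog -> sextic_of (coords6 f) = f.
Proof.
by move=> hf; rewrite {2}(form_coefE hf); apply: eq_bigr => i _; rewrite mxE.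
Qed.

Lemma sextic_inj : injective (@sextic_of C).
Proof. by move=> c c' E; rewrite -[c]coords6_sextic E coords6_sextic. Qed.

Lemma sextic_Z a (c : 'rV[C]_7) : sextic_of (a *: c) = a *: sextic_of c.
Proof.
by rewrite /sextic_of scaler_sumr; apply: eq_bigr => i _; rewrite mxE scalerA.
Qed.

Lemma sextic_0 : sextic_of (0 : 'rV[C]_7) = 0.
Proof. by rewrite -(scale0r 0) sextic_Z scale0r. Qed.

Lemma sextic_eq0 (c : 'rV[C]_7) : (sextic_of c == 0) = (c == 0).
Proof. by apply/eqP/eqP=> [|->]; rewrite ?sextic_0 // -{1}sextic_0 => /sextic_inj. Qed.

Lemma svalZ a (c : 'rV[C]_7) z : sval (a *: c) z = a * sval c z.
Proof. by rewrite -!sextic_ev sextic_Z mevalZ. Qed.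

Lemma sval_inj (c c' : 'rV[C]_7) : (forall z, sval c z = sval c' z) -> c = c'.
Proof. by move=> E; apply: sextic_inj; apply: meval_inj => z; rewrite !sextic_ev. Qed.

Lemma map_f1c (R S : comNzRingType) (f : {rmorphism R -> S}) (M : 'M[R]_2) :
  f1c (map_mx f M) = map_mx f (f1c M).
Proof.
apply/rowP=> i; rewrite !mxE -coef_map; congr (_`_i).
have fl a b : map_poly f (a%:P + b *: 'X) = (f a)%:P + f b *: 'X.
  by rewrite rmorphD /= map_polyC map_polyZ map_polyX.
by rewrite /f1poly rmorphB !rmorphM /= !rmorph1 !fl /= !rmorphN.
Qed.

Lemma peval_f1c g q : peval (f1c g) q = f1c (peval g q).
Proof. by rewrite /peval -map_f1c. Qed.

Definition homog_coefs n (p : {poly {mpoly C[2]}}) := forall i, p`_i \is n.-homog.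

Lemma homog_coefsM m n p p' : homog_coefs m p -> homog_coefs n p' ->
  homog_coefs (m + n) (p * p').
Proof. by move=> hp hp' i; rewrite coefM; apply: rpred_sum => j _; apply: dhomogM. Qed.

Lemma homog_coefs_lin n (a b : {mpoly C[2]}) : a \is n.-homog -> b \is n.-homog ->
  homog_coefs n (a%:P + b *: 'X).
Proof.
move=> ha hb i; rewrite coefD coefC coefZ coefX.
by apply: rpredD; case: eqP => _; rewrite ?mulr1 ?mulr0 ?rpred0.
Qed.

Lemma f1c_homog n g i j : (forall i j, g i j \is n.-homog) -> f1c g i j \is (6 * n).-homog.
Proof.
move=> hg; rewrite mxE /f1poly /=.
set p := (_%:P + - g 0 1 *: 'X); set r := (_%:P + g 0 0 *: 'X).
have hp : homog_coefs n p by apply: homog_coefs_lin; rewrite ?rpredN.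
have hr : homog_coefs n r by apply: homog_coefs_lin; rewrite ?rpredN.
have h1 : homog_coefs 0 1.
  by move=> k; rewrite coef1; case: eqP => _; rewrite ?rpred0 // dhomog1.
rewrite coefB; apply: rpredB; apply: (@homog_cast _ (n + (n + (n + (n + (n + (n + 0)))))));
  by [lia | do 6 (apply: homog_coefsM => //)].
Qed.

End F1.


(** * Matrices of size two *)

Section Mx2.
Variable R : comNzRingType.

Definition mx2 (a b c d : R) : 'M[R]_2 :=
  \matrix_(i, j) (if i == 0 then if j == 0 then a else b
                  else if j == 0 then c else d).

Lemma mul2E m n (A : 'M[R]_(m, 2)) (B : 'M[R]_(2, n)) i j :
  (A *m B) i j = A i 0 * B 0 j + A i 1 * B 1 j.
Proof. by rewrite mxE big_ord_recl big_ord1; congr (_ + A i _ * B _ j); apply/eqP. Qed.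

Lemma sclE m n (a : R) (A : 'M[R]_(m, n)) i j : (a *: A) i j = a * A i j.
Proof. by rewrite mxE. Qed.

Lemma ord2P (i : 'I_2) : i = 0 \/ i = 1.
Proof. by case: i => [[|[|//]] Hi]; [left|right]; apply/eqP. Qed.

Lemma mx2P (A B : 'M[R]_2) :
  A 0 0 = B 0 0 -> A 0 1 = B 0 1 -> A 1 0 = B 1 0 -> A 1 1 = B 1 1 -> A = B.
Proof.
by move=> ? ? ? ?; apply/matrixP=> i j; case: (ord2P i) => ->; case: (ord2P j) => ->.
Qed.

Lemma cv2P (v w : 'cV[R]_2) : v 0 0 = w 0 0 -> v 1 0 = w 1 0 -> v = w.
Proof. by move=> ? ?; apply/matrixP=> i j; rewrite (ord1 j); case: (ord2P i) => ->. Qed.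

Lemma mx2E a b c d : (mx2 a b c d 0 0 = a) * (mx2 a b c d 0 1 = b)
  * (mx2 a b c d 1 0 = c) * (mx2 a b c d 1 1 = d).
Proof. by rewrite !mxE. Qed.

Lemma det2E (A : 'M[R]_2) : \det A = A 0 0 * A 1 1 - A 0 1 * A 1 0.
Proof.
rewrite (expand_det_row _ 0) big_ord_recl big_ord1 /cofactor !det_mx11 !mxE /=.
have -> : lift ord0 ord0 = 1 :> 'I_2 by apply/eqP.
have -> : lift (1 : 'I_2) ord0 = 0 :> 'I_2 by apply/eqP.
by rewrite expr0 expr1 !mul1r mulN1r mulrN.
Qed.

End Mx2.

Section Linear.
Variable C : numClosedFieldType.
Implicit Types (q v w : 'cV[C]_2) (M P S T : 'M[C]_2).

Lemma ker2 M : \det M = 0 -> exists2 v : 'cV[C]_2, v != 0 & M *m v = 0.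
Proof.
rewrite -det_tr => /eqP/det0P[v v0 E]; exists v^T.
  by apply: contra_neq v0 => /(congr1 trmx); rewrite trmxK trmx0.
by rewrite -[M]trmxK -trmx_mul E trmx0.
Qed.

Lemma unit2 M : (M \in unitmx) = (\det M != 0).
Proof. by rewrite unitmxE unitfE. Qed.

Definition adj2 M : 'M[C]_2 := mx2 (M 1 1) (- M 0 1) (- M 1 0) (M 0 0).

Lemma mul_adj2 M : M *m adj2 M = (\det M)%:M.
Proof.
by apply: mx2P; rewrite mul2E !mx2E !mxE /= det2E ?mulr0n ?mulr1n; ring.
Qed.

Lemma adj2_mul M : adj2 M *m M = (\det M)%:M.
Proof.
by apply: mx2P; rewrite mul2E !mx2E !mxE /= det2E ?mulr0n ?mulr1n; ring.
Qed.

Lemma inv2E M : M \in unitmx -> invmx M = (\det M)^-1 *: adj2 M.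
Proof.
move=> Mu; have d0 : \det M != 0 by rewrite -unit2.
rewrite -[adj2 M](mulKmx Mu) mul_adj2 mul_mx_scalar scalerA mulVf //.
by rewrite scale1r.
Qed.

Lemma det1_unit M : \det M = 1 -> M \in unitmx.
Proof. by rewrite unit2 => ->; apply: oner_neq0. Qed.

Lemma root_exists n (x : C) : (0 < n)%N -> exists y : C, y ^+ n = x.
Proof. by move=> n0; exists (n.-root x); apply: rootCK. Qed.

Lemma imag_sqr : ('i : C) ^+ 2 = -1. Proof. exact: sqrCi. Qed.
Lemma imag_neq0 : ('i : C) != 0.
Proof. by apply/eqP=> E; have := imag_sqr; rewrite E expr0n /= => /eqP; rewrite eq_sym oppr_eq0 oner_eq0. Qed.
Lemma two_neq0 : (2 : C) != 0. Proof. by rewrite pnatr_eq0. Qed.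
Lemma imag_neq1 : ('i : C) != 1.
Proof.
apply/eqP=> E; have := imag_sqr; rewrite E expr1n => /eqP.
by rewrite -addr_eq0 (negPf two_neq0).
Qed.
Lemma imag_neqN1 : ('i : C) != -1.
Proof.
apply/eqP=> E; have := imag_sqr; rewrite E sqrrN expr1n => /eqP.
by rewrite -addr_eq0 (negPf two_neq0).
Qed.
Lemma one_neqN1 : (1 : C) != -1. Proof. by rewrite -addr_eq0 two_neq0. Qed.

(** The eigenvalues of a matrix of order four in the projective group have
    ratio ['i]: by the Cayley-Hamilton theorem the fourth power is scalar only
    if the trace vanishes (then so is the square) or if [tr^2 = 2 det]. *)
Lemma diag_order4 M c : M *m M *m (M *m M) = c%:M ->
  (forall e, M *m M != e%:M) ->
  exists P mu, [/\ P \in unitmx, mu != 0 & M *m P = P *m mx2 ('i * mu) 0 0 mu].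
Proof.
move=> M4 M2.
pose t := M 0 0 + M 1 1; pose d := \det M.
have CH : M *m M = t *: M - d%:M.
  by apply: mx2P; rewrite mul2E !mxE /= /d det2E /t ?mulr0n ?mulr1n; ring.
have al0 : t * (t ^+ 2 - 2 * d) = 0.
  pose al := t * (t ^+ 2 - 2 * d).
  have E4 : M *m M *m (M *m M) = al *: M + (d ^+ 2 - t ^+ 2 * d)%:M.
    rewrite {1}CH mulmxBl -scalemxAl mul_scalar_mx mulmxA CH mulmxBl -scalemxAl CH.
    rewrite mul_scalar_mx; apply: mx2P; rewrite !mxE /= ?mulr0n ?mulr1n /al; ring.
  have [//|al0] := eqVneq al 0.
  move: E4; rewrite M4 => E4.
  have Ms : M = (al^-1 * (c - (d ^+ 2 - t ^+ 2 * d)))%:M.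
    rewrite -scale_scalar_mx raddfB /= E4 addrK scalerA mulVf // scale1r //.
  by have /eqP[] := M2 ((al^-1 * (c - (d ^+ 2 - t ^+ 2 * d))) ^+ 2); rewrite {1 2}Ms -scalar_mxM.
have t0 : t != 0.
  apply/eqP=> t0; have /eqP[] := M2 (- d); rewrite CH t0 scale0r sub0r.
  by rewrite raddfN.
move/eqP: al0; rewrite mulf_eq0 (negPf t0) /= subr_eq0 => /eqP td.
pose mu := t * (1 - 'i) / 2.
have n2 := two_neq0; have i2 := imag_sqr.
have mu0 : mu != 0.
  by rewrite !mulf_neq0 ?invr_eq0 // subr_eq0 eq_sym imag_neq1.
have root2 (l : C) : l ^+ 2 - t * l + d = 0 -> exists2 v : 'cV[C]_2, v != 0 & M *m v = l *: v.
  move=> E; have [|v v0 H] := @ker2 (M - l%:M).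
    rewrite -E det2E !mxE /= ?mulr0n ?mulr1n /d det2E /t; ring.
  exists v => //; apply/eqP; rewrite -subr_eq0 -mul_scalar_mx -mulmxBl H //.
have d2 : d = t ^+ 2 / 2 by rewrite td mulrAC mulfV // mul1r.
have [v v0 Mv] : exists2 v : 'cV[C]_2, v != 0 & M *m v = ('i * mu) *: v.
  apply: root2; rewrite d2 /mu.
  have -> : ('i * (t * (1 - 'i) / 2)) = t * ('i - 'i ^+ 2) / 2 :> C by ring.
  rewrite i2.
  have -> : (t * ('i - -1) / 2) ^+ 2 = t ^+ 2 * ('i ^+ 2 + 2 * 'i + 1) / 4 :> C by field.
  by rewrite i2; field.
have [w w0 Mw] : exists2 v : 'cV[C]_2, v != 0 & M *m v = mu *: v.
  apply: root2; rewrite d2 /mu.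
  have -> : (t * (1 - 'i) / 2) ^+ 2 = t ^+ 2 * ('i ^+ 2 - 2 * 'i + 1) / 4 :> C by field.
  by rewrite i2; field.
pose P := mx2 (v 0 0) (w 0 0) (v 1 0) (w 1 0).
have PE k : P *m k = k 0 0 *: v + k 1 0 *: w.
  by apply: cv2P; rewrite mul2E !mx2E !mxE; ring.
exists P, mu; split=> //.
  rewrite unit2; apply/eqP=> /ker2[k k0]; rewrite PE => E.
  have E2 : (k 0 0 * ('i * mu)) *: v + (k 1 0 * mu) *: w = 0.
    by rewrite -[(_ * ('i * mu)) *: v]scalerA -[_ *: w]scalerA -Mv -Mw !scalemxAr -mulmxDr E mulmx0.
  have : (k 0 0 * (('i - 1) * mu)) *: v = 0.
    have := congr1 (fun x => mu *: x) E; rewrite scaler0 scalerDr !scalerA => E1.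
    rewrite -[RHS](subrr 0) -{1}E2 -E1 [mu * _]mulrC [mu * k 1 0]mulrC.
    by rewrite opprD addrACA subrr addr0 -scalerBl; congr (_ *: _); ring.
  have nn : ('i - 1) * mu != 0 by rewrite mulf_neq0 // subr_eq0 imag_neq1.
  move/eqP; rewrite scaler_eq0 (negPf v0) orbF mulf_eq0 (negPf nn) orbF => /eqP k00.
  move: E; rewrite k00 scale0r add0r => /eqP; rewrite scaler_eq0 (negPf w0) orbF => /eqP k10.
  by move: k0; rewrite cV2_neq0 k00 k10 eqxx.
have := (congr1 (fun x : 'cV_2 => x 0 0) Mv, congr1 (fun x : 'cV_2 => x 1 0) Mv).
have := (congr1 (fun x : 'cV_2 => x 0 0) Mw, congr1 (fun x : 'cV_2 => x 1 0) Mw).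
rewrite !mul2E !mxE => -[w0E w1E] [v0E v1E].
by apply: mx2P; rewrite !mul2E !mx2E ?v0E ?v1E ?w0E ?w1E; ring.
Qed.

End Linear.

(** * Cyclic coverings of degree four *)

Section Covering.
Variable C : numClosedFieldType.
Implicit Types (q : 'cV[C]_2) (S P T : 'M[C]_2) (phi : 'cV[{mpoly C[2]}]_2).

Lemma deck1 phi d : pmap_deg d phi -> deck phi 1%:M.
Proof.
move=> hphi; split; first exact: unitmx1.
by move=> q q0; rewrite mul1mx; apply: proj_eq_refl; apply: pmap_neq0 hphi q0.
Qed.

Lemma deckM phi S T : deck phi S -> deck phi T -> deck phi (S *m T).
Proof.
move=> [Su hS] [Tu hT]; split; first by rewrite unitmx_mul Su.
move=> q q0; rewrite -mulmxA; apply: proj_eq_trans (hS _ _) (hT _ q0).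
exact: unitmx_mul_neq0.
Qed.

Lemma deckX phi d S k : pmap_deg d phi -> deck phi S -> deck phi (S ^+ k).
Proof.
move=> hphi hS; elim: k => [|k IH]; first exact: deck1 hphi.
by rewrite exprS; apply: deckM.
Qed.

Lemma proj_exp_cancel S (a b : nat) : S \in unitmx -> (a <= b)%N ->
  proj_eq (S ^+ a) (S ^+ b) -> proj_eq (S ^+ (b - a)) 1.
Proof.
move=> Su ab [Sa0 Sb0 [c c0 E]].
have Sau : S ^+ a \is a GRing.unit by rewrite unitrX.
split; rewrite ?oner_eq0 //.
  by apply: contra_neq Sb0 => E0; rewrite -(subnK ab) exprD E0 mul0r.
exists c^-1; rewrite ?invr_eq0 //.
apply: (mulIr Sau); rewrite -exprD subnK // -scalerAl mul1r E scalerA mulVf //.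
by rewrite scale1r.
Qed.

Lemma proj_exp_period S (m k : nat) : S \in unitmx -> proj_eq (S ^+ m) 1 ->
  proj_eq (S ^+ k) (S ^+ (k %% m)).
Proof.
move=> Su [Sm0 _ [c c0 E]].
have nz j : S ^+ j != 0.
  by apply/eqP=> E0; have := unitrX j (Su : S \is a GRing.unit); rewrite E0 unitr0.
split=> //; exists (c ^+ (k %/ m)); first by rewrite expf_neq0.
by rewrite {1}(divn_eq k m) exprD mulnC exprM E exprZn expr1n -scalerAl mul1r.
Qed.

(** The powers of a generator of period [m] represent at most [m] deck
    transformations, so the period is at least four; among the first five powers two
    agree, so it is at most four. *)
Lemma deck_generator phi : galois_covering 4 phi -> deck_cyclic phi ->
  exists S, [/\ deck phi S, exists2 c, c != 0 & S *m S *m (S *m S) = c%:M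
    & forall e, S *m S != e%:M].
Proof.
move=> [_ hphi [s [hs inj_s surj_s]]] [S hS gen]; have Su : S \in unitmx by case: hS.
have period m : (0 < m)%N -> proj_eq (S ^+ m) 1 -> (4 <= m)%N.
  move=> m0 Sm.
  have [k hk] := @fin_all_exists _ _ _ (fun i => gen _ (hs i)).
  pose f i : 'I_m := Ordinal (ltn_pmod (k i) m0).
  have f_inj : injective f.
    move=> i j /(congr1 val) /= E; apply: inj_s.
    apply: proj_eq_trans (hk i) _; apply: proj_eq_trans (proj_exp_period _ Su Sm) _.
    rewrite E; apply: proj_eq_sym; apply: proj_eq_trans (hk j) _.
    exact: proj_exp_period.
  by have := leq_card f f_inj; rewrite !card_ord.
have [f hf] := @fin_all_exists 'I_5 _ _ (fun i => surj_s _ (deckX i hphi hS)).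
have [i [j [ij E]]] : exists i j : 'I_5, (i < j)%N /\ f i = f j.
  have : ~~ injectiveb f.
    by apply/injectiveP=> /leq_card; rewrite !card_ord.
  move/injectivePn=> [i [j ne E]].
  by case: (ltngtP i j) => [lt|lt|/val_inj e]; [exists i, j | exists j, i | case/eqP: ne].
have P : proj_eq (S ^+ (j - i)) 1.
  apply: proj_exp_cancel => //; first exact: ltnW.
  by apply: proj_eq_trans (hf i) _; rewrite E; apply: proj_eq_sym.
have ji : (j - i = 4)%N.
  by have := period _ _ P; rewrite subn_gt0 => /(_ ij); have := ltn_ord j; lia.
exists S; split=> //.
  move: P; rewrite ji => -[_ _ [c c0 E4]]; exists c => //.
  by rewrite -[LHS]/((S * S) * (S * S)) -expr2 -[S * S]expr2 -exprM E4 -scalemx1.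
move=> e; apply/eqP=> E2; have := period 2 isT.
have e0 : e != 0.
  apply/eqP=> e0; have : S *m S \in unitmx by rewrite unitmx_mul Su.
  by rewrite E2 e0 unit2 det_scalar expr0n eqxx.
suff H : proj_eq (S ^+ 2) 1 by move/(_ H).
rewrite expr2 /GRing.mul /= E2 -scalemx1; apply: proj_eqZ => //.
exact: oner_neq0.
Qed.

Lemma power4_ev q : peval (power4 C) q = pt (q 0 0 ^+ 4) (q 1 0 ^+ 4).
Proof.
by apply: cv2P; rewrite !mxE /= rmorphXn /= ?var0_ev ?var1_ev.
Qed.

Lemma fcoef_diag n (f : {mpoly C[2]}) a b j : f \is n.-homog -> (j <= n)%N ->
  fcoef n (lin_subst (mx2 a 0 0 b) f) j = a ^+ (n - j) * b ^+ j * fcoef n f j.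
Proof.
move=> hf jn.
have -> : lin_subst (mx2 a 0 0 b) f = \sum_(i < n.+1)
   (a ^+ (n - i) * b ^+ i * fcoef n f i) *: (var0 C ^+ (n - i) * var1 C ^+ i).
  apply: meval_inj => q; rewrite lin_subst_ev (form_ev _ hf) rmorph_sum /=.
  apply: eq_bigr => i _; rewrite mevalZ mevalM !rmorphXn /= var0_ev var1_ev.
  by rewrite !mul2E !mx2E !mul0r add0r addr0 !exprMn; ring.
exact: (fcoef_sum (fun i => a ^+ (n - i) * b ^+ i * fcoef n f i)).
Qed.

(** In eigencoordinates of a generator of the deck group the two components of
    [phi] are eigenvectors of [x |-> 'i x] for the same eigenvalue. Since they do
    not both vanish at [x = 0] the eigenvalue is that of [y^4], so that only the
    monomials [x^4] and [y^4] occur, and a Moebius transformation of the target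
    separates them. *)
Lemma covering_normal phi : galois_covering 4 phi -> deck_cyclic phi ->
  exists mu nu : 'M[C]_2, moebius_conj mu nu phi (power4 C).
Proof.
move=> gphi cphi; have [S [hS [c c0 S4] S2]] := deck_generator gphi cphi.
have [_ hphi _] := gphi.
have [P [m [Pu m0 SP]]] := diag_order4 S4 S2.
pose D : 'M[C]_2 := mx2 'i 0 0 1.
have hom i j : precomp P phi i j \is 4.-homog.
  by rewrite mxE; apply: lin_subst_homog; case: hphi.
have nz q : q != 0 -> exists i, (precomp P phi i 0).@(q) != 0.
  move=> q0; have [i [j]] := pmap_nozero hphi (unitmx_mul_neq0 Pu q0).
  by rewrite (ord1 j) => ne; exists i; rewrite mxE lin_subst_ev.
have prec i q : (precomp P phi i 0).@(q) = (phi i 0).@(P *m q).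
  by rewrite mxE lin_subst_ev.
have prop i j : lin_subst D (precomp P phi i 0) * precomp P phi j 0
     = lin_subst D (precomp P phi j 0) * precomp P phi i 0.
  apply/eqP; rewrite -subr_eq0; apply/eqP; apply: (@form_eq0 _ (4 + 4)).
    by apply: rpredB; apply: dhomogM => //; apply: lin_subst_homog.
  move=> q q0; rewrite mevalB !mevalM !lin_subst_ev !prec.
  have Du : D \in unitmx by rewrite unit2 det2E !mx2E mulr1 mul0r subr0 imag_neq0.
  have [_ /(_ _ (unitmx_mul_neq0 Pu q0))] := hS.
  have -> : S *m (P *m q) = m *: (P *m (D *m q)).
    rewrite mulmxA SP -mulmxA scalemxAr; congr (P *m _).
    by apply: cv2P; rewrite !(mul2E, sclE, mx2E); ring.
  have hphi1 : forall i j, phi i j \is 4.-homog by case: hphi.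
  rewrite (peval_scale _ _ hphi1) => -[_ _ [e e0 E]].
  have E' k : m ^+ 4 * (phi k 0).@(P *m (D *m q)) = e * (phi k 0).@(P *m q).
    by have := congr1 (fun x : 'cV_2 => x k 0) E; rewrite /= !mxE.
  apply/eqP; rewrite subr_eq0; apply/eqP.
  apply: (mulfI (expf_neq0 4 m0)); rewrite !mulrA !E'; ring.
have [|||_ [k hk kE]] := @prop_common C _ 4 (fun i => precomp P phi i 0) _ nz 4
   (fun i => lin_subst D (precomp P phi i 0)) _ _ prop.
- by move=> i; apply: hom.
- by move=> i; apply: lin_subst_homog; apply: hom.
- have q1 : pt (1 : C) 1 != 0 by rewrite pt_eq0 oner_eq0.
  have Du : D *m pt 1 1 != 0.
    apply: unitmx_mul_neq0 => //.
    by rewrite unit2 det2E !mx2E mulr1 mul0r subr0 imag_neq0.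
  have [i ne] := nz _ Du; exists i.
  by rewrite -lin_subst_ev in ne; apply: contra_neq ne => ->; rewrite meval0.
pose e := fcoef 0 k 0; have kc : k = e%:MP by apply: homog0_const.
pose F i j := fcoef 4 (precomp P phi i 0) j.
have Fe i j : (j <= 4)%N -> 'i ^+ (4 - j) * F i j = e * F i j.
  move=> j4; have := fcoef_diag 'i 1 (hom i 0) j4.
  rewrite expr1n mulr1 -/D kE kc mul_mpolyC => <-.
  by rewrite /fcoef mcoeffZ.
have e1 : e = 1.
  have q1 : pt (0 : C) 1 != 0 by rewrite pt_eq0 oner_eq0 andbF.
  have [i ne] := nz _ q1; rewrite (form_ev01 (hom i 0)) in ne.
  by have := Fe i 4%N isT; rewrite subnn expr0 => /(mulIf ne).
have F0 i j : (0 < j < 4)%N -> F i j = 0.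
  move=> j4; have j5 : (j <= 4)%N by lia.
  have /eqP := Fe i j j5; rewrite e1.
  rewrite -subr_eq0 -mulrBl mulf_eq0 => /orP[|/eqP//].
  rewrite subr_eq0; case: j j4 {j5} => [|[|[|[|]]]] // _; rewrite /= ?subSS ?subn0.
  - by rewrite exprS imag_sqr mulrN1 eqr_oppLR (negPf (imag_neqN1 _)).
  - by rewrite imag_sqr eq_sym (negPf (one_neqN1 _)).
  - by rewrite expr1 (negPf (imag_neq1 _)).
pose N := mx2 (F 0 0%N) (F 0 4%N) (F 1 0%N) (F 1 4%N).
have ev q : peval (precomp P phi) q = N *m pt (q 0 0 ^+ 4) (q 1 0 ^+ 4).
  have E i : peval (precomp P phi) q i 0 = F i 0%N * q 0 0 ^+ 4 + F i 4%N * q 1 0 ^+ 4.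
    rewrite pevalE (form_ev _ (hom i 0)).
    rewrite (eq_bigr (fun j : 'I_5 => F i j * (q 0 0 ^+ (4 - j) * q 1 0 ^+ j))) //.
    rewrite !big_ord_recr big_ord0 /= (F0 i 1%N) // (F0 i 2%N) // (F0 i 3%N) //.
    by rewrite !(mul0r, add0r, addr0, subnn, subn0, expr0, mulr1, mul1r).
  by apply: cv2P; rewrite E mul2E !mx2E pt0E pt1E //.
have Nu : N \in unitmx.
  rewrite unit2; apply/eqP=> /ker2[v v0 Nv].
  have [x xE] := root_exists (v 0 0) (isT : (0 < 4)%N).
  have [y yE] := root_exists (v 1 0) (isT : (0 < 4)%N).
  have q0 : pt x y != 0.
    have X0 : (x == 0) = (v 0 0 == 0) by rewrite -xE expf_eq0.
    have Y0 : (y == 0) = (v 1 0 == 0) by rewrite -yE expf_eq0.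
    by rewrite pt_eq0 negb_and X0 Y0 -cV2_neq0.
  have [i ne0] := nz _ q0; move: ne0; rewrite -pevalE ev pt0E pt1E xE yE -ptE Nv mxE eqxx //.
exists P, (invmx N); split; rewrite ?unitmx_inv //.
move=> q q0; rewrite pevalM peval_const ev mulKmx // power4_ev.
apply: proj_eq_refl; rewrite pt_eq0 !expf_eq0 /= negb_and.
by rewrite -cV2_neq0.
Qed.

End Covering.


(** * The content of the composite with f1 *)

(** The coefficients of [f1poly] written out, which makes polynomial identities
    in them accessible to the ring tactic. *)
Definition f1coef (R : comNzRingType) (a b c d : R) : seq R :=
  [:: d ^+ 5 * (- c) - d * (- c) ^+ 5;
      5 * d ^+ 4 * (- b) * (- c) + d ^+ 5 * a
        - (d * (5 * (- c) ^+ 4 * a) + (- b) * (- c) ^+ 5);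
      10 * d ^+ 3 * b ^+ 2 * (- c) + 5 * d ^+ 4 * (- b) * a
        - (d * (10 * (- c) ^+ 3 * a ^+ 2) + (- b) * (5 * c ^+ 4 * a));
      10 * d ^+ 2 * (- b) ^+ 3 * (- c) + 10 * d ^+ 3 * b ^+ 2 * a
        - (d * (10 * c ^+ 2 * a ^+ 3) + (- b) * (10 * (- c) ^+ 3 * a ^+ 2));
      5 * d * b ^+ 4 * (- c) + 10 * d ^+ 2 * (- b) ^+ 3 * a
        - (d * (5 * (- c) * a ^+ 4) + (- b) * (10 * c ^+ 2 * a ^+ 3));
      (- b) ^+ 5 * (- c) + 5 * d * b ^+ 4 * a
        - (d * a ^+ 5 + (- b) * (5 * (- c) * a ^+ 4));
      (- b) ^+ 5 * a - (- b) * a ^+ 5].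

(** Horner form of [f1poly], with the constant polynomials abstracted to elements
    of a commutative ring so that the ring tactic applies. *)
Lemma f1coef_ident (S : comNzRingType) (a' b' c' d' x : S) :
  (d' + - b' * x) * ((d' + - b' * x) * ((d' + - b' * x) * ((d' + - b' * x)
    * ((d' + - b' * x) * ((- c' + a' * x) * 1)))))
  - (d' + - b' * x) * ((- c' + a' * x) * ((- c' + a' * x) * ((- c' + a' * x)
    * ((- c' + a' * x) * ((- c' + a' * x) * 1)))))
  = foldr (fun y s => s * x + y) 0 (f1coef a' b' c' d').
Proof.
by rewrite /f1coef /=; ring.
Qed.

Lemma dvd_comb (R : comNzRingType) (h k k' a b c d x y : R) :
  (a * (h * k) + b * (h * k')) * x + (c * (h * k) + d * (h * k')) * y
  = h * ((a * k + b * k') * x + (c * k + d * k') * y).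
Proof. ring. Qed.

Lemma f1coef_morph (R S : comNzRingType) (f : {rmorphism R -> S}) a b c d :
  f1coef (f a) (f b) (f c) (f d) = map f (f1coef a b c d).
Proof.
rewrite /f1coef /=; congr [:: _; _; _; _; _; _; _]; ring.
Qed.

Section OctCoefs.
Variable R : comNzRingType.
Implicit Types (a b c d : R) (M : 'M[R]_2).

Lemma f1polyE a b c d : f1poly a b c d = Poly (f1coef a b c d).
Proof.
rewrite /f1coef /= !cons_poly_def mul0r add0r /f1poly -!mul_polyC.
rewrite -/(f1coef a b c d) !polyCN f1coef_ident (f1coef_morph (@polyC R)) foldr_map.
by rewrite /f1coef /= mul0r add0r.
Qed.

Lemma f1cE M (i : 'I_7) : f1c M 0 i = (f1coef (M 0 0) (M 0 1) (M 1 0) (M 1 1))`_i.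
Proof. by rewrite mxE f1polyE coef_Poly. Qed.

(** An effective version of the fact that [octa] has no double root. Up to the factor
    [det M], the partial derivatives of [octa] at [(d, -c)] are combinations of the
    value there, which is the first coordinate of [f1 M], and of the derivative in the
    direction [(-b, a)], which is the second one; the last two coordinates play the same
    role at [(-b, a)]. Moreover [24 u^9] and [24 v^9] lie in the ideal generated by the
    two partial derivatives. *)
Lemma det_pow9 M (c := fun i : nat => f1c M 0 (inord i)) :
  [/\ 24 * \det M * M 1 1 ^+ 9 =
        (6 * M 0 0 * c 0%N + M 1 0 * c 1%N) * (25 * M 1 1 * (- M 1 0) ^+ 3)
        + (6 * M 0 1 * c 0%N + M 1 1 * c 1%N) * (24 * M 1 1 ^+ 4 - 5 * M 1 0 ^+ 4),
      24 * \det M * M 1 0 ^+ 9 =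
        (6 * M 0 1 * c 0%N + M 1 1 * c 1%N) * (25 * (- M 1 0) * M 1 1 ^+ 3)
        + (6 * M 0 0 * c 0%N + M 1 0 * c 1%N) * (24 * M 1 0 ^+ 4 - 5 * M 1 1 ^+ 4),
      24 * \det M * M 0 1 ^+ 9 =
        - ((M 0 0 * c 5%N + 6 * M 1 0 * c 6%N) * (25 * (- M 0 1) * M 0 0 ^+ 3)
        + (M 0 1 * c 5%N + 6 * M 1 1 * c 6%N) * (24 * M 0 1 ^+ 4 - 5 * M 0 0 ^+ 4))
    & 24 * \det M * M 0 0 ^+ 9 =
        - ((M 0 1 * c 5%N + 6 * M 1 1 * c 6%N) * (25 * M 0 0 * (- M 0 1) ^+ 3)
        + (M 0 0 * c 5%N + 6 * M 1 0 * c 6%N) * (24 * M 0 0 ^+ 4 - 5 * M 0 1 ^+ 4))].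
Proof.
by rewrite /c !f1cE !inordK // det2E /=; split; ring.
Qed.

End OctCoefs.

Section Degree.
Variable C : numClosedFieldType.
Implicit Types (q : 'cV[C]_2) (g : 'M[{mpoly C[2]}]_2).

Lemma comp_homog m n (f : {mpoly C[2]}) (phi : 'cV[{mpoly C[2]}]_2) :
  f \is n.-homog -> (forall i, phi i 0 \is m.-homog) ->
  f \mPo [tuple phi i 0 | i < 2] \is (m * n).-homog.
Proof.
move=> hf hphi; rewrite (form_coefE hf) rmorph_sum /=.
apply: rpred_sum => i _; rewrite linearZ /=; apply: rpredZ.
rewrite rmorphM !rmorphXn /= !comp_mpolyXU -!tnth_nth !tnth_mktuple.
apply: (@homog_cast _ (m * (n - i) + m * i)).
  by rewrite -mulnDr subnK // -ltnS.
by apply: dhomogM; apply: homogXn.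
Qed.

Lemma comp_ev (f : {mpoly C[2]}) (phi : 'cV[{mpoly C[2]}]_2) q :
  (f \mPo [tuple phi i 0 | i < 2]).@(q) = f.@(peval phi q).
Proof.
rewrite comp_mpoly_meval; apply: meval_eq => i.
by rewrite tnth_mktuple mxE.
Qed.

(** The components of [F o phi] are forms without common zero, so [prop_common]
    applies to [f1 o g]; comparing degrees already gives [4 <= n]. *)
Lemma lift_factor n g (F : 'rV[{mpoly C[2]}]_7) (phi : 'cV[{mpoly C[2]}]_2) :
  (forall i j, g i j \is n.-homog) -> pmap_deg 6 F ->
  pmap_deg 4 phi ->
  (exists q, f1c (peval g q) != 0) ->
  (forall q, q != 0 -> forall i j, f1c (peval g q) 0 i * peval F (peval phi q) 0 j
      = f1c (peval g q) 0 j * peval F (peval phi q) 0 i) ->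
  (24 <= 6 * n)%N /\ exists2 h, h \is (6 * n - 24).-homog &
    forall q, f1c (peval g q) = h.@(q) *: peval F (peval phi q).
Proof.
move=> hg hF hphi [q0 nz] E.
pose a (j : 'I_7) := F 0 j \mPo [tuple phi i 0 | i < 2].
have ha j : a j \is (4 * 6).-homog.
  by apply: comp_homog; [case: hF | case: hphi => + _ i; apply].
have za q : q != 0 -> exists i, (a i).@(q) != 0.
  move=> q00; have [i [j]] := pmap_nozero hF (pmap_neq0 hphi q00).
  by rewrite (ord1 i) -comp_ev => ne; exists j.
have hf j : f1c g 0 j \is (6 * n).-homog by apply: f1c_homog.
have ex : exists j, f1c g 0 j != 0.
  have [j ne] : exists j, f1c (peval g q0) 0 j != 0.
    apply/existsP; apply: contraNT nz; rewrite negb_exists => /forallP H.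
    by apply/eqP/rowP=> j; rewrite [RHS]mxE; apply/eqP; have := H j; rewrite negbK.
  exists j; apply: contra_neq ne => Z.
  by rewrite -peval_f1c pevalE Z meval0.
have [|le [h hh hE]] := prop_common ha za hf ex.
  move=> i j; apply/eqP; rewrite -subr_eq0; apply/eqP.
  apply: (@form_eq0 _ (6 * n + 4 * 6)); first by apply: rpredB; apply: dhomogM.
  move=> q q00; have := E q q00 i j.
  by rewrite -peval_f1c !pevalE -!comp_ev mevalB !mevalM => ->; rewrite subrr.
split=> //; exists h => // q; apply/rowP=> j.
by rewrite -peval_f1c pevalE hE mevalM comp_ev sclE pevalE.
Qed.

(** A common factor of the coordinates of [f1 o g] divides [det g * a^9] for each
    entry [a] of [g] by [det_pow9]. As the entries have no common zero, it divides
    [det g]. *)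
Lemma content_degree n g e h : pmap_deg n g -> \det g != 0 ->
  h \is e.-homog -> h != 0 -> (forall i, exists k, f1c g 0 i = h * k) ->
  (e <= n + n)%N.
Proof.
move=> hg d0 hh h0 H.
have hgij i j : g i j \is n.-homog by case: hg.
pose a (ij : 'I_2 * 'I_2) := g ij.1 ij.2 ^+ 9.
have ha ij : a ij \is (n * 9).-homog by apply: homogXn.
have za q : q != 0 -> exists ij, (a ij).@(q) != 0.
  move=> q0; have [i [j ne]] := pmap_nozero hg q0.
  by exists (i, j); rewrite rmorphXn expf_neq0.
have d24 : 24 * \det g != 0.
  rewrite mulf_neq0 //; apply/eqP=> /(congr1 (fun f => f.@(pt 0 0))).
  by rewrite rmorph_nat meval0 => /eqP; rewrite pnatr_eq0.
have hd : 24 * \det g \is (n + n).-homog.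
  rewrite mulr_natl rpredMn // det2E; apply: rpredB; exact: dhomogM.
have [|//] := dvd_common za hh h0 hd d24.
move=> ij.
have [k0 E0] := H (inord 0); have [k1 E1] := H (inord 1).
have [k5 E5] := H (inord 5); have [k6 E6] := H (inord 6).
have [I11 I10 I01 I00] := det_pow9 g.
case: ij => i j; rewrite /a /=.
case: (ord2P i) => ->; case: (ord2P j) => ->.
- by rewrite I00 E5 E6 dvd_comb -mulrN; eexists; reflexivity.
- by rewrite I01 E5 E6 dvd_comb -mulrN; eexists; reflexivity.
- by rewrite I10 E0 E1 dvd_comb; eexists; reflexivity.
- by rewrite I11 E0 E1 dvd_comb; eexists; reflexivity.
Qed.

End Degree.


(** * Elements of order four of the octahedral group *)

Section Octahedral.
Variable C : numClosedFieldType.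
Implicit Types (T P M B : 'M[C]_2) (z w : 'cV[C]_2).

Local Notation diagB := (mx_of_rows 2 2
    [:: [:: (1 + 'i) / sqrtC 2; 0]; [:: 0; (1 - 'i) / sqrtC 2]] : 'M[C]_2).
Local Notation rotB := ((sqrtC 2)^-1 *: mx_of_rows 2 2
    [:: [:: 1; -1]; [:: 1; 1]] : 'M[C]_2).

Lemma sqrt2_neq0 : sqrtC 2 != 0 :> C.
Proof. by rewrite sqrtC_eq0 two_neq0. Qed.

Lemma rows2E (a b c d : C) :
  mx_of_rows 2 2 [:: [:: a; b]; [:: c; d]] = mx2 a b c d.
Proof. by apply: mx2P; rewrite !mxE. Qed.

Lemma zeta_inv : (1 + 'i) / sqrtC 2 * ((1 - 'i) / sqrtC 2) = 1 :> C.
Proof.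
have s0 := sqrt2_neq0; have -> : (1 + 'i) / sqrtC 2 * ((1 - 'i) / sqrtC 2)
  = (1 - 'i ^+ 2) / (sqrtC 2) ^+ 2 :> C by field.
rewrite sqrtCK imag_sqr opprK; apply: mulfV; exact: two_neq0.
Qed.

Lemma zeta_sqr : ((1 + 'i) / sqrtC 2) ^+ 2 = 'i :> C.
Proof.
have s0 := sqrt2_neq0; have -> : ((1 + 'i) / sqrtC 2) ^+ 2
  = (1 + 2 * 'i + 'i ^+ 2) / (sqrtC 2) ^+ 2 :> C by field.
by rewrite sqrtCK imag_sqr; field.
Qed.

Lemma zetaV_sqr : ((1 - 'i) / sqrtC 2) ^+ 2 = - 'i :> C.
Proof.
have s0 := sqrt2_neq0; have -> : ((1 - 'i) / sqrtC 2) ^+ 2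
  = (1 - 2 * 'i + 'i ^+ 2) / (sqrtC 2) ^+ 2 :> C by field.
by rewrite sqrtCK imag_sqr; field.
Qed.

(** Right multiplication by [B^T] substitutes [B] into [octa], of which it is a
    symmetry; both generators act by the character [-1]. *)
Lemma f1c_S4star B : S4star B -> B \in unitmx /\
  exists2 c, c != 0 & forall M, f1c (M *m B^T) = c *: f1c M.
Proof.
have s0 := sqrt2_neq0.
elim=> [|||{}B _ [Bu [c c0 H]]|{}B B' _ [Bu [c c0 H]] _ [Bu' [c' c0' H']]].
- split; first by rewrite rows2E unit2 det2E !mx2E zeta_inv mulr0 subr0 oner_eq0.
  exists (-1); first by rewrite oppr_eq0 oner_eq0.
  move=> M; apply: sval_inj => z; rewrite svalZ !sval_f1c rows2E !mul2E !mxE /=.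
  rewrite !mulr0 !addr0 !add0r /oct.
  set x := (1 + 'i) / _; set y := (1 - 'i) / _.
  have -> p : p * y * z 0 0 = y * (p * z 0 0) by ring.
  have xy : x * y = 1 by exact: zeta_inv.
  have x4 : x ^+ 4 = -1 by rewrite -[4%N]/(2 * 2)%N exprM zeta_sqr imag_sqr.
  have y4 : y ^+ 4 = -1 by rewrite -[4%N]/(2 * 2)%N exprM zetaV_sqr sqrrN imag_sqr.
  transitivity ((x * y) * ((M 1 1 * z 0 0 - M 0 1 * z 1 0) * (M 0 0 * z 1 0 - M 1 0 * z 0 0)
     * (y ^+ 4 * (M 1 1 * z 0 0 - M 0 1 * z 1 0) ^+ 4
         - x ^+ 4 * (M 0 0 * z 1 0 - M 1 0 * z 0 0) ^+ 4))); first by ring.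
  rewrite xy x4 y4; ring.
- split.
    rewrite rows2E unit2 detZ det2E !mx2E mulf_neq0 ?expf_neq0 ?invr_eq0 //.
    by rewrite mulr1 mulN1r opprK two_neq0.
  exists (-1); first by rewrite oppr_eq0 oner_eq0.
  move=> M; apply: sval_inj => z; rewrite svalZ !sval_f1c rows2E !mul2E !mxE /=.
  set s := (sqrtC 2)^-1; have s6 : 8 * s ^+ 6 = 1.
    rewrite /s exprVn -[6%N]/(2 * 3)%N exprM sqrtCK.
    have -> : (2 : C) ^+ 3 = 8 by ring.
    by rewrite mulfV // pnatr_eq0.
  rewrite /oct; set p := M 1 1 * z 0 0 - M 0 1 * z 1 0.
  set r := M 0 0 * z 1 0 - M 1 0 * z 0 0.
  transitivity (- (8 * s ^+ 6) * (p * r * (p ^+ 4 - r ^+ 4))); first by rewrite /p /r; ring.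
  by rewrite s6.
- split; first exact: unitmx1.
  by exists 1; rewrite ?oner_eq0 // => M; rewrite trmx1 mulmx1 scale1r.
- split; first by rewrite unitmx_inv.
  exists c^-1; first by rewrite invr_eq0.
  move=> M; have := H (M *m (invmx B)^T).
  rewrite -mulmxA -trmx_mul mulmxV // trmx1 mulmx1 => ->.
  by rewrite scalerA mulVf // scale1r.
- split; first by rewrite unitmx_mul Bu.
  exists (c * c'); first by rewrite mulf_neq0.
  by move=> M; rewrite trmx_mul mulmxA H H' scalerA.
Qed.

Lemma octa_ev z : (octa C).@(z) = oct (z 0 0) (z 1 0).
Proof. by rewrite /octa /oct !(mevalM, mevalB, rmorphXn) /= var0_ev var1_ev. Qed.

Lemma act_ev T (f : {mpoly C[2]}) z : (act T f).@(z) = f.@(invmx T *m z).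
Proof. exact: lin_subst_ev. Qed.

Lemma sval_adj2 P w : sval (f1c (adj2 P)) w = oct ((P *m w) 0 0) ((P *m w) 1 0).
Proof. by rewrite sval_f1c !mx2E !mul2E; congr oct; ring. Qed.

Lemma sval_diag (c : 'rV[C]_7) a b w :
  sval c (mx2 a 0 0 b *m w) =
  sval (\row_(i < 7) (c 0 i * (a ^+ (6 - i) * b ^+ i))) w.
Proof.
apply: eq_bigr => i _; rewrite !mul2E !mx2E !mxE !mul0r addr0 add0r !exprMn; ring.
Qed.

Lemma pow9_eq0 (d x : C) : d != 0 -> 24 * d * x ^+ 9 = 0 -> x = 0.
Proof.
move=> d0 E; apply/eqP; apply: contraT => x0.
have /eqP[] : 24 * d * x ^+ 9 != 0; last exact: E.
by apply: mulf_neq0; rewrite ?expf_neq0 // mulf_neq0 // pnatr_eq0.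
Qed.

(** Otherwise the sextic [octa] in the coordinates given by [P] would have a double
    root at one of the two base points, which [det_pow9] excludes. *)
Lemma f1c_adj_01 P : P \in unitmx -> (f1c (adj2 P) 0 (inord 0) != 0) ||
   (f1c (adj2 P) 0 (inord 1) != 0).
Proof.
move=> Pu; rewrite -negb_and; apply/negP=> /andP[/eqP E0 /eqP E1].
have d0 : \det (adj2 P) != 0.
  by move: Pu; rewrite unit2 !det2E !mx2E; congr (~~ (_ == _)); ring.
have [I11 I10 _ _] := det_pow9 (adj2 P); move: I11 I10; rewrite E0 E1.
rewrite !(mulr0, addr0, mul0r) => /(pow9_eq0 d0) + /(pow9_eq0 d0); rewrite !mx2E => P0 /eqP.
rewrite oppr_eq0 => /eqP P1.
by move: Pu; rewrite unit2 det2E P0 P1 mul0r mulr0 subr0 eqxx.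
Qed.

Lemma f1c_adj_56 P : P \in unitmx -> (f1c (adj2 P) 0 (inord 5) != 0) ||
   (f1c (adj2 P) 0 (inord 6) != 0).
Proof.
move=> Pu; rewrite -negb_and; apply/negP=> /andP[/eqP E0 /eqP E1].
have d0 : \det (adj2 P) != 0.
  by move: Pu; rewrite unit2 !det2E !mx2E; congr (~~ (_ == _)); ring.
have [_ _ I11 I10] := det_pow9 (adj2 P); move: I11 I10; rewrite E0 E1.
rewrite !(mulr0, addr0, mul0r, oppr0) => /(pow9_eq0 d0) + /(pow9_eq0 d0); rewrite !mx2E.
move=> /eqP; rewrite oppr_eq0 => /eqP P0 P1.
by move: Pu; rewrite unit2 det2E P0 P1 mul0r mulr0 subr0 eqxx.
Qed.

(** In eigencoordinates of an element of order four the coefficients of [octa] are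
    supported on one residue class of exponents modulo four. If the class contained
    the extreme exponent [6] it would consist of [6] and [2], and the other fixed
    point would be a double root. So it consists of [5] and [1]: the fixed points are
    antipodal vertices of the octahedron. *)
Lemma octa_fixed_points T P mu : octa_stabilizer T -> P \in unitmx -> mu != 0 ->
  T *m P = P *m mx2 ('i * mu) 0 0 mu ->
  f1c (adj2 P) 0 (inord 0) = 0 /\ f1c (adj2 P) 0 (inord 2) = 0.
Proof.
move=> [dT [_ _ [e e0 eE]]] Pu m0 TP.
set c := f1c (adj2 P).
have Tu := det1_unit dT.
have inv z : oct (z 0 0) (z 1 0) = e * oct ((T *m z) 0 0) ((T *m z) 1 0).
  have := congr1 (fun f => f.@(T *m z)) eE.
  by rewrite act_ev mevalZ !octa_ev mulKmx.
pose k := e * mu ^+ 6.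
have ci (i : 'I_7) : (1 - k * 'i ^+ (6 - i)) * c 0 i = 0.
  suff E : c = \row_(i < 7) (e * (c 0 i * (('i * mu) ^+ (6 - i) * mu ^+ i))).
    have := congr1 (fun r : 'rV_7 => r 0 i) E; rewrite /= mxE => E'.
    rewrite mulrBl mul1r {1}E' /k exprMn.
    have -> : mu ^+ 6 = mu ^+ (6 - i) * mu ^+ i by rewrite -exprD subnK // -ltnS.
    ring.
  apply: sval_inj => w; rewrite /c sval_adj2 inv mulmxA TP -mulmxA -sval_adj2 sval_diag.
  by rewrite -svalZ; congr sval; apply/rowP=> j; rewrite !mxE.
have cn (i : nat) : (i < 7)%N -> k * 'i ^+ (6 - i) != 1 -> c 0 (inord i) = 0.
  move=> i7 ne; have /eqP := ci (inord i); rewrite inordK // mulf_eq0 subr_eq0 eq_sym.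
  by rewrite (negPf ne) => /eqP.
have i2 := imag_sqr C.
have i3 : 'i ^+ 3 = - 'i :> C by rewrite exprS i2 mulrN1.
have i4 : 'i ^+ 4 = 1 :> C by rewrite -[4%N]/(2 * 2)%N exprM i2 sqrrN expr1n.
have i5 : 'i ^+ 5 = 'i :> C by rewrite exprS i4 mulr1.
have i6 : 'i ^+ 6 = -1 :> C by rewrite exprS i5 -expr2 i2.
have c0 : c 0 (inord 0) = 0.
  apply/eqP; apply: contraT => c0.
  have k1 : k = -1.
    have /eqP := ci (inord 0); rewrite inordK // subn0 i6 mulf_eq0 (negPf c0) orbF.
    by rewrite mulrN1 opprK addrC addr_eq0 => /eqP.
  have := f1c_adj_56 Pu; rewrite -/c !cn ?eqxx // k1.
    by rewrite expr0 mulr1 eq_sym one_neqN1.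
  by rewrite expr1 mulN1r eqr_oppLR imag_neqN1.
split=> //; apply: cn => //; rewrite i4 mulr1.
have := f1c_adj_01 Pu; rewrite -/c c0 eqxx /= => c1.
have /eqP := ci (inord 1); rewrite inordK // mulf_eq0 (negPf c1) orbF i5 subr_eq0 eq_sym.
move=> /eqP E; apply/eqP=> k1; move: E; rewrite k1 mul1r => /eqP.
by rewrite (negPf (imag_neq1 C)).
Qed.

(** The fixed points of [T] are a pair of antipodal vertices, and the octahedral
    group is transitive on vertices; an element that carries the pair to [0] and
    infinity in the right order diagonalizes [T]. *)
Lemma octa_diagonalize T c : octa_stabilizer T ->
  T *m T *m (T *m T) = c%:M -> (forall e, T *m T != e%:M) ->
  exists B mu, [/\ S4star B, mu != 0 & T *m B^T = B^T *m mx2 mu 0 0 ('i * mu)].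
Proof.
move=> hT T4 T2; have [P [mu [Pu m0 TP]]] := diag_order4 T4 T2.
have [c0 c2] := octa_fixed_points hT Pu m0 TP.
have s0 := sqrt2_neq0.
have d0 : \det P != 0 by rewrite -unit2.
move: c0 c2; rewrite !f1cE !inordK // !mx2E /=.
set p0 := P 0 0; set p1 := P 1 0; set q0 := P 0 1; set q1 := P 1 1 => c0 c2.
have Pd : p0 * q1 - q0 * p1 != 0 by rewrite -det2E.
(* The rows of [B] must be eigenvectors of [T], up to scalars [s] and [t]. *)
suff [B hB [s [t [B0 B1 B2 B3]]]] : exists2 B, S4star B & exists s t,
   [/\ B 0 0 = s * q0, B 0 1 = s * q1, B 1 0 = t * p0 & B 1 1 = t * p1].
  exists B, mu; split=> //.
  have E i j := congr1 (fun M : 'M_2 => M i j) TP.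
  have := (E 0 0, E 0 1, E 1 0, E 1 1); rewrite !mul2E !mx2E -/p0 -/p1 -/q0 -/q1.
  rewrite !(mulr0, addr0, add0r) => -[[[E00 E01] E10] E11].
  apply: mx2P; rewrite !mul2E ![B^T _ _]mxE !mx2E ?B0 ?B1 ?B2 ?B3 !(mulr0, addr0, add0r).
  - by transitivity (s * (T 0 0 * q0 + T 0 1 * q1)); [ring | rewrite E01; ring].
  - by transitivity (t * (T 0 0 * p0 + T 0 1 * p1)); [ring | rewrite E00; ring].
  - by transitivity (s * (T 1 0 * q0 + T 1 1 * q1)); [ring | rewrite E11; ring].
  - by transitivity (t * (T 1 0 * p0 + T 1 1 * p1)); [ring | rewrite E10; ring].
have rot : S4star rotB := S4star_rot C.
have rot3 : S4star (rotB *m rotB *m rotB) by do 2 (apply: S4star_mul => //).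
have s2 : (sqrtC 2)^-1 * (sqrtC 2)^-1 = 2^-1 :> C by rewrite -invfM -expr2 sqrtCK.
have n2 := two_neq0 C.
have rotE : rotB *m rotB = mx2 0 (-1) 1 0.
  rewrite rows2E -scalemxAl -scalemxAr scalerA s2.
  by apply: mx2P; rewrite !(sclE, mul2E, mx2E); field.
(* The six vertices are the two coordinate points and the fourth roots of unity,
   here the ratio [w] of the coordinates of the eigenvector [(p0, p1)]. *)
have [p00|p00] := eqVneq p0 0.
  have q00 : q0 != 0 by apply: contra_neq Pd => ->; rewrite p00; ring.
  have p10 : p1 != 0 by apply: contra_neq Pd => ->; rewrite p00; ring.
  have q10 : q1 = 0.
    apply/eqP; apply: contraT => q10.
    have : 5 * q1 * q0 * p1 ^+ 4 != 0 by rewrite !mulf_neq0 ?expf_neq0 ?pnatr_eq0.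
    by case/eqP; apply: (@oppr_inj C); rewrite oppr0 -c2 p00; ring.
  exists 1%:M; first exact: S4star_one.
  exists q0^-1, p1^-1; rewrite !mxE /= p00 q10 !mulr0 ?mulr0n ?mulr1n.
  by rewrite !mulVf.
have [p10|p10] := eqVneq p1 0.
  have q10 : q1 != 0 by apply: contra_neq Pd => ->; rewrite p10; ring.
  have q00 : q0 = 0.
    apply/eqP; apply: contraT => q00.
    have : 5 * q1 * q0 * p0 ^+ 4 != 0 by rewrite !mulf_neq0 ?expf_neq0 ?pnatr_eq0.
    by case/eqP; rewrite -c2 p10; ring.
  exists (rotB *m rotB); first exact: S4star_mul.
  exists (- q1^-1), p0^-1; rewrite rotE !mx2E p10 q00 !mulr0.
  by rewrite mulNr !mulVf.
pose w := p1 / p0; have p1E : p1 = w * p0 by rewrite /w divfK.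
have w0 : w != 0 by rewrite mulf_neq0 ?invr_eq0.
have w4 : w ^+ 4 = 1.
  have : p0 ^+ 6 * w * (1 - w ^+ 4) = 0 by rewrite -[RHS]c0 p1E; ring.
  have n6 : p0 ^+ 6 * w != 0 by rewrite mulf_neq0 ?expf_neq0.
  by move/eqP; rewrite mulf_eq0 (negPf n6) /= subr_eq0 => /eqP.
have q1E : q1 = - w * q0 /\ q0 != 0.
  have : 10 * p0 ^+ 4 * w * ((q0 - w * q1) * (q0 + w * q1)) = 0.
    transitivity (10 * p0 ^+ 4 * w * (q0 ^+ 2 - w ^+ 2 * q1 ^+ 2)
        + 5 * p0 ^+ 4 * q0 * q1 * (1 - w ^+ 4)); first by rewrite w4; ring.
    by rewrite -[RHS]c2 p1E; ring.
  have Pd' : q1 - w * q0 != 0.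
    apply: contra_neq Pd => E; rewrite p1E.
    by transitivity (p0 * (q1 - w * q0)); [ring | rewrite E mulr0].
  have n4 : 10 * p0 ^+ 4 * w != 0 by rewrite mulf_neq0 // mulf_neq0 ?expf_neq0 // pnatr_eq0.
  move/eqP; rewrite mulf_eq0 (negPf n4) /= mulf_eq0.
  have /eqP : (w ^+ 2 - 1) * (w ^+ 2 + 1) = 0 by rewrite -[RHS](subrr 1) -{3}w4; ring.
  have q00 : q1 = - w * q0 -> q0 != 0.
    by move=> E; apply: contra_neq Pd' => z; rewrite E z; ring.
  rewrite mulf_eq0 => /orP[/eqP w2|/eqP w2] /orP[/eqP E|/eqP E].
  - case/eqP: Pd'; transitivity (- (w * (q0 - w * q1)) - (w ^+ 2 - 1) * q1); first by ring.
    by rewrite E w2; ring.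
  - suff H : q1 = - w * q0 by split=> //; apply: q00.
    apply/eqP; rewrite -subr_eq0; apply/eqP.
    transitivity (w * (q0 + w * q1) - (w ^+ 2 - 1) * q1); first by ring.
    by rewrite E w2; ring.
  - suff H : q1 = - w * q0 by split=> //; apply: q00.
    apply/eqP; rewrite -subr_eq0; apply/eqP.
    transitivity (w * (q0 - w * q1) + (w ^+ 2 + 1) * q1); first by ring.
    by rewrite E w2; ring.
  - case/eqP: Pd'; transitivity (- (w * (q0 + w * q1)) + (w ^+ 2 + 1) * q1); first by ring.
    by rewrite E w2; ring.
have [q1E' q00] := q1E.
suff [B hB [s [t [B0 B1 B2 B3]]]] : exists2 B, S4star B & exists s t,
   [/\ B 0 0 = s, B 0 1 = - (w * s), B 1 0 = t & B 1 1 = w * t].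
  exists B => //; exists (s / q0), (t / p0).
  by rewrite B0 B1 B2 B3 q1E' p1E; split; field.
have i2 := imag_sqr C.
have rot3E : rotB *m rotB *m rotB = (sqrtC 2)^-1 *: mx2 (-1) (-1) 1 (-1).
  by rewrite rotE rows2E -scalemxAr; congr (_ *: _);
     apply: mx2P; rewrite !(mul2E, mx2E); ring.
pose x : C := (1 + 'i) / sqrtC 2; pose y : C := (1 - 'i) / sqrtC 2.
have xy : y = - 'i * x.
  by rewrite /x /y; transitivity ((- 'i - 'i ^+ 2) / sqrtC 2 : C); [rewrite i2; ring|ring].
have hD : S4star diagB := S4star_diag C.
have w4' : (w - 1) * (w + 1) * ((w - 'i) * (w + 'i)) = 0.
  transitivity ((w ^+ 2 - 1) * (w ^+ 2 - 'i ^+ 2)); first by ring.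
  rewrite i2; transitivity (w ^+ 4 - 1); first by ring.
  by rewrite w4 subrr.
move/eqP: w4'; rewrite !mulf_eq0 !subr_eq0 !addr_eq0 => /orP[/orP[]|/orP[]] /eqP wE.
- exists rotB => //; exists (sqrtC 2)^-1, (sqrtC 2)^-1.
  by rewrite rows2E !(sclE, mx2E) wE; split; ring.
- exists (rotB *m rotB *m rotB) => //; exists (- (sqrtC 2)^-1), (sqrtC 2)^-1.
  by rewrite rot3E !(sclE, mx2E) wE; split; ring.
- exists (rotB *m rotB *m rotB *m diagB); first exact: S4star_mul.
  exists (- (sqrtC 2)^-1 * x), ((sqrtC 2)^-1 * x).
  by rewrite rot3E rows2E !(mul2E, sclE, mx2E) -/x -/y xy wE; split; ring.
- exists (rotB *m diagB); first exact: S4star_mul.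
  exists ((sqrtC 2)^-1 * x), ((sqrtC 2)^-1 * x).
  by rewrite !rows2E !(mul2E, sclE, mx2E) -/x -/y xy wE; split; ring.
Qed.

End Octahedral.


(** * Monodromy and degree of the lift *)

Section Reduction.
Variable C : numClosedFieldType.
Implicit Types (q : 'cV[C]_2) (S T B : 'M[C]_2) (g : 'M[{mpoly C[2]}]_2).
Implicit Types (phi : 'cV[{mpoly C[2]}]_2) (F : 'rV[{mpoly C[2]}]_7).

Lemma proj_eq_unit (m : nat) (nu : 'M[C]_2) (v w : 'M[C]_(2, m)) : nu \in unitmx ->
  proj_eq (nu *m v) (nu *m w) -> proj_eq v w.
Proof.
move=> nuu [v0 w0 [c c0 E]]; split.
- by apply: contra_neq v0 => ->; rewrite mulmx0.
- by apply: contra_neq w0 => ->; rewrite mulmx0.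
- exists c => //; rewrite -[v](mulKmx nuu) E -scalemxAr mulKmx //.
Qed.

Lemma moebius_ev mu nu phi q : moebius_conj mu nu phi (power4 C) -> q != 0 ->
  proj_eq (nu *m peval phi (mu *m q)) (peval (power4 C) q).
Proof. by move=> [_ _ H] q0; have := H q q0; rewrite pevalM peval_const peval_precomp. Qed.

Lemma deck_conj mu nu phi S : moebius_conj mu nu phi (power4 C) ->
  deck (power4 C) S -> deck phi (mu *m S *m invmx mu).
Proof.
move=> H [Su hS]; have [muu nuu _] := H; split.
  by rewrite !unitmx_mul muu Su unitmx_inv.
move=> q q0; apply: (proj_eq_unit nuu).
have [q' q'0 ->] : exists2 q' : 'cV[C]_2, q' != 0 & q = mu *m q'.
  exists (invmx mu *m q); last by rewrite mulKVmx.
  by apply: unitmx_mul_neq0 => //; rewrite unitmx_inv.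
rewrite -!mulmxA mulKmx //.
apply: proj_eq_trans (moebius_ev H (unitmx_mul_neq0 Su q'0)) _.
apply: proj_eq_trans (hS _ q'0) _.
by apply: proj_eq_sym; apply: moebius_ev H _.
Qed.

Lemma deck_power4_diag (a b : C) : a != 0 -> b != 0 -> a ^+ 4 = b ^+ 4 ->
  deck (power4 C) (mx2 a 0 0 b).
Proof.
move=> a0 b0 ab; split; first by rewrite unit2 det2E !mx2E mulr0 subr0 mulf_neq0.
move=> q q0.
have -> : peval (power4 C) (mx2 a 0 0 b *m q) = a ^+ 4 *: peval (power4 C) q.
  rewrite !power4_ev; apply: cv2P; rewrite sclE !(pt0E, pt1E) !mul2E !mx2E.
    by rewrite mul0r addr0 exprMn.
  by rewrite mul0r add0r exprMn ab.
apply: proj_eqZ; first exact: expf_neq0.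
rewrite power4_ev pt_eq0 !expf_eq0 /= negb_and.
by rewrite -cV2_neq0.
Qed.

Lemma det_ev g q : (\det g).@(q) = \det (peval g q).
Proof. by rewrite /peval det_map_mx. Qed.

Lemma det_subst S g q : (lin_subst S (\det g)).@(q) = \det (peval g (S *m q)).
Proof. by rewrite lin_subst_ev det_ev. Qed.

Lemma lin_subst_neq0 S (f : {mpoly C[2]}) : S \in unitmx -> f != 0 -> lin_subst S f != 0.
Proof.
move=> Su; apply: contra_neq => E; apply: meval_all0 => q.
by rewrite -[q](mulKVmx Su) -lin_subst_ev E meval0.
Qed.

Lemma lift_monodromyE g S T q : q != 0 -> lift_monodromy g S T ->
  peval g q \in unitmx -> peval g (S *m q) \in unitmx ->
  exists2 c, c != 0 & peval g (S *m q) *m T = c *: peval g q.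
Proof.
move=> q0 H u u'; have [_ _ [c c0 E]] := H q q0 u u'.
exists c^-1; first by rewrite invr_eq0.
have := congr1 (mulmx (peval g (S *m q))) E; rewrite mulKVmx // => ->.
by rewrite -scalemxAr scalerA mulVf // scale1r.
Qed.

(** The factor [c] depends on the point a priori. But [g (S q) T] and [g q] are
    given by forms of the same degree, the latter without common zero, so that
    [prop_common] makes [c] a form of degree zero. *)
Lemma equivariant n g S T : pmap_deg n g -> \det g != 0 ->
  S \in unitmx -> T \in unitmx ->
  (forall q, q != 0 -> peval g q \in unitmx -> peval g (S *m q) \in unitmx ->
     exists2 c, c != 0 & peval g (S *m q) *m T = c *: peval g q) ->
  exists2 c, c != 0 & forall q, peval g (S *m q) *m T = c *: peval g q.
Proof.
move=> hg d0 Su Tu H; have hgij i j : g i j \is n.-homog by case: hg.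
pose a (p : 'I_2 * 'I_2) := g p.1 p.2.
pose bm := precomp S g *m mpolyC_mx T.
pose b (p : 'I_2 * 'I_2) := bm p.1 p.2.
have bE q : peval bm q = peval g (S *m q) *m T.
  by rewrite pevalM peval_const peval_precomp.
have ha p : a p \is n.-homog by apply: hgij.
have hb p : b p \is n.-homog.
  rewrite /b mul2E; apply: rpredD; rewrite [mpolyC_mx _ _ _]mxE mulrC mul_mpolyC rpredZ //;
    by rewrite mxE lin_subst_homog.
have za q : q != 0 -> exists p, (a p).@(q) != 0.
  by move=> q0; have [i [j ne]] := pmap_nozero hg q0; exists (i, j).
have ex : exists p, b p != 0.
  have q1 : pt (1 : C) 1 != 0 by rewrite pt_eq0 oner_eq0.
  have nz : peval bm (pt 1 1) != 0.
    rewrite bE; have := pmap_neq0 hg (unitmx_mul_neq0 Su q1).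
    by apply: contra_neq => E; rewrite -[peval g _](mulmxK Tu) E mul0mx.
  apply/existsP; apply: contraNT nz; rewrite negb_exists => /forallP E.
  apply/eqP/matrixP=> i j; rewrite pevalE [RHS]mxE.
  by have := E (i, j); rewrite negbK => /eqP Eb; rewrite -[bm i j]/(b (i, j)) Eb meval0.
have prop p p' : b p * a p' = b p' * a p.
  apply/eqP; rewrite -subr_eq0; apply/eqP.
  have dd : \det g * lin_subst S (\det g) * var0 C != 0.
    by rewrite !mulf_neq0 ?lin_subst_neq0 ?var0_neq0.
  apply: (meval_dense dd) => q; rewrite !mevalM det_ev det_subst var0_ev.
  rewrite !mulf_eq0 !negb_or => /andP[/andP[u u'] q00].
  have q0 : q != 0 by rewrite cV2_neq0 q00.
  have [c c0] := H q q0 (etrans (unit2 _) u) (etrans (unit2 _) u').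
  rewrite -bE => E; rewrite mevalB !mevalM.
  have E' r : (b r).@(q) = c * (a r).@(q).
    by have := congr1 (fun M : 'M_2 => M r.1 r.2) E; rewrite /= sclE !pevalE.
  by rewrite !E'; ring.
have [_ [k hk kE]] := prop_common ha za hb ex prop.
move: hk; rewrite subnn => /homog0_const; set c := fcoef 0 k 0 => kc.
have E q : peval g (S *m q) *m T = c *: peval g q.
  rewrite -bE; apply/matrixP=> i j; rewrite sclE !pevalE -[bm i j]/(b (i, j)) kE kc.
  by rewrite mevalM mevalC.
exists c => //; have [p] := ex; apply: contra_neq => c0.
by rewrite kE kc c0 mpolyC0 mul0r.
Qed.

(** The relation [f1 o g = F o phi] by cross products, which also makes sense at the
    points where [f1 o g] is undefined. *)
Definition cross g F phi := forall q, q != 0 -> forall i j,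
  f1c (peval g q) 0 i * peval F (peval phi q) 0 j
  = f1c (peval g q) 0 j * peval F (peval phi q) 0 i.

Lemma lifts_cross phi F g : lifts phi F g ->
  (exists q, f1c (peval g q) != 0) /\ cross g F phi.
Proof.
move=> [[q0 q00 nz] H]; split.
  by exists q0; apply: contra_neq nz; rewrite -sextic_f1c => ->; rewrite sextic_0.
move=> q qn i j; have [E|ne] := eqVneq (f1c (peval g q)) 0.
  by rewrite E !mxE !mul0r.
have := H q qn; rewrite -sextic_f1c sextic_eq0 => /(_ ne)[_ _ [c c0]].
rewrite -sextic_Z => /sextic_inj ->; rewrite !sclE; ring.
Qed.

Definition shift_mx : 'M[C]_2 := mx2 'i 0 0 1.

Lemma shift_unit : shift_mx \in unitmx.
Proof. by rewrite unit2 det2E !mx2E mulr1 mul0r subr0 imag_neq0. Qed.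

Lemma deck_shift : deck (power4 C) shift_mx.
Proof.
apply: deck_power4_diag; rewrite ?imag_neq0 ?oner_eq0 //.
by rewrite expr1n -[4%N]/(2 * 2)%N exprM imag_sqr sqrrN expr1n.
Qed.

(** Injectivity of the monodromy homomorphism has two effects: [det g] is not zero,
    since otherwise the defining condition on monodromy would be empty and all deck
    transformations would have the same one; and the monodromy [T] along a generator
    has order four, so that an element of the octahedral group diagonalizes it. *)
Lemma diagonal_monodromy phi F n g : galois_covering 4 phi -> deck_cyclic phi ->
  pmap_deg n g -> galois_lift phi F g ->
  exists mu nu B m c, [/\ moebius_conj mu nu phi (power4 C), S4star B, m != 0 /\ c != 0,
    \det (precomp mu g) != 0 &
    forall q, peval g (mu *m (shift_mx *m q)) *m B^T *m mx2 m 0 0 ('i * m)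
      = c *: (peval g (mu *m q) *m B^T)].
Proof.
move=> gphi cphi hg [_ mono inj].
have [mu [nu mc]] := covering_normal gphi cphi.
have [muu nuu _] := mc; have [_ hphi _] := gphi.
have hgij i j : g i j \is n.-homog by case: hg.
have hg' : pmap_deg n (precomp mu g).
  apply: nozero_pmap => [i j|q q0]; first by rewrite mxE lin_subst_homog.
  have [i [j ne]] := pmap_nozero hg (unitmx_mul_neq0 muu q0).
  by exists i, j; rewrite mxE lin_subst_ev.
set D := shift_mx; have Du := shift_unit.
pose conj S := mu *m S *m invmx mu.
have dD := deck_conj mc deck_shift; have d1 := deck1 hphi.
have dD2 := deckM dD dD.
have DD : conj D *m conj D = conj (D *m D) by rewrite /conj -!mulmxA mulKmx.
have conj_q S q : conj S *m (mu *m q) = mu *m (S *m q).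
  by rewrite /conj -!mulmxA mulKmx.
have not_scalar : ~ proj_eq (conj (D *m D)) 1%:M.
  move=> [_ _ [c c0 E]]; have : D *m D = c%:M.
    have := congr1 (fun X => invmx mu *m X *m mu) E; rewrite /conj !mulmxA mulVmx //.
    by rewrite mul1mx mulmxKV // -scalemxAr mulmx1 -scalemxAl mulVmx // scalemx1.
  move/matrixP=> M; have := (M 0 0, M 1 1); rewrite !mul2E !mx2E !mxE /=.
  rewrite !mulr0 !mulr1 add0r addr0 mulr1n -expr2 imag_sqr => -[<-] /eqP.
  by rewrite (negPf (one_neqN1 C)).
have mono1 : lift_monodromy g 1%:M 1%:M.
  move=> q q0 u _; rewrite mul1mx mulVmx //; apply: proj_eq_refl.
  exact: oner_neq0.
have det0 : \det (precomp mu g) != 0.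
  apply/eqP=> dz; apply: not_scalar; rewrite -DD.
  apply: (inj _ _ 1%:M) => // q q0 u.
  have [q' qE] : exists q', q = mu *m q' by exists (invmx mu *m q); rewrite mulKVmx.
  by move: u; rewrite unit2 qE -peval_precomp -det_ev dz meval0 eqxx.
have [T hT Tmono] := mono _ dD; have dT := hT.1.
have Tu := det1_unit dT.
have [c c0 eqv] : exists2 c, c != 0 &
    forall q, peval (precomp mu g) (D *m q) *m T = c *: peval (precomp mu g) q.
  apply: equivariant hg' det0 Du Tu _ => q q0; rewrite !peval_precomp -conj_q => u u'.
  exact: lift_monodromyE (unitmx_mul_neq0 muu q0) Tmono u u'.
have [B [m [hB m0 TB]]] : exists B m, [/\ S4star B, m != 0 & T *m B^T = B^T *m mx2 m 0 0 ('i * m)].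
  have eq2 q : peval (precomp mu g) (D *m (D *m q)) *m (T *m T) = c ^+ 2 *: peval (precomp mu g) q.
    by rewrite mulmxA eqv -scalemxAl eqv scalerA.
  apply: (octa_diagonalize (c := c ^+ 4) hT).
    have D4 q : D *m (D *m (D *m (D *m q))) = q.
      apply: cv2P; rewrite !mul2E !mx2E ?(mul0r, mul1r, addr0, add0r) //.
      transitivity ('i ^+ 2 * 'i ^+ 2 * q 0 0); first by ring.
      by rewrite imag_sqr mulrNN !mul1r.
    have E4 q : peval (precomp mu g) q *m (T *m T *m (T *m T) - (c ^+ 4)%:M) = 0.
      have e1 := eq2 (D *m (D *m q)); rewrite D4 in e1.
      rewrite mulmxBr mul_mx_scalar.
      have -> : peval (precomp mu g) q *m (T *m T *m (T *m T))
          = peval (precomp mu g) q *m (T *m T) *m (T *m T) by rewrite !mulmxA.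
      by rewrite e1 -scalemxAl eq2 scalerA -exprD subrr.
    apply/eqP; rewrite -subr_eq0; apply/eqP/matrixP=> i j; rewrite [RHS]mxE.
    set K := (_ - _); have : (K i j)%:MP_[2] = 0.
      apply: (meval_dense det0) => q; rewrite det_ev mevalC -unit2 => u.
      by rewrite -[K](mulKmx u) E4 mulmx0 mxE.
    by move/eqP; rewrite mpolyC_eq0 => /eqP.
  move=> e; apply/eqP=> TT; apply: not_scalar; rewrite -DD.
  have e0 : e != 0.
    apply/eqP=> e0; have : T *m T \in unitmx by rewrite unitmx_mul Tu.
    by rewrite TT e0 unit2 det_scalar expr0n eqxx.
  apply: (inj _ _ 1%:M) => // q q0 u u'.
  have [q' qE] : exists q', q = mu *m q' by exists (invmx mu *m q); rewrite mulKVmx.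
  move: u u'; rewrite DD qE conj_q -!mulmxA -!(peval_precomp mu g) => u u'.
  have := eq2 q'; rewrite TT mul_mx_scalar => E.
  have {}E : peval (precomp mu g) q' = (e / c ^+ 2) *: peval (precomp mu g) (D *m (D *m q')).
    by rewrite mulrC -scalerA E scalerA mulVf ?expf_neq0 // scale1r.
  rewrite E -scalemxAr mulVmx //; apply: proj_eqZ.
    by rewrite mulf_neq0 // invr_eq0 expf_neq0.
  exact: oner_neq0.
exists mu, nu, B, m, c; split=> // q.
have := eqv q; rewrite !peval_precomp => E.
by rewrite -mulmxA -TB mulmxA E -scalemxAl.
Qed.

Lemma f1c_col0 (M : 'M[C]_2) : M 0 0 = 0 -> M 1 0 = 0 -> f1c M = 0.
Proof.
move=> a c; apply: sval_inj => z; rewrite sval_f1c a c -(scale0r 0) svalZ /oct; ring.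
Qed.

Lemma f1c_col1 (M : 'M[C]_2) : M 0 1 = 0 -> M 1 1 = 0 -> f1c M = 0.
Proof.
move=> a c; apply: sval_inj => z; rewrite sval_f1c a c -(scale0r 0) svalZ /oct; ring.
Qed.

Lemma expi (n : nat) : 'i ^+ n.+4 = 'i ^+ n :> C.
Proof.
have -> : n.+4 = (2 * 2 + n)%N by lia.
by rewrite exprD exprM imag_sqr sqrrN expr1n mul1r.
Qed.

(** The columns are eigenvectors of [x |-> 'i x] with eigenvalues of ratio ['i], so
    their exponents lie in consecutive residue classes modulo four. Moreover
    [4 <= n] since [F o phi] divides [f1 o g], and [n <= 6] since the quotient, of
    degree [6 n - 24], divides [det g]. For [n = 4] the quotient is constant, yet a
    column of [g] vanishes at [x = 0]; for [n = 6] no two consecutive classes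
    are such that [g] vanishes neither at [x = 0] nor at [y = 0]. *)
Lemma lift_shape n g F m c : pmap_deg n g -> pmap_deg 6 F -> \det g != 0 ->
  cross g F (power4 C) -> pmap_deg 4 (power4 C) ->
  (exists q, f1c (peval g q) != 0) -> m != 0 -> c != 0 ->
  (forall q, peval g (shift_mx *m q) *m mx2 m 0 0 ('i * m) = c *: peval g q) ->
  n = 5%N /\ exists M : 'M[C]_(2, 4), forall q i,
    peval g q i 0 = q 0 0 * (M i 0 * q 0 0 ^+ 4 + M i 2 * q 1 0 ^+ 4) /\
    peval g q i 1 = q 1 0 * (M i 1 * q 0 0 ^+ 4 + M i 3 * q 1 0 ^+ 4).
Proof.
move=> hg hF d0 hx hp ex m0 c0 eqv.
have hgij i j : g i j \is n.-homog by case: hg.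
have [le [h hh hE]] := lift_factor hgij hF hp ex hx.
have hn0 : h != 0.
  have [q] := ex; apply: contra_neq => h0.
  by rewrite hE h0 meval0 scale0r.
have n6 : (n <= 6)%N.
  have := content_degree hg d0 hh hn0 _; suff H : forall i, exists k, f1c g 0 i = h * k.
    by move/(_ H); lia.
  move=> i; exists (F 0 i \mPo [tuple (power4 C) i 0 | i < 2]).
  apply: meval_inj => q; have := congr1 (fun r : 'rV_7 => r 0 i) (hE q).
  by rewrite -peval_f1c !pevalE sclE pevalE mevalM comp_ev.
have [k kdef] : exists k, k = c / m by exists (c / m).
have i2 := imag_sqr C.
have co (i : 'I_2) j : (j <= n)%N -> (k - 'i ^+ (n - j)) * fcoef n (g i 0) j = 0 /\
    (k - 'i ^+ (n - j).+1) * fcoef n (g i 1) j = 0.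
  move=> jn.
  have E0 : lin_subst shift_mx (g i 0) = k *: g i 0.
    apply: meval_inj => q; rewrite lin_subst_ev mevalZ kdef.
    have := congr1 (fun M : 'M_2 => M i 0) (eqv q).
    rewrite mul2E !mx2E sclE !pevalE mulr0 addr0 => E.
    by rewrite mulrAC -E mulfK.
  have E1 : lin_subst shift_mx (g i 1) = (k / 'i) *: g i 1.
    apply: meval_inj => q; rewrite lin_subst_ev mevalZ kdef.
    have := congr1 (fun M : 'M_2 => M i 1) (eqv q).
    rewrite mul2E !mx2E sclE !pevalE mulr0 add0r => E.
    have im : 'i * m != 0 by rewrite mulf_neq0 // imag_neq0.
    apply: (mulIf im); rewrite E; field; rewrite imag_neq0.
    done.
  have := fcoef_diag 'i 1 (hgij i 0) jn; have := fcoef_diag 'i 1 (hgij i 1) jn.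
  rewrite -!/shift_mx E0 E1 expr1n mulr1 /fcoef !mcoeffZ => e1 e0.
  rewrite !mulrBl e0 subrr; split=> //; rewrite exprS -mulrA -e1; field.
  exact: imag_neq0.
have ev1 (i j : 'I_2) := form_ev10 (hgij i j).
have ev0 (i j : 'I_2) := form_ev01 (hgij i j).
(* The entries do not all vanish at the ramification point [x = 0]: one of the two classes
   contains [y^n]. In the same way one of them contains [x^n]. *)
have k01 : k = 1 \/ k = 'i.
  have q1 : pt (0 : C) 1 != 0 by rewrite pt_eq0 oner_eq0 andbF.
  have [i [j ne]] := pmap_nozero hg q1; move: ne; rewrite ev0 => ne.
  have [] := co i n (leqnn n); rewrite subnn expr0 expr1.
  case: (ord2P j) ne => -> ne /eqP + /eqP; rewrite !mulf_eq0 ?(negPf ne) ?orbF !subr_eq0.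
    by move=> /eqP -> _; left.
  by move=> _ /eqP ->; right.
have kn : k = 'i ^+ n \/ k = 'i ^+ n.+1.
  have q1 : pt (1 : C) 0 != 0 by rewrite pt_eq0 oner_eq0.
  have [i [j ne]] := pmap_nozero hg q1; move: ne; rewrite ev1 => ne.
  have [] := co i 0%N (leq0n n); rewrite subn0.
  case: (ord2P j) ne => -> ne /eqP + /eqP; rewrite !mulf_eq0 ?(negPf ne) ?orbF !subr_eq0.
    by move=> /eqP -> _; left.
  by move=> _ /eqP ->; right.
have n4 : (4 <= n)%N by lia.
have i3 : 'i ^+ 3 = - 'i :> C by rewrite exprS i2 mulrN1.
have i1 := imag_neq1 C; have iN := imag_neqN1 C; have oN := one_neqN1 C.
have i0 := imag_neq0 C.
have iNi : 'i != - 'i :> C.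
  by rewrite -addr_eq0 -mulr2n -mulr_natl mulf_neq0 // two_neq0.
have oNi : 1 != - 'i :> C by rewrite -eqr_oppLR eq_sym.
have [E4|[E5|E6]] : n = 4%N \/ n = 5%N \/ n = 6%N by clear -n4 n6; lia.
- suff /eqP : f1c (peval g (pt 0 1)) = 0.
    have q1 : pt (0 : C) 1 != 0 by rewrite pt_eq0 oner_eq0 andbF.
    have := pmap_neq0 hF (pmap_neq0 hp q1).
    rewrite hE scaler_eq0 => /negPf->; rewrite orbF.
    have : h \is 0.-homog by move: hh; rewrite E4.
    move/homog0_const=> hc; rewrite {1}hc mevalC => /eqP h0.
    by move: hn0; rewrite hc h0 mpolyC0 eqxx.
  case: k01 => kE.
    apply: f1c_col1; rewrite pevalE ev0.
      have [_ /eqP] := co 0 n (leqnn n).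
      by rewrite subnn expr1 kE mulf_eq0 subr_eq0 eq_sym (negPf i1) => /eqP.
    have [_ /eqP] := co 1 n (leqnn n).
    by rewrite subnn expr1 kE mulf_eq0 subr_eq0 eq_sym (negPf i1) => /eqP.
  apply: f1c_col0; rewrite pevalE ev0.
    have [/eqP + _] := co 0 n (leqnn n).
    by rewrite subnn expr0 kE mulf_eq0 subr_eq0 (negPf i1) => /eqP.
  have [/eqP + _] := co 1 n (leqnn n).
  by rewrite subnn expr0 kE mulf_eq0 subr_eq0 (negPf i1) => /eqP.
- split=> //; subst n.
  have kE : k = 'i.
    case: k01 => // k1; case: kn; rewrite k1 !expi ?expr1 ?i2 => /eqP.
      by rewrite eq_sym (negPf i1).
    by rewrite (negPf oN).
  have z0 i (j : nat) : (j <= 5)%N -> 'i != 'i ^+ (5 - j) :> C -> fcoef 5 (g i 0) j = 0.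
    move=> j5 ne; have [/eqP + _] := co i j j5.
    by rewrite kE mulf_eq0 subr_eq0 (negPf ne) => /eqP.
  have z1 i (j : nat) : (j <= 5)%N -> 'i != 'i ^+ (5 - j).+1 :> C -> fcoef 5 (g i 1) j = 0.
    move=> j5 ne; have [_ /eqP] := co i j j5.
    by rewrite kE mulf_eq0 subr_eq0 (negPf ne) => /eqP.
  exists (\matrix_(i < 2, j < 4) nth 0 [:: fcoef 5 (g i 0) 0; fcoef 5 (g i 1) 1;
     fcoef 5 (g i 0) 4; fcoef 5 (g i 1) 5] j) => q i.
  rewrite !mxE !(form_ev _ (hgij _ _)) !big_ord_recr !big_ord0 /=.
  have e4 : 'i ^+ 4 = 1 :> C by rewrite (expi 0).
  rewrite (z0 i 1%N) ?e4 // (z0 i 2%N) ?i3 // (z0 i 3%N) ?i2 // (z0 i 5%N) //.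
  rewrite (z1 i 0%N) ?(expi 2) ?i2 // (z1 i 2%N) ?e4 // (z1 i 3%N) ?i3 // (z1 i 4%N) ?i2 //.
  split; ring.
- exfalso; case: k01 => kE; case: kn; rewrite kE E6 !expi ?i2 ?i3 => /eqP.
  + by rewrite (negPf oN).
  + by rewrite (negPf oNi).
  + by rewrite (negPf iN).
  + by rewrite (negPf iNi).
Qed.

End Reduction.


(** * Reduction to the normal form *)

Section NormalForm.
Variable C : numClosedFieldType.
Implicit Types (q z : 'cV[C]_2) (A S : 'M[C]_2) (g : 'M[{mpoly C[2]}]_2).
Implicit Types (F : 'rV[{mpoly C[2]}]_7).

Lemma nf_ev (a2 a4 b2 b4 : C) q (x := q 0 0) (y := q 1 0) :
  peval (normal_form (plane a2 a4 b2 b4)) q =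
  mx2 (x ^+ 5) (a2 * (x ^+ 4 * y) + a4 * y ^+ 5)
      (x * y ^+ 4) (b2 * (x ^+ 4 * y) + b4 * y ^+ 5).
Proof.
rewrite /normal_form pevalM peval_const.
by apply: mx2P; rewrite mxE !big_ord_recr big_ord0 /= !mxE /=
   !(mevalM, rmorphXn, meval0) /= var0_ev var1_ev -/x -/y; ring.
Qed.

Lemma perp_altE (a2 a4 b2 b4 : C) :
  perp_alt (plane a2 a4 b2 b4) <-> a2 = 1 - a4 /\ b2 = 1 - b4.
Proof.
have ev i : (plane a2 a4 b2 b4 *m (mx_of_rows 1 4 [:: [:: 1; -1; 1; -1]])^T) i 0
    = if i == 0 then 1 - a2 - a4 else 1 - b2 - b4.
  by case: (ord2P i) => ->; rewrite mxE !big_ord_recr big_ord0 /= !mxE /=; ring.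
split=> [H|[Ea Eb]].
  have := (congr1 (fun X : 'cV_2 => X 0 0) H, congr1 (fun X : 'cV_2 => X 1 0) H).
  rewrite !ev !mxE /= => -[/eqP E0 /eqP E1]; move: E0 E1.
  by rewrite !subr_eq0 => /eqP <- /eqP <-; rewrite !subKr.
by rewrite /perp_alt; apply: cv2P; rewrite ev mxE /= ?Ea ?Eb; ring.
Qed.

Definition veronese z : 'cV[C]_7 := \col_(j < 7) (z 0 0 ^+ (6 - j) * z 1 0 ^+ j).

Lemma mul_veronese (c : 'rV[C]_7) z : (c *m veronese z) 0 0 = sval c z.
Proof. by rewrite mxE; apply: eq_bigr => j _; rewrite mxE. Qed.

(** Evaluation at [z] is a nonzero linear functional on sextics. *)
Lemma full_eval F z : linearly_full F -> z != 0 ->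
  ~ (forall q, sval (peval F q) z = 0).
Proof.
move=> full z0 E; have := full (veronese z) _.
have H q : peval F q *m veronese z = 0.
  by apply/matrixP=> i j; rewrite (ord1 i) (ord1 j) mul_veronese E mxE.
move/(_ H)=> V; case/negP: z0.
have := (congr1 (fun X : 'cV_7 => X ord0 0) V, congr1 (fun X : 'cV_7 => X ord_max 0) V).
rewrite !mxE /= subn0 subnn !expr0 mulr1 mul1r => -[/eqP + /eqP].
by rewrite !expf_eq0 /= => /eqP E0 /eqP E1; rewrite [z]ptE E0 E1 pt_eq0 eqxx.
Qed.

Definition fiber F z : {mpoly C[2]} :=
  \sum_(j < 7) (z 0 0 ^+ (6 - j) * z 1 0 ^+ j) *: F 0 j.

Lemma fiber_ev F z q : (fiber F z).@(q) = sval (peval F q) z.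
Proof.
rewrite /fiber rmorph_sum /=; apply: eq_bigr => j _.
by rewrite mevalZ pevalE mulrC.
Qed.

Definition pullback (f : {mpoly C[2]}) : {mpoly C[2]} :=
  f \mPo [tuple (power4 C) i 0 | i < 2].

Lemma pullback_ev f q : (pullback f).@(q) = f.@(pt (q 0 0 ^+ 4) (q 1 0 ^+ 4)).
Proof. by rewrite comp_ev power4_ev. Qed.

Lemma power4_surj q : exists q', q = pt (q' 0 0 ^+ 4) (q' 1 0 ^+ 4).
Proof.
have [x xE] := root_exists (q 0 0) (isT : (0 < 4)%N).
have [y yE] := root_exists (q 1 0) (isT : (0 < 4)%N).
by exists (pt x y); rewrite pt0E pt1E xE yE -ptE.
Qed.

Lemma pmap_power4 : pmap_deg 4 (power4 C).
Proof.
apply: nozero_pmap => [i j|q q0].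
  rewrite (ord1 j); case: (ord2P i) => ->; rewrite mxE /=.
    by apply: (@homog_cast _ (1 * 4)) => //; apply/homogXn/homog_var0.
  by apply: (@homog_cast _ (1 * 4)) => //; apply/homogXn/homog_var1.
have : peval (power4 C) q != 0.
  by rewrite power4_ev pt_eq0 !expf_eq0 /= negb_and -cV2_neq0.
rewrite cV2_neq0 => /orP[ne|ne]; [exists 0, 0 | exists 1, 0]; by rewrite -pevalE.
Qed.

Definition br (v z : 'cV[C]_2) : C := v 1 0 * z 0 0 - v 0 0 * z 1 0.

Lemma lin_br v z : (lin v).@(z) = br v z. Proof. exact: lin_ev. Qed.

Lemma br_dep (v w : 'cV[C]_2) : v 0 0 * w 1 0 - w 0 0 * v 1 0 = 0 ->
  exists2 z : 'cV[C]_2, z != 0 & br v z = 0 /\ br w z = 0.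
Proof.
move=> D; have [|z z0 E] := @ker2 C (mx2 (v 1 0) (- v 0 0) (w 1 0) (- w 0 0)).
  by rewrite det2E !mx2E -[RHS]D; ring.
exists z => //; rewrite /br.
have := (congr1 (fun X : 'cV_2 => X 0 0) E, congr1 (fun X : 'cV_2 => X 1 0) E).
by rewrite !mul2E !mx2E !mxE !mulNr => -[-> ->].
Qed.

Lemma lin_proportional (v w : 'cV[C]_2) : v != 0 -> br v w = 0 ->
  exists s, w = s *: v.
Proof.
rewrite cV2_neq0 /br => v0 /eqP; rewrite subr_eq0 => /eqP E.
case/orP: v0 => [n0|n1].
  exists (w 0 0 / v 0 0); apply: cv2P; rewrite sclE ?divfK //.
  by rewrite mulrAC [w 0 0 * _]mulrC E mulrAC mulfV // mul1r.
exists (w 1 0 / v 1 0); apply: cv2P; rewrite sclE ?divfK //.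
by rewrite mulrAC [w 1 0 * _]mulrC -E mulrAC mulfV // mul1r.
Qed.

(** The quotient [h] of [f1 o g] by [F o phi] has degree six. It vanishes at both
    ramification points, where a column of [g] does, so [h / (x y)] has degree four, and it
    has a zero [q]. There [f1 o g] vanishes, while fullness of [F] keeps both columns
    [al x^4 + be y^4] and [ga x^4 + de y^4] from vanishing; so they are proportional,
    which also shows that [q] is not a ramification point. The ratio [s] is that of [x] and
    [y] up to a fourth root of unity, so that [x^4 = y^4] at [q] after rescaling [x] by
    [s].
    Left multiplication then normalizes [al] and [be], and the proportionality
    becomes the orthogonality to [(1, -1, 1, -1)]. *)
Lemma normalize g F (M : 'M[C]_(2, 4)) : pmap_deg 5 g -> pmap_deg 6 F ->
  linearly_full F -> cross g F (power4 C) -> (exists q, f1c (peval g q) != 0) ->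
  (forall q i,
    peval g q i 0 = q 0 0 * (M i 0 * q 0 0 ^+ 4 + M i 2 * q 1 0 ^+ 4) /\
    peval g q i 1 = q 1 0 * (M i 1 * q 0 0 ^+ 4 + M i 3 * q 1 0 ^+ 4)) ->
  exists s A a2 a4 b2 b4, [/\ s != 0, A \in unitmx, perp_alt (plane a2 a4 b2 b4) &
    forall q, A *m peval g (mx2 s 0 0 1 *m q)
       = peval (normal_form (plane a2 a4 b2 b4)) q].
Proof.
move=> hg hF full hx ex gE.
have hgij i j : g i j \is 5.-homog by case: hg.
have [_ [h hh hE]] := lift_factor hgij hF pmap_power4 ex hx.
have h0 : h != 0.
  have [q] := ex; apply: contra_neq => h0.
  by rewrite hE h0 meval0 scale0r.
have Fn q : q != 0 -> peval F (peval (power4 C) q) != 0.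
  by move=> q0; apply: pmap_neq0 hF _; apply: pmap_neq0 pmap_power4 q0.
have p01 : pt (0 : C) 1 != 0 by rewrite pt_eq0 oner_eq0 andbF.
have p10 : pt (1 : C) 0 != 0 by rewrite pt_eq0 oner_eq0.
have hz0 : h.@(pt 0 1) = 0.
  have /eqP : f1c (peval g (pt 0 1)) = 0.
    by apply: f1c_col0; rewrite (gE _ _).1 pt0E mul0r.
  by rewrite hE scaler_eq0 (negPf (Fn _ p01)) orbF => /eqP.
have [h5 hh5 h5E] := lin_factor hh p01 hz0.
have hz1 : h5.@(pt 1 0) = 0.
  have /eqP : f1c (peval g (pt 1 0)) = 0.
    by apply: f1c_col1; rewrite (gE _ _).2 pt1E mul0r.
  rewrite hE scaler_eq0 (negPf (Fn _ p10)) orbF h5E mevalM lin_ev !(pt0E, pt1E).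
  by rewrite mul0r subr0 !mul1r => /eqP.
have [h4 hh4 h4E] := lin_factor hh5 p10 hz1.
have h40 : h4 != 0 by apply: contra_neq h0 => E; rewrite h5E h4E E !mulr0.
have hxy q : h.@(q) = - (q 0 0 * q 1 0) * h4.@(q).
  by rewrite h5E h4E !mevalM !lin_ev !(pt0E, pt1E); ring.
pose mcol j : 'cV[C]_2 := \col_i M i j.
pose al := mcol 0; pose ga := mcol 1; pose be := mcol 2; pose de := mcol 3.
pose pp q z := br ga z * q 0 0 ^+ 4 + br de z * q 1 0 ^+ 4.
pose rr q z := - (br al z * q 0 0 ^+ 4 + br be z * q 1 0 ^+ 4).
(* Up to factors [x] and [y], [pp] and [- rr] are the linear forms of the second
   and the first column of [g q], so that [key] is the relation of [h] with the factors [x y] cancelled. *)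
pose mono (a b : C) : {mpoly C[2]} := a *: var0 C ^+ 4 + b *: var1 C ^+ 4.
have mono_ev a b q : (mono a b).@(q) = a * q 0 0 ^+ 4 + b * q 1 0 ^+ 4.
  by rewrite mevalD !mevalZ !rmorphXn /= var0_ev var1_ev.
have key z q : pp q z * rr q z * (q 1 0 ^+ 4 * pp q z ^+ 4 - q 0 0 ^+ 4 * rr q z ^+ 4)
    = - h4.@(q) * sval (peval F (peval (power4 C) q)) z.
  pose P := mono (br ga z) (br de z); pose Q := - mono (br al z) (br be z).
  pose W := P * Q * (var1 C ^+ 4 * P ^+ 4 - var0 C ^+ 4 * Q ^+ 4)
     + h4 * pullback (fiber F z).
  have Wev q' : W.@(q') =
     pp q' z * rr q' z * (q' 1 0 ^+ 4 * pp q' z ^+ 4 - q' 0 0 ^+ 4 * rr q' z ^+ 4)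
     + h4.@(q') * sval (peval F (peval (power4 C) q')) z.
    rewrite /W; do 3 rewrite ?(mevalN, mevalD, rmorphXn, mevalM, mevalZ) /=.
    by rewrite var0_ev var1_ev pullback_ev fiber_ev power4_ev.
  suff W0 : W = 0.
    by apply/eqP; rewrite mulNr -subr_eq0 opprK -Wev W0 meval0.
  apply: (@meval_dense _ _ (var0 C * var1 C)).
    by rewrite mulf_neq0 ?var0_neq0 ?var1_neq0.
  move=> q'; rewrite mevalM var0_ev var1_ev Wev => xy0; apply: (mulfI xy0).
  have := congr1 (fun c => sval c z) (hE q'); rewrite sval_f1c svalZ hxy.
  rewrite !(gE _ _).1 !(gE _ _).2 => E.
  rewrite mulr0 mulrDr; apply/eqP; rewrite addr_eq0; apply/eqP.
  transitivity (- (q' 0 0 * q' 1 0) * h4.@(q') * sval (peval F (peval (power4 C) q')) z).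
    by rewrite -E /oct /pp /rr /br !mxE; ring.
  by ring.
(* Columns that are proportional vectors would make all the sextics of the curve
   vanish at a common point. *)
have notP v w (H : forall q z, br v z = 0 -> br w z = 0 ->
     pp q z * rr q z * (q 1 0 ^+ 4 * pp q z ^+ 4 - q 0 0 ^+ 4 * rr q z ^+ 4) = 0) :
   v 0 0 * w 1 0 - w 0 0 * v 1 0 != 0.
  apply/eqP=> /br_dep[z z0 [bv bw]]; apply: (full_eval full z0) => q.
  have [q' ->] := power4_surj q; rewrite -power4_ev.
  have : pullback (fiber F z) = 0.
    apply: (meval_dense h40) => q''; rewrite pullback_ev fiber_ev -power4_ev => n4.
    by apply: (mulfI n4); rewrite mulr0 -[LHS]opprK -mulNr -key H // oppr0.
  move=> /(congr1 (fun f => f.@(q'))); rewrite pullback_ev fiber_ev -power4_ev.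
  by rewrite meval0.
have gade : ga 0 0 * de 1 0 - de 0 0 * ga 1 0 != 0.
  by apply: notP => q z E E'; rewrite /pp E E' !mul0r addr0 !mul0r.
have albe : al 0 0 * be 1 0 - be 0 0 * al 1 0 != 0.
  by apply: notP => q z E E'; rewrite /rr E E' !mul0r addr0 oppr0 mulr0 mul0r.
have [q qn0 h4q] := form_zero hh4.
have [X XE] : exists X, X = q 0 0 ^+ 4 by exists (q 0 0 ^+ 4).
have [Y YE] : exists Y, Y = q 1 0 ^+ 4 by exists (q 1 0 ^+ 4).
pose w1 := X *: al + Y *: be; pose w2 := X *: ga + Y *: de.
have XY0 : (X != 0) || (Y != 0) by rewrite XE YE !expf_eq0 /= -cV2_neq0.
have wn (v w : 'cV[C]_2) : v 0 0 * w 1 0 - w 0 0 * v 1 0 != 0 -> X *: v + Y *: w != 0.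
  move=> D; apply/eqP=> E.
  have := (congr1 (fun V : 'cV_2 => V 0 0) E, congr1 (fun V : 'cV_2 => V 1 0) E).
  rewrite !mxE => -[E0 E1].
  have HX : X * (v 0 0 * w 1 0 - w 0 0 * v 1 0) = 0.
    transitivity ((X * v 0 0 + Y * w 0 0) * w 1 0 - (X * v 1 0 + Y * w 1 0) * w 0 0).
      by ring.
    by rewrite E0 E1 !mul0r subrr.
  have HY : Y * (v 0 0 * w 1 0 - w 0 0 * v 1 0) = 0.
    transitivity (- ((X * v 0 0 + Y * w 0 0) * v 1 0) + (X * v 1 0 + Y * w 1 0) * v 0 0).
      by ring.
    by rewrite E0 E1 !mul0r oppr0 addr0.
  move/eqP: HX; rewrite mulf_eq0 (negPf D) orbF => X0.
  move/eqP: HY; rewrite mulf_eq0 (negPf D) orbF => Y0.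
  by move: XY0; rewrite X0 Y0.
have w10 : w1 != 0 := wn _ _ albe.
have w20 : w2 != 0 := wn _ _ gade.
have lin0 : Y *: lin w2 ^+ 4 = X *: lin w1 ^+ 4.
  apply/eqP; rewrite -subr_eq0.
  have nz : lin w2 * lin w1 != 0 by rewrite mulf_neq0 ?lin_neq0.
  have /eqP : lin w2 * lin w1 * (Y *: lin w2 ^+ 4 - X *: lin w1 ^+ 4) = 0.
    apply: meval_all0 => z; rewrite mevalM mevalB !mevalZ !rmorphXn /= mevalM !lin_br.
    have := key z q; rewrite h4q oppr0 mul0r => E.
    rewrite -[RHS]oppr0 -[in RHS]E /pp /rr -XE -YE /w1 /w2 /br !mxE; ring.
  by rewrite mulf_eq0 (negPf nz).
have br_self v : br v v = 0 by rewrite /br mulrC subrr.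
have ev z : Y * br w2 z ^+ 4 = X * br w1 z ^+ 4.
  have := congr1 (fun f => f.@(z)) lin0.
  by rewrite !mevalZ !rmorphXn /= !lin_br.
have X0 : X != 0.
  apply/eqP=> X0; move: lin0 XY0; rewrite X0 scale0r eqxx /= => /eqP E Y0.
  by move: E; rewrite scaler_eq0 (negPf Y0) expf_eq0 (negPf (lin_neq0 w20)).
have Y0 : Y != 0.
  apply/eqP=> Y0; move: lin0; rewrite Y0 scale0r => /esym/eqP.
  by rewrite scaler_eq0 (negPf X0) expf_eq0 (negPf (lin_neq0 w10)).
have [s w2E] : exists s, w2 = s *: w1.
  apply: lin_proportional w10 _.
  have /eqP := ev w2; rewrite br_self expr0n mulr0 eq_sym mulf_eq0 (negPf X0) /=.
  by rewrite expf_eq0 => /eqP.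
have s4 : Y * s ^+ 4 = X.
  have [z z0 lz] : exists2 z : 'cV[C]_2, z != 0 & (lin w1).@(z) != 0.
    have : (lin w1).@(pt 1 0) != 0 \/ (lin w1).@(pt 0 1) != 0.
      rewrite !lin_ev !(pt0E, pt1E) !mulr0 !mulr1 subr0 sub0r oppr_eq0.
      by move: w10; rewrite cV2_neq0 orbC => /orP[]; [left|right].
    by case=> H; [exists (pt 1 0) | exists (pt 0 1)].
  have := ev z; rewrite w2E.
  have -> : br (s *: w1) z = s * br w1 z by rewrite /br !mxE; ring.
  rewrite exprMn mulrA; apply: mulIf; rewrite expf_neq0 //.
  by rewrite -lin_br.
have s0 : s != 0.
  by apply/eqP=> E; move: s4 X0; rewrite E expr0n mulr0 => <-; rewrite eqxx.
pose N := mx2 (s ^+ 5 * al 0 0) (s * be 0 0) (s ^+ 5 * al 1 0) (s * be 1 0).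
have Nu : N \in unitmx.
  rewrite unit2 det2E !mx2E.
  have -> : s ^+ 5 * al 0 0 * (s * be 1 0) - s * be 0 0 * (s ^+ 5 * al 1 0)
     = s ^+ 6 * (al 0 0 * be 1 0 - be 0 0 * al 1 0) by ring.
  by rewrite mulf_neq0 // expf_neq0.
pose v2 := invmx N *m (s ^+ 4 *: ga); pose v4 := invmx N *m de.
exists s, (invmx N), (v2 0 0), (v4 0 0), (v2 1 0), (v4 1 0).
have sum : s ^+ 4 *: ga + de = s *: (s ^+ 4 *: al + be).
  have E : Y *: (s ^+ 4 *: ga + de) = Y *: (s *: (s ^+ 4 *: al + be)).
    rewrite !scalerDr !scalerA s4.
    by rewrite -/w2 w2E /w1 scalerDr !scalerA -s4; congr (_ *: _ + _ *: _); ring.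
  exact: (scalerI Y0) E.
have Ne1 : N *m pt 1 1 = s *: (s ^+ 4 *: al + be).
  by apply: cv2P; rewrite mul2E !mx2E !(pt0E, pt1E) !mxE; ring.
have vsum : v2 + v4 = pt 1 1.
  by rewrite /v2 /v4 -mulmxDr sum -Ne1 mulKmx.
have vs0 : v2 0 0 + v4 0 0 = 1.
  by have := congr1 (fun V : 'cV_2 => V 0 0) vsum; rewrite mxE pt0E.
have vs1 : v2 1 0 + v4 1 0 = 1.
  by have := congr1 (fun V : 'cV_2 => V 1 0) vsum; rewrite mxE pt1E.
split; [exact: s0 | by rewrite unitmx_inv | |].
  by apply/perp_altE; split; apply/eqP; rewrite eq_sym subr_eq ?vs0 ?vs1.
move=> p; rewrite nf_ev -[RHS](mulKmx Nu); congr (_ *m _).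
have Nv2 : N *m v2 = s ^+ 4 *: ga by rewrite mulKVmx.
have Nv4 : N *m v4 = de by rewrite mulKVmx.
clearbody v2 v4.
have c2 := (congr1 (fun V : 'cV_2 => V 0 0) Nv2, congr1 (fun V : 'cV_2 => V 1 0) Nv2).
have c4 := (congr1 (fun V : 'cV_2 => V 0 0) Nv4, congr1 (fun V : 'cV_2 => V 1 0) Nv4).
move: c2 c4; rewrite !mul2E !mx2E !sclE => -[c20 c21] [c40 c41].
have alE i : al i 0 = M i 0 by rewrite mxE.
have gaE i : ga i 0 = M i 1 by rewrite mxE.
have beE i : be i 0 = M i 2 by rewrite mxE.
have deE i : de i 0 = M i 3 by rewrite mxE.
rewrite !alE !beE ?gaE ?deE in c20 c21 c40 c41.
apply: mx2P; rewrite ?(gE _ _).1 ?(gE _ _).2 !mul2E !mx2E !(mul0r, mul1r, addr0, add0r).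
- by rewrite alE beE; ring.
- transitivity (((s ^+ 5 * M 0 0) * v2 0 0 + (s * M 0 2) * v2 1 0) * (p 0 0 ^+ 4 * p 1 0)
    + ((s ^+ 5 * M 0 0) * v4 0 0 + (s * M 0 2) * v4 1 0) * p 1 0 ^+ 5).
    by rewrite c20 c40; ring.
  by rewrite alE beE; ring.
- by rewrite alE beE; ring.
- transitivity (((s ^+ 5 * M 1 0) * v2 0 0 + (s * M 1 2) * v2 1 0) * (p 0 0 ^+ 4 * p 1 0)
    + ((s ^+ 5 * M 1 0) * v4 0 0 + (s * M 1 2) * v4 1 0) * p 1 0 ^+ 5).
    by rewrite c21 c41; ring.
  by rewrite alE beE; ring.
Qed.

End NormalForm.


(** * The sextic curve in closed form *)

Section CurvePoly.
Variable R : comNzRingType.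

(** The quotient of [p * r * (y * p ^+ 4 - x * r ^+ 4)] by [x - y], when
    [p + r = (x - y) * l]. *)
Definition curve_val (y p r l : R) : R :=
  p * r * (y * l * (p - r) * (p ^+ 2 + r ^+ 2) - r ^+ 4).

(** The expansion of [curve_val] in the nested products that [homv_lin] evaluates, with
    the factor [y] absorbed in [l]. *)
Definition curve_poly (p0 p1 r0 r1 l0 l1 : R) : {poly R} :=
  let p := p0%:P + p1 *: 'X in let r := r0%:P + r1 *: 'X in
  let l := l0%:P + l1 *: 'X in
  p * (r * (l * (p * (p * (p * 1))))) - p * (r * (l * (p * (p * (r * 1)))))
  - (p * (r * (l * (r * (r * (r * 1))))) - p * (r * (l * (p * (r * (r * 1)))))
     - - (p * (r * (r * (r * (r * (r * 1))))))).

Lemma homvN n (p : {poly R}) u v : homv n (- p) u v = - homv n p u v.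
Proof. by rewrite /homv -sumrN; apply: eq_bigr => i _; rewrite coefN mulNr. Qed.

Lemma homv_curve_poly y p0 p1 r0 r1 l0 l1 u v :
  homv 6 (curve_poly p0 p1 r0 r1 (y * l0) (y * l1)) u v
  = curve_val y (p0 * u + p1 * v) (r0 * u + r1 * v) (l0 * u + l1 * v).
Proof.
rewrite /curve_poly !homvB !homvN !homv_lin ?homv1 ?size_lin_mul ?size_poly1 //.
by rewrite /curve_val; ring.
Qed.

End CurvePoly.

Lemma map_curve_poly (R S : comNzRingType) (f : {rmorphism R -> S}) p0 p1 r0 r1 l0 l1 :
  map_poly f (curve_poly p0 p1 r0 r1 l0 l1)
  = curve_poly (f p0) (f p1) (f r0) (f r1) (f l0) (f l1).
Proof.
have fl c d : map_poly f (c%:P + d *: 'X) = (f c)%:P + f d *: 'X.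
  by rewrite rmorphD /= map_polyC map_polyZ map_polyX.
by rewrite /curve_poly !rmorphB /= rmorphN !rmorphM /= !rmorph1 !fl.
Qed.

Section Curve.
Variable C : numClosedFieldType.
Implicit Types (q z w : 'cV[C]_2) (A N S : 'M[C]_2) (g : 'M[{mpoly C[2]}]_2).
Implicit Types (F : 'rV[{mpoly C[2]}]_7) (a b : C).

Definition curve a b : 'rV[{mpoly C[2]}]_7 :=
  let X := var0 C in let Y := var1 C in let c := b - 1 in
  \row_i (curve_poly (Y - c *: (X - Y)) (a *: (X - Y) - X) (- Y) X
            (Y * (- c)%:MP) (Y * a%:MP))`_i.

Lemma curve_ev a b q z (X := q 0 0) (Y := q 1 0)
   (r := X * z 1 0 - Y * z 0 0) (l := a * z 1 0 - (b - 1) * z 0 0) :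
  sval (peval (curve a b) q) z = curve_val Y ((X - Y) * l - r) r l.
Proof.
have E (i : 'I_7) : peval (curve a b) q 0 i = (curve_poly (Y - (b - 1) * (X - Y))
    (a * (X - Y) - X) (- Y) X (Y * - (b - 1)) (Y * a))`_i.
  rewrite pevalE mxE -coef_map; congr (_`_i).
  rewrite map_curve_poly /=.
  by rewrite !(mevalB, mevalN, mevalM, mevalZ, mevalC) var0_ev var1_ev.
rewrite /sval (eq_bigr _ (fun i _ => congr1 (fun x => x * _) (E i))).
rewrite -[LHS]/(homv 6 _ _ _) homv_curve_poly; congr (curve_val _ _ _ _);
  rewrite /r /l; ring.
Qed.

Lemma curve_homog a b i j : curve a b i j \is 6.-homog.
Proof.
have h0 := homog_var0 C; have h1 := homog_var1 C.
have hC (c : C) : var1 C * c%:MP \is 1.-homog.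
  by rewrite mulrC mul_mpolyC rpredZ.
rewrite mxE /curve_poly; set p := (_%:P + (a *: _ - _) *: 'X).
set r := (_%:P + var0 C *: 'X); set l := (_%:P + (_ * a%:MP) *: 'X).
have hp : homog_coefs 1 p by apply: homog_coefs_lin; rewrite ?(rpredB, rpredZ).
have hr : homog_coefs 1 r by apply: homog_coefs_lin; rewrite ?rpredN.
have hl : homog_coefs 1 l by apply: homog_coefs_lin.
have hc1 : homog_coefs 0 (1 : {poly {mpoly C[2]}}).
  by move=> k; rewrite coef1; case: eqP => _; rewrite ?rpred0 // dhomog1.
rewrite !(coefB, coefN); repeat (apply: rpredB || rewrite rpredN);
  apply: (@homog_cast _ (1 + (1 + (1 + (1 + (1 + (1 + 0))))))); rewrite //;
  do 6 (apply: homog_coefsM => //).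
Qed.

(** The columns of the normal form give the linear forms [y * p] and [x * r], where
    [p + r = (X - Y) * l] expresses the orthogonality to [(1, -1, 1, -1)]. Hence [f1]
    of it is [x * y * p * r * (Y * p ^+ 4 - X * r ^+ 4)], which is divisible by
    [X - Y] because [p ^+ 4 - r ^+ 4] is divisible by [p + r]. *)
Lemma nf_curve a b q z :
  sval (f1c (peval (normal_form (plane (1 - a) a (1 - b) b)) q)) z =
  q 0 0 * q 1 0 * (q 0 0 ^+ 4 - q 1 0 ^+ 4)
   * sval (peval (curve a b) (peval (power4 C) q)) z.
Proof.
rewrite curve_ev sval_f1c nf_ev power4_ev !mx2E !(pt0E, pt1E).
set x := q 0 0; set y := q 1 0; set X := x ^+ 4; set Y := y ^+ 4.
set r := X * z 1 0 - Y * z 0 0; set l := a * z 1 0 - (b - 1) * z 0 0.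
set p := (X - Y) * l - r.
have -> : ((1 - b) * (X * y) + b * y ^+ 5) * z 0 0 - ((1 - a) * (X * y) + a * y ^+ 5) * z 1 0
   = y * p by rewrite /p /l /r /Y; ring.
have -> : x ^+ 5 * z 1 0 - x * Y * z 0 0 = x * r by rewrite /r /X; ring.
have pr : p + r = (X - Y) * l by rewrite /p subrK.
rewrite /oct !exprMn -/X -/Y /curve_val.
transitivity (x * y * (p * r * ((p + r) * Y * (p - r) * (p ^+ 2 + r ^+ 2)
   - (X - Y) * r ^+ 4))); first by ring.
by rewrite pr; ring.
Qed.

(** * Derivatives and the tangent line *)

Lemma mderiv_big k (I : Type) (r : seq I) (G : I -> {mpoly C[2]}) :
  (\sum_(i <- r) G i)^`M(k) = \sum_(i <- r) (G i)^`M(k).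
Proof. exact: (big_morph (mderiv k) (mderivD k) (mderiv0 _ k)). Qed.

Lemma meval_big q (I : Type) (r : seq I) (G : I -> {mpoly C[2]}) :
  (\sum_(i <- r) G i).@(q) = \sum_(i <- r) (G i).@(q).
Proof. exact: rmorph_sum. Qed.

Lemma deriv_line q0 q1 (f : {mpoly C[2]}) :
  (line q0 q1 f)^`().[0] = q1 0 0 * (f^`M(0)).@(q0) + q1 1 0 * (f^`M(1)).@(q0).
Proof.
have dE i : (f^`M(i)).@(q0) = \sum_(m <- msupp f) f@_m * ('X_[m]^`M(i)).@(q0).
  rewrite {1}[f]mpolyE mderiv_big meval_big; apply: eq_bigr => m _.
  by rewrite mderivZ mevalZ.
rewrite !dE /line /mmap (big_morph _ (@derivD C) (deriv0 C)) horner_sum.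
rewrite !mulr_sumr -big_split /=; apply: eq_bigr => m _.
rewrite /mmap1 big_ord_recl big_ord1.
rewrite !mderivX !mevalZ !mevalX !big_ord_recl !big_ord0.
have -> : lift ord0 ord0 = 1 :> 'I_2 by apply/eqP.
have -> : ord0 = 0 :> 'I_2 by [].
rewrite !mnmBE !mnm1E /= !subn0 !mulr1 !subn1.
rewrite derivM derivC mul0r add0r hornerM hornerC derivM hornerD !hornerM.
rewrite !deriv_exp !derivD !derivC !derivZ !derivX !add0r.
rewrite !(hornerMn, hornerM, horner_exp, hornerD, hornerC, hornerZ, hornerX).
rewrite !mulr0 !addr0 !mulr1 -[_ *+ m 0]mulr_natr -[_ *+ m 1]mulr_natr.
move: (q0 0 0 ^+ (m 0).-1) (q0 1 0 ^+ (m 1).-1) => c c'; ring.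
Qed.

(** A linearly full curve of degree six in a six-dimensional space is the rational
    normal curve, since its seven components are linearly independent in a space of
    dimension seven. *)
Lemma full_span F (f : {mpoly C[2]}) : (forall i j, F i j \is 6.-homog) ->
  linearly_full F -> f \is 6.-homog ->
  exists l : 'cV[C]_7, f = \sum_(j < 7) l j 0 *: F 0 j.
Proof.
move=> hF full hf.
pose K : 'M[C]_7 := \matrix_(i, j) fcoef 6 (F 0 j) i.
have FE q (l : 'cV[C]_7) : (peval F q *m l) 0 0 = \sum_(i < 7) (K *m l) i 0 * (q 0 0 ^+ (6 - i) * q 1 0 ^+ i).
  rewrite mxE.
  transitivity (\sum_(j < 7) \sum_(i < 7) K i j * l j 0 * (q 0 0 ^+ (6 - i) * q 1 0 ^+ i)).
    apply: eq_bigr => j _; rewrite pevalE (form_ev _ (hF _ _)) mulr_suml.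
    by apply: eq_bigr => i _; rewrite mxE; ring.
  rewrite exchange_big /=; apply: eq_bigr => i _.
  by rewrite mxE mulr_suml.
have Ku : K \in unitmx.
  rewrite unitmxE unitfE -det_tr; apply/det0P=> -[v v0 vK].
  have Kv : K *m v^T = 0 by rewrite -[K]trmxK -trmx_mul vK trmx0.
  case/eqP: v0; rewrite -[v]trmxK (full v^T) ?trmx0 // => q.
  apply/matrixP=> i j; rewrite (ord1 i) (ord1 j) FE big1 ?mxE // => k _.
  by rewrite Kv mxE mul0r.
pose c : 'cV[C]_7 := \col_i fcoef 6 f i.
exists (invmx K *m c); apply: meval_inj => q.
have := FE q (invmx K *m c); rewrite mulKVmx // => E.
rewrite (form_ev _ hf) rmorph_sum /=; transitivity ((peval F q *m (invmx K *m c)) 0 0).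
  by rewrite E; apply: eq_bigr => i _; rewrite mxE.
by rewrite mxE; apply: eq_bigr => j _; rewrite mevalZ pevalE mulrC.
Qed.

(** The components span all forms of degree six, so a direction in which all of them
    are stationary is one in which [x ^ 6], [x ^ 5 y] and their mirror images are; there
    is none at [q != 0]. *)
Lemma jacobian_rank F q : (forall i j, F i j \is 6.-homog) -> linearly_full F ->
  q != 0 -> \rank (jacobian F q) = 2%N.
Proof.
move=> hF full q0; apply/eqP; rewrite -/(row_free _) -kermx_eq0.
apply/rowV0P=> v /sub_kermxP vJ.
have dir (f : {mpoly C[2]}) : f \is 6.-homog ->
    v 0 0 * (f^`M(0)).@(q) + v 0 1 * (f^`M(1)).@(q) = 0.
  move=> hf; have [l ->] := full_span hF full hf.
  have E j : v 0 0 * ((F 0 j)^`M(0)).@(q) + v 0 1 * ((F 0 j)^`M(1)).@(q) = 0.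
    have := congr1 (fun X : 'rV_7 => X 0 j) vJ.
    by rewrite mul2E /jacobian !mxE.
  have D i : ((\sum_(j < 7) l j 0 *: F 0 j)^`M(i)).@(q)
      = \sum_(j < 7) l j 0 * ((F 0 j)^`M(i)).@(q).
    by rewrite mderiv_big meval_big; apply: eq_bigr => j _; rewrite mderivZ mevalZ.
  rewrite !D !mulr_sumr -big_split big1 //= => j _.
  by rewrite mulrCA [X in _ + X]mulrCA -mulrDr E mulr0.
have dl (f : {mpoly C[2]}) : f \is 6.-homog -> (line q v^T f)^`().[0] = 0.
  by move=> hf; rewrite deriv_line ![v^T _ _]mxE dir.
pose x := (q 0 0)%:P + v 0 0 *: 'X; pose y := (q 1 0)%:P + v 0 1 *: 'X.
have lineE i j : line q v^T (var0 C ^+ i * var1 C ^+ j) = x ^+ i * y ^+ j.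
  by rewrite /line rmorphM !rmorphXn /= /var0 /var1 !mmapX !mmap1U ![v^T _ _]mxE.
have mono i j : (i + j = 6)%N -> (x ^+ i * y ^+ j)^`().[0] = 0.
  by move=> ij; rewrite -lineE dl // -ij homog_monom.
have Dx : x^`() = (v 0 0)%:P by rewrite derivD derivC derivZ derivX add0r alg_polyC.
have Dy : y^`() = (v 0 1)%:P by rewrite derivD derivC derivZ derivX add0r alg_polyC.
have x0 : x.[0] = q 0 0 by rewrite hornerD hornerC hornerZ hornerX mulr0 addr0.
have y0 : y.[0] = q 1 0 by rewrite hornerD hornerC hornerZ hornerX mulr0 addr0.
have dE i j : (x ^+ i * y ^+ j)^`().[0] = q 0 0 ^+ i.-1 * v 0 0 *+ i * q 1 0 ^+ j
   + q 0 0 ^+ i * (q 1 0 ^+ j.-1 * v 0 1 *+ j).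
  rewrite derivM !deriv_exp Dx Dy hornerD !hornerM !hornerMn !hornerM !hornerC !horner_exp x0 y0.
  by rewrite mulrC [v 0 0 * _]mulrC [v 0 1 * _]mulrC [X in X + _]mulrC.
have n6 : (6%:R : C) != 0 by rewrite pnatr_eq0.
have vz : v 0 0 = 0 /\ v 0 1 = 0.
  move: q0; rewrite cV2_neq0 => /orP[n|n].
    have := mono 6%N 0%N erefl; rewrite dE mulr0n mulr0 addr0 expr0 mulr1.
    rewrite -mulr_natr => /eqP; rewrite mulf_eq0 (negPf n6) orbF mulf_eq0.
    rewrite (negPf (expf_neq0 _ n)) /= => /eqP v0; split=> //.
    have := mono 5%N 1%N erefl; rewrite dE v0 mulr0 mul0rn mul0r add0r expr0 mul1r mulr1n.
    by move/eqP; rewrite mulf_eq0 (negPf (expf_neq0 _ n)) => /eqP.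
  have := mono 0%N 6%N erefl; rewrite dE mulr0n mul0r add0r expr0 mul1r.
  rewrite -mulr_natr => /eqP; rewrite mulf_eq0 (negPf n6) orbF mulf_eq0.
  rewrite (negPf (expf_neq0 _ n)) /= => /eqP v1; split=> //.
  have := mono 1%N 5%N erefl; rewrite dE v1 mulr0 mul0rn mulr0 addr0 expr0 mul1r mulr1n.
  by move/eqP; rewrite mulf_eq0 (negPf (expf_neq0 _ n)) orbF => /eqP.
by apply/rowP=> j; rewrite mxE; case: (ord2P j) => ->; case: vz.
Qed.

End Curve.


(** * Ramification *)

Section Ramified.
Variable C : numClosedFieldType.
Implicit Types (q z w : 'cV[C]_2) (A N S : 'M[C]_2) (g : 'M[{mpoly C[2]}]_2).
Implicit Types (F : 'rV[{mpoly C[2]}]_7) (a b : C).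

Lemma jacobian_ev F q1 q w (i : 'I_2) : q1 0 0 = (i == 0)%:R -> q1 1 0 = (i == 1)%:R ->
  sval (row i (jacobian F q)) w = (line q q1 (fiber F w))^`().[0].
Proof.
move=> E0 E1; rewrite deriv_line E0 E1.
have -> : (i == 0)%:R * ((fiber F w)^`M(0)).@(q) + (i == 1)%:R * ((fiber F w)^`M(1)).@(q)
    = ((fiber F w)^`M(i)).@(q).
  by case: (ord2P i) => ->; rewrite /= ?mul1r ?mul0r ?addr0 ?add0r.
rewrite /fiber mderiv_big meval_big; apply: eq_bigr => j _.
by rewrite mderivZ mevalZ mulrC !mxE.
Qed.

(** At the parameter [(a, b - 1)] both [p] and [r] are multiples of [l]. As [curve_val]
    has degree six in [p], [r] and [l], its derivative there is [l ^+ 5] times a linear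
    form. *)
Lemma curve_first_order a b (x y : C) : exists c1 c2, forall z (P : {poly C}),
  (forall t, P.[t] = sval (peval (curve a b) (pt a (b - 1) + t *: pt x y)) z) ->
  P^`().[0] = (a * z 1 0 - (b - 1) * z 0 0) ^+ 5 *
    (c1 * (a * z 1 0 - (b - 1) * z 0 0) + c2 * (x * z 1 0 - y * z 0 0)).
Proof.
pose Y := b - 1; pose k := a - Y - 1; pose d := x - y.
pose e := Y * (k - 1) * (k ^+ 2 + 1) - 1.
(* The coefficients come from the product rule, at values [r = l], [p = k * l] and
   derivatives [r' = m], [p' = d * l - m], [y] of [r], [p] and [Y]. *)
exists (d * e + k * (y * (k - 1) * (k ^+ 2 + 1)
          + Y * (d * (k ^+ 2 + 1) + (k - 1) * (2 * k * d)))).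
exists (k * e - e + k * (Y * (- 2 * (k ^+ 2 + 1) + (k - 1) * (2 - 2 * k)) - 4)).
move=> z P PE; set l := _ - _; set m := x * _ - _.
pose r : {poly C} := l%:P + m *: 'X; pose s : {poly C} := (a - Y)%:P + d *: 'X.
pose yp : {poly C} := Y%:P + y *: 'X; pose p : {poly C} := s * l%:P - r.
have -> : P = p * r * (yp * l%:P * (p - r) * (p ^+ 2 + r ^+ 2) - r ^+ 4).
  apply/eqP; rewrite -subr_eq0; apply/eqP/poly_all0 => t.
  rewrite hornerD hornerN PE curve_ev /curve_val !mxE /=.
  rewrite !(hornerM, hornerD, hornerN, hornerC, hornerZ, hornerX, horner_exp).
  by rewrite /l /m /d /Y; ring.
have lin0 (u v : C) : (u%:P + v *: 'X).[0] = u.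
  by rewrite hornerD hornerC hornerZ hornerX mulr0 addr0.
have linD (u v : C) : (u%:P + v *: 'X)^`() = v%:P.
  by rewrite derivD derivC derivZ derivX add0r alg_polyC.
have r0 : r.[0] = l by exact: lin0.
have s0 : s.[0] = a - Y by exact: lin0.
have y0 : yp.[0] = Y by exact: lin0.
have rD : r^`() = m%:P by exact: linD.
have sD : s^`() = d%:P by exact: linD.
have yD : yp^`() = y%:P by exact: linD.
have p0 : p.[0] = k * l by rewrite hornerD hornerN hornerM hornerC r0 s0 /k; ring.
have pD : p^`() = (d * l - m)%:P.
  by rewrite derivB derivM derivC mulr0 addr0 sD rD [RHS]polyCB polyCM.
clearbody r s yp p.
rewrite !(derivM, derivB, derivD, deriv_exp, derivC) rD yD pD /=.
rewrite !(hornerM, hornerD, hornerN, hornerMn, hornerC, horner_exp) r0 y0 p0.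
rewrite /e; clearbody k d; ring.
Qed.

Lemma sextic_add (c d : 'rV[C]_7) : sextic_of (c + d) = sextic_of c + sextic_of d.
Proof.
by rewrite /sextic_of -big_split; apply: eq_bigr => i _; rewrite mxE scalerDl.
Qed.

Lemma act_homog A n (f : {mpoly C[2]}) : f \is n.-homog -> act A f \is n.-homog.
Proof. exact: lin_subst_homog. Qed.

Lemma homog_u6 : var0 C ^+ 6 \is 6.-homog.
Proof. by have := homogXn 6 (homog_var0 C). Qed.

Lemma homog_u5v : var0 C ^+ 5 * var1 C \is 6.-homog.
Proof. by have := homog_monom C 5 1; rewrite expr1. Qed.

(** At the point with parameter [(a, b - 1)] the value of the curve is a multiple of
    [l ^+ 6], and by [curve_first_order] its derivatives are [l ^+ 5] times linear
    forms, which span the tangent line of the closed orbit. The jacobian has rank two,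
    so this line is the tangent line of the curve. *)
Lemma ramified F a b N A k : pmap_deg 6 F -> linearly_full F ->
  N \in unitmx -> A \in unitmx -> k != 0 ->
  (forall q z, sval (peval (curve a b) q) z = k * sval (peval F (N *m q)) (A *m z)) ->
  (a != 0) || (b != 1) -> generally_ramified F.
Proof.
move=> hF full Nu Au k0 H ab.
have hFij i j : F i j \is 6.-homog by case: hF.
pose Q0 := pt a (b - 1); have Q00 : Q0 != 0 by rewrite pt_eq0 negb_and subr_eq0.
pose q0 := N *m Q0; have q00 : q0 != 0 by apply: unitmx_mul_neq0.
pose ell z := a * z 1 0 - (b - 1) * z 0 0.
pose la0 := a * invmx A 1 0 - (b - 1) * invmx A 0 0.
pose la1 := a * invmx A 1 1 - (b - 1) * invmx A 0 1.
have laE w : ell (invmx A *m w) = la0 * w 0 0 + la1 * w 1 0.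
  by rewrite /ell !mul2E /la0 /la1; ring.
have la : (la0 != 0) || (la1 != 0).
  rewrite -negb_and; apply/negP=> /andP[/eqP E0 /eqP E1].
  have ell0 z : ell z = 0 by rewrite -[z](mulKmx Au) laE E0 E1; ring.
  have := (ell0 (pt 1 0), ell0 (pt 0 1)); rewrite /ell !(pt0E, pt1E).
  rewrite !mulr0 !mulr1 sub0r subr0 => -[/eqP + a0]; move: a0 => /[swap].
  by rewrite oppr_eq0 subr_eq0 => b1 a0; move: ab; rewrite a0 b1 eqxx.
(* Complete the linear form [l] to a unimodular basis. *)
have [m0 [m1 dm]] : exists m0 m1, la0 * m1 - la1 * m0 = 1.
  case/orP: la => n; [exists 0, la0^-1 | exists (- la1^-1), 0].
    by rewrite mulr0 subr0 mulfV.
  by rewrite mulr0 sub0r mulrN opprK mulfV.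
pose B := mx2 la0 la1 m0 m1; have dB : \det B = 1 by rewrite det2E !mx2E.
have Bu := det1_unit dB.
have a6 w : (act (invmx B) (var0 C ^+ 6)).@(w) = ell (invmx A *m w) ^+ 6.
  by rewrite act_ev rmorphXn /= var0_ev invmxK mul2E !mx2E laE.
have a51 w : (act (invmx B) (var0 C ^+ 5 * var1 C)).@(w)
   = ell (invmx A *m w) ^+ 5 * (m0 * w 0 0 + m1 * w 1 0).
  by rewrite act_ev mevalM rmorphXn /= var0_ev var1_ev invmxK !mul2E !mx2E laE.
exists q0, (invmx B).
have dB' : \det (invmx B) = 1 by rewrite det_inv dB invr1.
split=> //.
  have Fq0 : sextic_of (peval F q0) != 0 by rewrite sextic_eq0; apply: pmap_neq0 hF q00.
  pose e := (a - (b - 1) - 1) * ((b - 1) * (a - (b - 1) - 2)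
      * ((a - (b - 1) - 1) ^+ 2 + 1) - 1).
  have E : sextic_of (peval F q0) = (k^-1 * e) *: act (invmx B) (var0 C ^+ 6).
    apply: meval_inj => w; rewrite mevalZ a6 sextic_ev.
    have := H Q0 (invmx A *m w); rewrite -/q0 mulKVmx // => E.
    apply: (mulfI k0); rewrite -E curve_ev !(pt0E, pt1E) /curve_val -/(ell _) /e.
    by rewrite !mulrA mulfV // mul1r; ring.
  have e0 : k^-1 * e != 0.
    by apply: contra_neq Fq0 => e0; rewrite E e0 scale0r.
  split=> //; last by exists (k^-1 * e).
  by apply: contra_neq Fq0 => a0; rewrite E a0 scaler0.
set W := col_mx _ _.
have JW : (jacobian F q0 <= W)%MS.
  apply/row_subP=> i.
  pose q1 : 'cV[C]_2 := \col_j (i == j)%:R.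
  have q1E j : q1 j 0 = (i == j)%:R by rewrite mxE.
  have [Q1 NQ1] : exists Q1, N *m Q1 = q1 by exists (invmx N *m q1); rewrite mulKVmx.
  have [c1 [c2 cE]] := curve_first_order a b (Q1 0 0) (Q1 1 0).
  have rowE w : sval (row i (jacobian F q0)) w = k^-1 * (ell (invmx A *m w) ^+ 5 *
    (c1 * ell (invmx A *m w) +
     c2 * (Q1 0 0 * (invmx A *m w) 1 0 - Q1 1 0 * (invmx A *m w) 0 0))).
    rewrite (jacobian_ev _ _ _ (q1E 0) (q1E 1)); apply: (mulfI k0).
    rewrite mulrA mulfV // mul1r.
    transitivity ((k *: line q0 q1 (fiber F w))^`().[0]); first by rewrite derivZ hornerZ.
    rewrite (cE (invmx A *m w)) // => t.
    rewrite hornerZ horner_line fiber_ev H mulKVmx // -ptE.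
    by rewrite mulmxDr -scalemxAr NQ1.
  pose n0 := Q1 0 0 * invmx A 1 0 - Q1 1 0 * invmx A 0 0.
  pose n1 := Q1 0 0 * invmx A 1 1 - Q1 1 0 * invmx A 0 1.
  pose s := n0 * m1 - n1 * m0; pose t := la0 * n1 - la1 * n0.
  have -> : row i (jacobian F q0) =
     (k^-1 * (c1 + c2 * s)) *: coords6 (act (invmx B) (var0 C ^+ 6)) +
     (k^-1 * (c2 * t)) *: coords6 (act (invmx B) (var0 C ^+ 5 * var1 C)).
    apply: sextic_inj; rewrite sextic_add !sextic_Z !sextic_coords6; last first.
    - exact/act_homog/homog_u6.
    - exact/act_homog/homog_u5v.
    apply: meval_inj => w; rewrite sextic_ev rowE mevalD !mevalZ a6 a51.
    have -> : Q1 0 0 * (invmx A *m w) 1 0 - Q1 1 0 * (invmx A *m w) 0 0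
       = s * ell (invmx A *m w) + t * (m0 * w 0 0 + m1 * w 1 0).
      rewrite laE !mul2E.
      transitivity ((la0 * m1 - la1 * m0) * (n0 * w 0 0 + n1 * w 1 0)).
        by rewrite dm /n0 /n1; ring.
      by rewrite /s /t; ring.
    ring.
  rewrite /W -addsmxE; apply: addmx_sub; apply: scalemx_sub.
    exact: addsmxSl.
  exact: addsmxSr.
have rJ := jacobian_rank hFij full q00.
rewrite -(mxrank_leqif_eq JW) rJ eq_sym eqn_leq (rank_leq_row W) /=.
by have := mxrankS JW; rewrite rJ.
Qed.

Definition subst_mx A : 'M[C]_7 := \matrix_(i < 7) coords6 (lin_subst A
   (var0 C ^+ (6 - i) * var1 C ^+ i)).

Lemma subst_mxE A (c : 'rV[C]_7) z : sval (c *m subst_mx A) z = sval c (A *m z).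
Proof.
transitivity (\sum_(j < 7) \sum_(i < 7) (c 0 i * subst_mx A i j) * (z 0 0 ^+ (6 - j) * z 1 0 ^+ j)).
  by apply: eq_bigr => j _; rewrite mxE mulr_suml.
rewrite exchange_big /=; apply: eq_bigr => i _.
transitivity (c 0 i * sval (row i (subst_mx A)) z).
  rewrite /sval mulr_sumr; apply: eq_bigr => j _.
  by rewrite [row _ _ _ _]mxE -mulrA.
congr (_ * _); rewrite -sextic_ev rowK sextic_coords6.
  by rewrite lin_subst_ev mevalM !rmorphXn /= var0_ev var1_ev.
apply: lin_subst_homog; apply: (@homog_cast _ (6 - i + i)); last exact: homog_monom.
by rewrite subnK // -ltnS.
Qed.

Opaque subst_mx.

(** Every point of the target of [w |-> w^4] has a preimage, so the pointwise relation
    descends to one between [curve a b] and the coordinate change of [F], away from the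
    zeros of [x y (x - y)]; then [prop_common] applies. *)
Lemma curve_unique F a b N A : pmap_deg 6 F -> N \in unitmx -> A \in unitmx ->
  (forall q, exists h, forall z,
     sval (f1c (peval (normal_form (plane (1 - a) a (1 - b) b)) q)) z
     = h * sval (peval F (N *m peval (power4 C) q)) (A *m z)) ->
  (exists q, f1c (peval (normal_form (plane (1 - a) a (1 - b) b)) q) != 0) ->
  exists2 k, k != 0 & forall q z,
    sval (peval (curve a b) q) z = k * sval (peval F (N *m q)) (A *m z).
Proof.
move=> hF Nu Au H [q0 ex].
pose F3 := precomp N F *m mpolyC_mx (subst_mx A).
have F3E q : peval F3 q = peval F (N *m q) *m subst_mx A.
  by rewrite pevalM peval_const peval_precomp.
have F3h j : F3 0 j \is 6.-homog.
  rewrite mxE; apply: rpred_sum => i _; rewrite [mpolyC_mx _ _ _]mxE mulrC mul_mpolyC.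
  by apply: rpredZ; rewrite mxE lin_subst_homog //; case: hF.
have F3n q : q != 0 -> exists j, (F3 0 j).@(q) != 0.
  move=> q00; apply/existsP; apply: contraT; rewrite negb_exists => /forallP E.
  have Z : peval F3 q = 0.
    by apply/rowP=> j; rewrite pevalE [RHS]mxE; apply/eqP; have := E j; rewrite negbK.
  case/eqP: (pmap_neq0 hF (unitmx_mul_neq0 Nu q00)).
  apply: sval_inj => z; rewrite -[z](mulKVmx Au) -subst_mxE -F3E Z.
  by rewrite -(scale0r 0) !svalZ !mul0r.
have cr q i j : peval (curve a b) q 0 i * peval F3 q 0 j
    = peval (curve a b) q 0 j * peval F3 q 0 i.
  rewrite !pevalE -!mevalM.
  suff -> : curve a b 0 i * F3 0 j = curve a b 0 j * F3 0 i by [].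
  apply/eqP; rewrite -subr_eq0; apply/eqP.
  apply: (@meval_dense _ _ (var0 C * var1 C * (var0 C - var1 C))).
    rewrite !mulf_neq0 ?var0_neq0 ?var1_neq0 // subr_eq0.
    apply/eqP=> /(congr1 (fun h => h.@(pt 1 0))); rewrite var0_ev var1_ev pt0E pt1E.
    by move/eqP; rewrite oner_eq0.
  move=> {}q; rewrite mevalB !mevalM mevalB var0_ev var1_ev => n0.
  have [q' qE] := power4_surj q.
  have [h hE] := H q'.
  have E : (q' 0 0 * q' 1 0 * (q' 0 0 ^+ 4 - q' 1 0 ^+ 4)) *: peval (curve a b) q
       = h *: peval F3 q.
    apply: sval_inj => z; rewrite !svalZ F3E subst_mxE qE -power4_ev -hE.
    by rewrite nf_curve.
  have n1 : q' 0 0 * q' 1 0 * (q' 0 0 ^+ 4 - q' 1 0 ^+ 4) != 0.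
    apply: contra_neq n0 => Z; rewrite qE pt0E pt1E.
    transitivity (q' 0 0 * q' 1 0 * (q' 0 0 ^+ 4 - q' 1 0 ^+ 4)
       * (q' 0 0 ^+ 3 * q' 1 0 ^+ 3)); first by ring.
    by rewrite Z mul0r.
  apply: (mulfI n1); rewrite mulr0 -!pevalE; move: n1 E.
  set d := q' 0 0 * _ * _ => n1 E.
  have Ei l : d * peval (curve a b) q 0 l = h * peval F3 q 0 l.
    by rewrite -!sclE E.
  rewrite mulrBr !mulrA !Ei; ring.
have nz : exists j, curve a b 0 j != 0.
  apply/existsP; apply: contraT; rewrite negb_exists => /forallP E.
  case/eqP: ex; apply: sval_inj => z; rewrite nf_curve.
  have -> : peval (curve a b) (peval (power4 C) q0) = 0.
    apply/rowP=> j; rewrite pevalE [RHS]mxE.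
    by have := E j; rewrite negbK => /eqP ->; rewrite meval0.
  by rewrite -(scale0r 0) !svalZ !mul0r mulr0.
have [|_ [k hk kE]] := @prop_common C _ 6 (fun j => F3 0 j) F3h F3n 6 (fun j => curve a b 0 j)
   (fun j => curve_homog a b 0 j) nz _.
  by move=> i j; apply: meval_inj => q; rewrite !mevalM -!pevalE cr.
move: hk; rewrite subnn => /homog0_const; set c := fcoef 0 k 0 => kc.
exists c.
  have [j] := nz; apply: contra_neq => c0.
  by rewrite kE kc c0 mpolyC0 mul0r.
move=> q z; rewrite -subst_mxE -F3E -svalZ; congr sval; apply/rowP=> j.
by rewrite sclE !pevalE kE kc mevalM mevalC.
Qed.

Lemma f1c_mull A (M : 'M[C]_2) z : sval (f1c (A *m M)) z = sval (f1c M) (adj2 A *m z).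
Proof. by rewrite !sval_f1c !mul2E !mx2E /oct; ring. Qed.

Lemma linearly_full_precomp N F : N \in unitmx -> linearly_full F ->
  linearly_full (precomp N F).
Proof.
move=> Nu full l H; apply: full => q.
by have := H (invmx N *m q); rewrite peval_precomp mulKVmx.
Qed.

Lemma pmap_precomp m k n N (G : 'M[{mpoly C[2]}]_(m, k)) : N \in unitmx ->
  pmap_deg n G -> pmap_deg n (precomp N G).
Proof.
move=> Nu hG; apply: nozero_pmap => [i j|q q0].
  by rewrite mxE lin_subst_homog //; case: hG.
have [i [j ne]] := pmap_nozero hG (unitmx_mul_neq0 Nu q0).
by exists i, j; rewrite mxE lin_subst_ev.
Qed.

(** * Classification of the Galois lifts *)

(** The coordinate changes that normalize [phi], the monodromy and [g] in turn are
    collected, and the property of being generally ramified is carried back from the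
    closed form of the curve to [F] through [curve_unique]. *)
Lemma classification phi F n g : galois_covering 4 phi -> deck_cyclic phi ->
  sextic_curve F -> pmap_deg n g -> galois_lift phi F g ->
  [/\ n = 5%N,
      exists a2 a4 b2 b4 : C, perp_alt (plane a2 a4 b2 b4) /\
        moebius_PSL2_equiv phi g (power4 C) (normal_form (plane a2 a4 b2 b4))
    & generally_ramified F].
Proof.
move=> gphi cphi [hF _ full _] hg lg.
have [mu [nu [B [m [c [mc hB [m0 c0] d0 eqv]]]]]] := diagonal_monodromy gphi cphi hg lg.
have [muu nuu smap] := mc; have [_ hphi _] := gphi.
have [Bu [cB cB0 BE]] := f1c_S4star hB.
have [lf _ _] := lg; have [ex cx] := lifts_cross lf.
have N1u : invmx nu \in unitmx by rewrite unitmx_inv.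
pose g2 := precomp mu g *m (mpolyC_mx B)^T.
pose F1 := precomp (invmx nu) F.
have g2E q : peval g2 q = peval g (mu *m q) *m B^T.
  rewrite pevalM peval_precomp; congr (_ *m _).
  by apply/matrixP=> i j; rewrite !mxE mevalC.
have BTu : B^T \in unitmx by rewrite unitmx_tr.
have hg2 : pmap_deg n g2.
  apply: pmap_of_neq0 => [i j|q q0].
    rewrite mxE; apply: rpred_sum => k _; rewrite !mxE mulrC mul_mpolyC; apply: rpredZ.
    by apply: lin_subst_homog; case: hg.
  rewrite g2E; have := pmap_neq0 hg (unitmx_mul_neq0 muu q0).
  by apply: contra_neq => E; rewrite -[peval g _](mulmxK BTu) E mul0mx.
have hF1 : pmap_deg 6 F1 := pmap_precomp N1u hF.
have full1 : linearly_full F1 := linearly_full_precomp N1u full.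
have hFij i j : F i j \is 6.-homog by case: hF.
have FF1 q : q != 0 -> exists2 e, e != 0 &
    peval F (peval phi (mu *m q)) = e *: peval F1 (peval (power4 C) q).
  move=> q0; have [_ _ [e e0 E]] := moebius_ev mc q0.
  exists (e ^+ 6); first by rewrite expf_neq0.
  rewrite peval_precomp -(peval_scale _ _ hFij) scalemxAr -E mulKmx //.
have cx2 : cross g2 F1 (power4 C).
  move=> q q0 i j; have [e e0 E] := FF1 q q0.
  have := cx _ (unitmx_mul_neq0 muu q0) i j.
  rewrite E g2E BE !sclE => H; apply: (mulfI e0).
  transitivity (cB * (f1c (peval g (mu *m q)) 0 i * (e * peval F1 (peval (power4 C) q) 0 j))).
    by ring.
  by rewrite H; ring.
have ex2 : exists q, f1c (peval g2 q) != 0.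
  have [q0 nz] := ex; exists (invmx mu *m q0); rewrite g2E BE mulKVmx //.
  by rewrite scaler_eq0 negb_or cB0.
have d2 : \det g2 != 0.
  apply: contra_neq d0 => E; apply: meval_all0 => q.
  have := congr1 (fun f => f.@(q)) E; rewrite !det_ev g2E det_mulmx meval0 peval_precomp.
  by move/eqP; rewrite mulf_eq0 -[\det B^T == 0]negbK -unit2 BTu orbF => /eqP.
have eqv2 q : peval g2 (shift_mx C *m q) *m mx2 m 0 0 ('i * m) = c *: peval g2 q.
  by rewrite !g2E eqv.
have [n5 [M gE]] := lift_shape hg2 hF1 d2 cx2 (pmap_power4 C) ex2 m0 c0 eqv2.
move: n5 hg hg2 => {n}-> hg hg2.
have [s [A [a2 [a4 [b2 [b4 [s0 Au perp nfE]]]]]]] := normalize hg2 hF1 full1 cx2 ex2 gE.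
have [a2E b2E] := (perp_altE a2 a4 b2 b4).1 perp.
pose S := mx2 s 0 0 1; pose S4 := mx2 (s ^+ 4) 0 0 1.
have Su : S \in unitmx by rewrite unit2 det2E !mx2E mulr1 mul0r subr0.
have S4u : S4 \in unitmx by rewrite unit2 det2E !mx2E mulr1 mul0r subr0 expf_neq0.
have pS q : peval (power4 C) (S *m q) = S4 *m peval (power4 C) q.
  rewrite !power4_ev; apply: cv2P; rewrite !mul2E !mx2E !(pt0E, pt1E).
    by rewrite !mul0r !addr0 exprMn.
  by rewrite !mul0r !add0r !mul1r.
have g2n q : q != 0 -> peval g2 q != 0 by move=> q0; apply: pmap_neq0 hg2 q0.
split=> //.
  exists a2, a4, b2, b4; split=> //.
  exists (mu *m S), (invmx S4 *m nu); split.
    split; [by rewrite unitmx_mul muu | by rewrite unitmx_mul unitmx_inv S4u |].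
    move=> q q0; rewrite pevalM peval_const peval_precomp -!mulmxA.
    have Sq0 := unitmx_mul_neq0 Su q0.
    apply: (proj_eq_unit S4u); rewrite mulKVmx // -pS.
    exact: moebius_ev mc Sq0.
  have dA : \det A != 0 by rewrite -unit2.
  have [rho rhoE] := root_exists (\det A)^-1 (isT : (0 < 2)%N).
  have rho0 : rho != 0.
    apply/eqP=> r0; move: rhoE; rewrite r0 expr0n => /esym/eqP.
    by rewrite invr_eq0 (negPf dA).
  exists (rho *: A), B; split=> //; first by rewrite detZ rhoE mulVf.
  move=> q q0.
  have E : peval (mpolyC_mx (rho *: A) *m precomp (mu *m S) g *m (mpolyC_mx B)^T) q
     = rho *: peval (normal_form (plane a2 a4 b2 b4)) q.
    rewrite -nfE g2E !pevalM peval_const peval_precomp -!mulmxA -scalemxAl.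
    congr (_ *: (_ *m (_ *m _))); by apply/matrixP=> i j; rewrite !mxE mevalC.
  rewrite E; apply: proj_eqZ => //; rewrite -nfE.
  have := g2n _ (unitmx_mul_neq0 Su q0).
  by apply: contra_neq => Z; rewrite -[peval g2 _](mulKmx Au) Z mulmx0.
have [_ [h hh hE]] := lift_factor (proj1 hg2) hF1 (pmap_power4 C) ex2 cx2.
have adjA z : adj2 A *m (A *m z) = \det A *: z by rewrite mulmxA adj2_mul mul_scalar_mx.
have Aadj z : A *m (adj2 A *m z) = \det A *: z by rewrite mulmxA mul_adj2 mul_scalar_mx.
have dA : \det A != 0 by rewrite -unit2.
have adju : adj2 A \in unitmx.
  have : A *m adj2 A \in unitmx by rewrite mul_adj2 unit2 det_scalar expf_neq0.
  by rewrite unitmx_mul => /andP[].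
have [|||k k0 kE] := @curve_unique F a4 b4 (invmx nu *m S4) (adj2 A) hF _ adju.
- by rewrite unitmx_mul N1u.
- move=> q; exists h.@(S *m q) => z.
  rewrite -a2E -b2E -nfE f1c_mull hE svalZ; congr (_ * sval _ _).
  by rewrite pS peval_precomp mulmxA.
- have [q nz] := ex2; exists (invmx S *m q).
  rewrite -a2E -b2E -nfE mulKVmx //; apply: contra_neq nz => Z.
  apply: sval_inj => z; rewrite -[z](mulKVmx adju) -f1c_mull Z.
  by rewrite -(scale0r 0) !svalZ !mul0r.
have N2u : invmx nu *m S4 \in unitmx by rewrite unitmx_mul N1u.
apply: (ramified hF full N2u adju k0 kE).
(* For [a4 = 0] and [b4 = 1] the determinant of [g] would vanish. *)
rewrite -negb_and; apply: contraNN d2 => /andP[/eqP a0 /eqP b1].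
apply/eqP/meval_all0 => q; rewrite det_ev.
have /eqP : \det (peval (normal_form (plane a2 a4 b2 b4)) (invmx S *m q)) = 0.
  by rewrite nf_ev a2E b2E a0 b1 det2E !mx2E; ring.
by rewrite -nfE mulKVmx // det_mulmx mulf_eq0 (negPf dA) => /eqP.
Qed.

End Ramified.


(** * Generic parameters give linearly full curves *)

Section Factors.

(** Coefficients of [(k s - t)^5 (s + t)] and of [(k s - t) (s + t)^5], which are
    [p ^+ 5 * r] and [p * r ^+ 5] in the coordinates of [curve_full]. *)
Definition pcoef (R : comNzRingType) (k : R) : seq R :=
  [:: k ^+ 5; k ^+ 5 - 5 * k ^+ 4; 10 * k ^+ 3 - 5 * k ^+ 4;
      10 * k ^+ 3 - 10 * k ^+ 2; 5 * k - 10 * k ^+ 2; 5 * k - 1; - 1].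
Definition rcoef (R : comNzRingType) (k : R) : seq R :=
  [:: k; 5 * k - 1; 10 * k - 5; 10 * k - 10; 5 * k - 10; k - 5; - 1].

(** The diagonal entries of the bidiagonal coefficient matrix of [curve_full]. *)
Definition diag_coef (R : comNzRingType) (a b : R) (i : nat) : R :=
  (b - 1) * (pcoef (a - b))`_i - a * (rcoef (a - b))`_i.

(** The product of all the quantities required to be nonzero, as a polynomial in the
    two parameters: [a] keeps [det g] and the vector of the entries from vanishing, [a - b] bounds the number of
    equivalent parameters, and the other factors ensure linear fullness. *)
Definition generic (R : comNzRingType) (a b : R) : R :=
  a * (a - b) * (a - b + 1) * \prod_(i < 7) diag_coef a b i.

Lemma diag_coef_morph (R S : comNzRingType) (f : {rmorphism R -> S}) a b i :
  (i < 7)%N -> f (diag_coef a b i) = diag_coef (f a) (f b) i.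
Proof. by rewrite /diag_coef; do 7 (case: i => [|i]; [move=> _ /=; ring|]). Qed.

Lemma generic_morph (R S : comNzRingType) (f : {rmorphism R -> S}) a b :
  f (generic a b) = generic (f a) (f b).
Proof.
rewrite /generic !rmorphM /= rmorph_prod !(rmorphB, rmorphD, rmorph1) /=.
by congr (_ * _); apply: eq_bigr => i _; rewrite diag_coef_morph.
Qed.

End Factors.

Section Existence.
Variable C : numClosedFieldType.
Implicit Types (q z w : 'cV[C]_2) (A N S T M : 'M[C]_2) (g : 'M[{mpoly C[2]}]_2).
Implicit Types (F : 'rV[{mpoly C[2]}]_7) (a b : C).

Local Notation nf a b := (normal_form (plane (1 - a) a (1 - b) b)).

(** It suffices to exhibit one good pair of parameters, namely [(2, 0)]. *)
Lemma generic_neq0 : generic (var0 C) (var1 C) != 0.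
Proof.
apply/eqP=> /(congr1 (fun f => f.@(pt 2 0))); rewrite generic_morph /= var0_ev var1_ev.
rewrite pt0E pt1E meval0 => /eqP; apply/negP.
have n (k : nat) (x : C) : x = k.+1%:R \/ x = - k.+1%:R -> x != 0.
  by case=> ->; rewrite ?oppr_eq0 pnatr_eq0.
have dn i : (i < 7)%N -> diag_coef (2 : C) 0 i != 0.
  rewrite /diag_coef; case: i => [|[|[|[|[|[|[|//]]]]]]] _ /=.
  - by apply: (n 35%N); right; ring.
  - by apply: (n 29%N); left; ring.
  - by apply: (n 29%N); right; ring.
  - by apply: (n 59%N); right; ring.
  - by apply: (n 29%N); left; ring.
  - by apply: (n 2%N); right; ring.
  - by apply: (n 2%N); left; ring.
rewrite /generic mulf_neq0 ?mulf_neq0 //.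
- exact: two_neq0.
- by apply: (n 1%N); left; ring.
- by apply: (n 2%N); left; ring.
- by apply/prodf_neq0 => i _; apply: dn.
Qed.

Lemma generic_parts a b : generic a b != 0 ->
  [/\ a != 0, a - b != 0, a - b + 1 != 0 &
      forall i, (i < 7)%N -> diag_coef a b i != 0].
Proof.
rewrite /generic !mulf_eq0 !negb_or => /andP[/andP[/andP[? ?] ?] p].
split=> // i i7; move/prodf_neq0: p => /(_ (Ordinal i7)); exact.
Qed.

Lemma sval_row_subst A (i : 'I_7) z :
  sval (row i (subst_mx A)) z = (A *m z) 0 0 ^+ (6 - i) * (A *m z) 1 0 ^+ i.
Proof.
rewrite rowE subst_mxE /sval (bigD1 i) //= big1 ?addr0.
  by rewrite mxE !eqxx mul1r.
by move=> j ne; rewrite mxE (negPf ne) andbF mul0r.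
Qed.

Lemma subst_mxM A N : subst_mx A *m subst_mx N = subst_mx (A *m N).
Proof.
apply/row_matrixP=> i; apply: sval_inj => z.
by rewrite row_mul (subst_mxE N) (sval_row_subst A) (sval_row_subst (A *m N)) mulmxA.
Qed.

Lemma subst_mx_unit A : A \in unitmx -> subst_mx A \in unitmx.
Proof.
move=> Au; suff H : subst_mx A *m subst_mx (invmx A) = 1%:M.
  exact: (mulmx1_unit H).1.
rewrite subst_mxM mulmxV //; apply/row_matrixP=> i; apply: sval_inj => z.
by rewrite rowE subst_mxE mul1mx rowE mulmx1.
Qed.

Lemma sval_lin (I : finType) (c : I -> 'rV[C]_7) z :
  sval (\sum_i c i) z = \sum_i sval (c i) z.
Proof.
rewrite /sval exchange_big /=; apply: eq_bigr => j _.
by rewrite summxE mulr_suml.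
Qed.

(** Put the coordinate [s] on the parameter line with [(a, b - 1)] at infinity and
    [(1, 1)] at zero, and take [l] and [v - u] as coordinates on the plane. Then
    [r = s * l + (v - u)] and [p = k * s * l - (v - u)], and [X - Y] times the curve is
    [Y * p ^+ 5 * r - X * p * r ^+ 5] with [X] and [Y] of degree one in [s]. Therefore
    the coefficient of [l ^+ (6 - i) * (v - u) ^+ i] only involves [s ^+ (7 - i)] and
    [s ^+ (6 - i)]. This matrix is bidiagonal, so a functional that kills the curve is
    determined to be zero one coordinate after the other. *)
Lemma curve_full a b : generic a b != 0 -> linearly_full (curve a b).
Proof.
move=> /generic_parts[_ _ d0 dA] l H.
pose L : 'M[C]_2 := mx2 (- (b - 1)) a (-1) 1.
have Lu : L \in unitmx.
  by rewrite unit2 det2E !mx2E (_ : _ - _ = a - b + 1) //; ring.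
pose e i := (subst_mx L *m l) i 0.
pose k := a - b.
pose B i := (pcoef k)`_i - (rcoef k)`_i.
have key s : (a - b + 1) * s *: peval (curve a b) (pt (s * a + 1) (s * (b - 1) + 1)) =
   \sum_(i < 7) (diag_coef a b i * s ^+ (7 - i) + B i * s ^+ (6 - i)) *: row i (subst_mx L).
  apply: sval_inj => z; rewrite svalZ sval_lin.
  rewrite (eq_bigr (fun i : 'I_7 => (diag_coef a b i * s ^+ (7 - i) + B i * s ^+ (6 - i))
     * ((L *m z) 0 0 ^+ (6 - i) * (L *m z) 1 0 ^+ i))); last first.
    by move=> i _; rewrite svalZ sval_row_subst.
  rewrite curve_ev !(pt0E, pt1E) /curve_val !mul2E !mx2E.
  rewrite !big_ord_recr big_ord0 /= /diag_coef /B /pcoef /rcoef /= -/k.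
  have -> : a = k + b by rewrite /k subrK.
  clearbody k; ring.
have key2 s : \sum_(i < 7) (diag_coef a b i * s ^+ (7 - i) + B i * s ^+ (6 - i)) * e i = 0.
  transitivity ((((a - b + 1) * s) *: peval (curve a b) (pt (s * a + 1) (s * (b - 1) + 1))
      *m l) 0 0).
    rewrite key mulmx_suml summxE; apply: eq_bigr => i _.
    by rewrite -scalemxAl sclE /e -row_mul [row _ _ _ _]mxE.
  by rewrite -scalemxAl H scaler0 mxE.
pose P := \sum_(i < 7) ((diag_coef a b i * e i) *: 'X^(7 - i) + (B i * e i) *: 'X^(6 - i)).
have P0 : P = 0.
  apply: poly_all0 => s; rewrite -[RHS](key2 s) /P horner_sum; apply: eq_bigr => i _.
  by rewrite hornerD !hornerZ !hornerXn; ring.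
have Pc j : P`_j = 0 by rewrite P0 coef0.
have PE (j : nat) : \sum_(i < 7) (diag_coef a b i * e i * (j == (7 - i)%N)%:R
      + B i * e i * (j == (6 - i)%N)%:R) = 0.
  transitivity P`_j; last exact: Pc.
  rewrite /P coef_sum; apply: eq_bigr => i _.
  by rewrite coefD !coefZ !coefXn.
have e0 (i : nat) (i7 : (i < 7)%N) : e (Ordinal i7) = 0.
  elim/ltn_ind: i i7 => i IH i7.
  have := PE (7 - i)%N; rewrite (bigD1 (Ordinal i7)) //= eqxx mulr1.
  rewrite (_ : (7 - i == 6 - i)%N = false); last by lia.
  rewrite mulr0 addr0 big1 ?addr0.
    by move/eqP; rewrite mulf_eq0 (negPf (dA _ i7)) => /eqP.
  move=> m; rewrite -val_eqE /= => ne; have m7 := ltn_ord m.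
  have [lt|gt|E] := ltngtP m i; last by rewrite E eqxx in ne.
    have -> : e m = 0 by rewrite -(IH m lt m7); congr e; apply: val_inj.
    by rewrite !mulr0 !mul0r addr0.
  rewrite (_ : (7 - i == 7 - m)%N = false); last by lia.
  rewrite (_ : (7 - i == 6 - m)%N = false); last by lia.
  by rewrite !mulr0 addr0.
have E0 : subst_mx L *m l = 0.
  apply/matrixP=> i j; rewrite (ord1 j) [RHS]mxE -[LHS]/(e i).
  by rewrite -(e0 i (ltn_ord i)); congr e; apply: val_inj.
by rewrite -[l](mulKmx (subst_mx_unit Lu)) E0 mulmx0.
Qed.

End Existence.


(** * The curves lie in the quasihomogeneous threefold and lift *)

Section Orbits.
Variable C : numClosedFieldType.
Implicit Types (q z w : 'cV[C]_2) (A N S T M : 'M[C]_2) (g : 'M[{mpoly C[2]}]_2).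
Implicit Types (F : 'rV[{mpoly C[2]}]_7) (a b : C).

Local Notation nf a b := (normal_form (plane (1 - a) a (1 - b) b)).

Lemma det_nf a b q : \det (peval (nf a b) q) =
  q 0 0 * q 1 0 * (q 0 0 ^+ 4 - q 1 0 ^+ 4) * ((1 - b) * q 0 0 ^+ 4 + a * q 1 0 ^+ 4).
Proof. by rewrite nf_ev det2E !mx2E; ring. Qed.

Lemma det_nf_neq0 a b : a != 0 -> \det (nf a b) != 0.
Proof.
move=> a0.
have -> : \det (nf a b) = var0 C * var1 C * (var0 C ^+ 4 - var1 C ^+ 4)
   * ((1 - b) *: var0 C ^+ 4 + a *: var1 C ^+ 4).
  apply: meval_inj => q; rewrite det_ev det_nf.
  rewrite mevalM mevalM mevalB mevalD !mevalZ !rmorphXn /= mevalM var0_ev var1_ev.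
  by [].
apply: mulf_neq0; first apply: mulf_neq0.
- by rewrite mulf_neq0 ?var0_neq0 ?var1_neq0.
- apply/eqP=> /(congr1 (fun f => f.@(pt 1 0))); rewrite mevalB !rmorphXn /= var0_ev var1_ev.
  by rewrite pt0E pt1E expr1n expr0n subr0 meval0 => /eqP; rewrite oner_eq0.
- apply/eqP=> /(congr1 (fun f => f.@(pt 0 1))); rewrite mevalD !mevalZ !rmorphXn /=.
  rewrite var0_ev var1_ev pt0E pt1E expr1n expr0n mulr0 add0r mulr1 meval0 => /eqP.
  by rewrite (negPf a0).
Qed.

Lemma unit_nf_exists a b : a != 0 -> exists2 q, q != 0 & peval (nf a b) q \in unitmx.
Proof.
move=> a0.
have [x xn] : exists x : C, x * (x ^+ 4 - 1) * ((1 - b) * x ^+ 4 + a) != 0.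
  pose P : {poly C} := 'X * ('X^4 - 1) * ((1 - b) *: 'X^4 + a%:P).
  have P0 : P != 0.
    rewrite !mulf_neq0 ?polyX_eq0 //.
      by apply/eqP=> /(congr1 (fun p => p.[0])); rewrite !hornerE expr0n sub0r => /eqP;
         rewrite oppr_eq0 oner_eq0.
    by apply/eqP=> /(congr1 (fun p => p.[0])); rewrite hornerD hornerZ hornerXn hornerC horner0 expr0n mulr0 add0r => /eqP;
       rewrite (negPf a0).
  have [s ss] : exists s : seq C, forall x, P.[x] = 0 -> x \in s.
    have [s sE] := closed_field_poly_normal P; exists s => x Px.
    have : root P x by apply/rootP.
    by rewrite sE rootZ ?lead_coef_eq0 // root_prod_XsubC.
  have [x xs] : exists x, x \notin s.
    pose t := [seq n%:R : C | n <- iota 0 (size s).+1].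
    have ut : uniq t.
      by rewrite map_inj_uniq ?iota_uniq // => m n /eqP; rewrite eqr_nat => /eqP.
    have [/allP st|/allPn[x _ xs]] := boolP (all (mem s) t); last by exists x.
    by have := uniq_leq_size ut st; rewrite size_map size_iota ltnn.
  exists x; apply: contra xs => /eqP E; apply: ss; rewrite -[RHS]E /P.
  by rewrite !(hornerM, hornerD, hornerN, hornerZ, hornerXn, hornerX, hornerC).
exists (pt x 1); first by rewrite pt_eq0 oner_eq0 andbF.
by rewrite unit2 det_nf pt0E pt1E expr1n !mulr1.
Qed.

(** The quadratic form on binary sextics that is invariant under [SL_2]. It vanishes on
    the orbit of [u^5 v] but not on that of [octa], so that it separates the open orbit
    from the closure of the other two. *)
Definition quadric : {mpoly C[7]} :=
  120 *: ('X_(inord 0) * 'X_(inord 6)) - 20 *: ('X_(inord 1) * 'X_(inord 5))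
  + 8 *: ('X_(inord 2) * 'X_(inord 4)) - 3 *: ('X_(inord 3) * 'X_(inord 3)).

Definition qval (c : 'rV[C]_7) : C :=
  120 * (c 0 (inord 0) * c 0 (inord 6)) - 20 * (c 0 (inord 1) * c 0 (inord 5))
  + 8 * (c 0 (inord 2) * c 0 (inord 4)) - 3 * (c 0 (inord 3) * c 0 (inord 3)).

Lemma quadric_ev (c : 'rV[C]_7) : quadric.@[c 0] = qval c.
Proof. by rewrite /quadric mevalB mevalD mevalB !mevalZ !mevalM !mevalXU. Qed.

Lemma quadric_homog : quadric \is 2.-homog.
Proof.
have h i j : ('X_i : {mpoly C[7]}) * 'X_j \is 2.-homog.
  by apply: (@dhomogM _ _ _ 1 _ 1); rewrite dhomogX; apply/eqP; exact: mdeg1.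
by rewrite /quadric !(rpredB, rpredD, rpredZ).
Qed.

Lemma qvalZ t c : qval (t *: c) = t ^+ 2 * qval c.
Proof. by rewrite /qval !sclE; ring. Qed.

Lemma qval_f1c M : qval (f1c M) = 20 * \det M ^+ 6.
Proof. by rewrite /qval !f1cE !inordK // det2E /=; ring. Qed.

Definition tangent_coef (x y s t : C) : seq C :=
  [:: x ^+ 5 * s; 5 * x ^+ 4 * y * s + x ^+ 5 * t;
     10 * x ^+ 3 * y ^+ 2 * s + 5 * x ^+ 4 * y * t;
     10 * x ^+ 2 * y ^+ 3 * s + 10 * x ^+ 3 * y ^+ 2 * t;
     5 * x * y ^+ 4 * s + 10 * x ^+ 2 * y ^+ 3 * t;
     y ^+ 5 * s + 5 * x * y ^+ 4 * t; y ^+ 5 * t].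

Lemma qval_tangent (c : 'rV[C]_7) :
  Defs.in_orbit (var0 C ^+ 5 * var1 C) (sextic_of c) -> qval c = 0.
Proof.
move=> [A dA [_ _ [e e0 E]]].
set B := invmx A in E.
have -> : c = e *: \row_(i < 7) (tangent_coef (B 0 0) (B 0 1) (B 1 0) (B 1 1))`_i.
  apply: sval_inj => z; rewrite -sextic_ev E mevalZ act_ev mevalM rmorphXn /=.
  rewrite var0_ev var1_ev !mul2E svalZ; congr (_ * _).
  by rewrite /sval !big_ord_recr big_ord0 !mxE /=; ring.
rewrite qvalZ /qval !mxE !inordK //=; ring.
Qed.

(** Rescaling [M] to determinant one makes [f1 M] the image of [octa] under [M]. *)
Lemma f1c_orbit M (c : 'rV[C]_7) k : k != 0 -> \det M != 0 -> f1c M = k *: c ->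
  Defs.in_orbit (octa C) (sextic_of c).
Proof.
move=> k0 d0 E.
have [rho rhoE] := root_exists (\det M)^-1 (isT : (0 < 2)%N).
have rho0 : rho != 0.
  apply/eqP=> r0; move: rhoE; rewrite r0 expr0n => /esym/eqP.
  by rewrite invr_eq0 (negPf d0).
have dA : \det (rho *: M) = 1 by rewrite detZ rhoE mulVf.
have actE : act (rho *: M) (octa C) = (rho ^+ 6 * k) *: sextic_of c.
  apply: meval_inj => z; rewrite act_ev octa_ev mevalZ sextic_ev -mulrA -svalZ -E.
  rewrite (inv2E (det1_unit dA)) dA invr1 scale1r sval_f1c !mul2E !mx2E !sclE /oct.
  ring.
have c0 : c != 0.
  apply/eqP=> c0; have := qval_f1c M; rewrite E qvalZ c0 /qval !mxE.
  rewrite !mulr0 !subr0 addr0 mulr0 => /esym/eqP; apply/negP.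
  by rewrite mulf_neq0 ?expf_neq0 ?pnatr_eq0.
exists (rho *: M) => //; apply: proj_eq_sym; rewrite actE; apply: proj_eqZ.
  by rewrite mulf_neq0 ?expf_neq0.
by rewrite sextic_eq0.
Qed.

Lemma nf_homog a2 a4 b2 b4 i j :
  normal_form (plane a2 a4 b2 b4 : 'M[C]_(2, 4)) i j \is 5.-homog.
Proof.
rewrite /normal_form mxE; apply: rpred_sum => k _.
rewrite [mpolyC_mx _ _ _]mxE mul_mpolyC; apply: rpredZ; rewrite !mxE.
have h0 := homog_var0 C; have h1 := homog_var1 C.
by case: (ord2P j) => ->; case: k => [[|[|[|[|//]]]] /= _]; rewrite ?rpred0 //;
  [ apply: (@homog_cast _ (1 * 5)) => //; apply: homogXn
  | apply: (@homog_cast _ (1 + 1 * 4)) => //; apply: dhomogM => //; apply: homogXn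
  | apply: (@homog_cast _ (1 * 4 + 1)) => //; apply: dhomogM => //; apply: homogXn
  | apply: (@homog_cast _ (1 * 5)) => //; apply: homogXn ].
Qed.

Lemma pmap_nf a b : a != 0 -> pmap_deg 5 (nf a b).
Proof.
move=> a0; apply: pmap_of_neq0 => [i j|q q0]; first exact: nf_homog.
apply/eqP; rewrite nf_ev => /matrixP E; have := (E 0 0, E 0 1); rewrite !mx2E !mxE.
move=> -[/eqP]; rewrite expf_eq0 /= => /eqP q00; rewrite q00 expr0n mul0r mulr0 add0r.
move/eqP; rewrite mulf_eq0 (negPf a0) expf_eq0 /= => /eqP q10.
by move: q0; rewrite cV2_neq0 q00 q10 eqxx.
Qed.

Lemma pmap_curve a b : linearly_full (curve a b) -> pmap_deg 6 (curve a b).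
Proof.
move=> full; have hF := curve_homog a b.
apply: pmap_of_neq0 => // q q0; apply/eqP => E.
have Z (f : {mpoly C[2]}) : f \is 6.-homog -> f.@(q) = 0.
  move=> /(full_span hF full)[l ->]; rewrite meval_big big1 // => j _.
  by rewrite mevalZ -pevalE E mxE mulr0.
have := Z _ (homog_u6 C); rewrite rmorphXn /= var0_ev => /eqP.
have := Z _ (homogXn 6 (homog_var1 C)); rewrite rmorphXn /= var1_ev => /eqP.
rewrite !expf_eq0 /= => /eqP q1 /eqP q2.
by move: q0; rewrite cV2_neq0 q1 q2 eqxx.
Qed.

Lemma nf_curveE a b q : f1c (peval (nf a b) q) =
  (q 0 0 * q 1 0 * (q 0 0 ^+ 4 - q 1 0 ^+ 4)) *: peval (curve a b) (peval (power4 C) q).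
Proof. by apply: sval_inj => z; rewrite nf_curve svalZ. Qed.

(** Off the zeros of [det g] the points [f1 (g q)] belong to the open orbit. A form
    that vanishes on the orbit pulls back to a form that vanishes off the zeros of
    [det g], hence identically. *)
Lemma curve_in_V5 a b q : a != 0 -> pmap_deg 6 (curve a b) -> q != 0 ->
  in_V5 (peval (curve a b) q).
Proof.
move=> a0 hF q0; split; first exact: pmap_neq0 hF q0.
move=> d h hh Hs.
pose H := h \mPo [tuple pullback (curve a b 0 i) | i < 7].
have HE q' : H.@(q') = h.@[peval (curve a b) (peval (power4 C) q') 0].
  rewrite comp_mpoly_meval; apply: meval_eq => i.
  by rewrite tnth_mktuple pullback_ev pevalE power4_ev.
have [q' ->] := power4_surj q; rewrite -power4_ev -HE.
suff -> : H = 0 by rewrite meval0.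
apply: (meval_dense (det_nf_neq0 b a0)) => {q0}q0; rewrite det_ev HE => d0.
apply: Hs; apply: (f1c_orbit _ d0 (nf_curveE a b q0)).
by move: d0; rewrite det_nf; apply: contra_neq => ->; rewrite mul0r.
Qed.

Lemma curve_sextic a b : generic a b != 0 -> sextic_curve (curve a b).
Proof.
move=> gen; have full := curve_full gen; have hF := pmap_curve full.
have [a0 _ _ _] := generic_parts gen.
split=> // [q q0|]; first exact: curve_in_V5.
have [q q0 u] := unit_nf_exists b a0.
exists (peval (power4 C) q); first exact: pmap_neq0 (pmap_power4 C) q0.
move=> [_ cl]; have := cl 2 quadric quadric_homog.
rewrite quadric_ev => H.
have /H Z : forall s : 'rV[C]_7, Defs.in_orbit (var0 C ^+ 5 * var1 C) (sextic_of s) ->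
   quadric.@[s 0] = 0.
  by move=> s hs; rewrite quadric_ev; apply: qval_tangent.
have := qval_f1c (peval (nf a b) q); rewrite nf_curveE qvalZ Z mulr0 => /esym/eqP.
by rewrite mulf_eq0 pnatr_eq0 expf_eq0 /= -[_ == _]negbK -unit2 u.
Qed.

(** A transformation of the source that conjugates [w |-> w^4] to itself preserves the
    pair of ramification points. Algebraically, a nontrivial combination of the fourth
    powers of the new coordinates is a multiple of [x^4]; its value and its derivative
    vanish at [x = 0], which is only possible if one of the new coordinates does. *)
Lemma power4_conj mu nu : moebius_conj mu nu (power4 C) (power4 C) ->
  (mu 0 1 = 0 /\ mu 1 0 = 0) \/ (mu 0 0 = 0 /\ mu 1 1 = 0).
Proof.
move=> mc; have [muu nuu _] := mc.
have cr q : q != 0 ->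
  (nu 0 0 * (mu *m q) 0 0 ^+ 4 + nu 0 1 * (mu *m q) 1 0 ^+ 4) * q 1 0 ^+ 4
  = (nu 1 0 * (mu *m q) 0 0 ^+ 4 + nu 1 1 * (mu *m q) 1 0 ^+ 4) * q 0 0 ^+ 4.
  move=> q0; have [_ _ [e _ E]] := moebius_ev mc q0.
  have := (congr1 (fun v : 'cV_2 => v 0 0) E, congr1 (fun v : 'cV_2 => v 1 0) E).
  rewrite !power4_ev !sclE !(pt0E, pt1E) 2![(nu *m _) _ _]mul2E !(pt0E, pt1E).
  by move=> -[-> ->]; ring.
have dm : mu 0 0 * mu 1 1 - mu 0 1 * mu 1 0 != 0 by rewrite -det2E -unit2.
have dn : nu 0 0 * nu 1 1 - nu 0 1 * nu 1 0 != 0 by rewrite -det2E -unit2.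
pose V (x y c d n m : C) : {poly C} :=
  n *: (x%:P + y *: 'X) ^+ 4 + m *: (c%:P + d *: 'X) ^+ 4.
have VE x y c d n m t : (V x y c d n m).[t] = n * (x + y * t) ^+ 4 + m * (c + d * t) ^+ 4.
  by rewrite /V !(hornerD, hornerZ, horner_exp, hornerC, hornerX).
have V0 x y c d n m : (V x y c d n m)`_0 = n * x ^+ 4 + m * c ^+ 4.
  by rewrite -horner_coef0 VE !mulr0 !addr0.
have V1 x y c d n m : (V x y c d n m)`_1 = 4 * (n * (x ^+ 3 * y) + m * (c ^+ 3 * d)).
  have -> : (V x y c d n m)`_1 = (V x y c d n m)^`().[0].
    by rewrite horner_coef0 coef_deriv mulr1n.
  rewrite /V !(derivD, derivZ, deriv_exp, derivC, derivX) add0r.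
  rewrite !(hornerD, hornerZ, hornerMn, hornerM, horner_exp, hornerC, hornerX) /=.
  by rewrite !mulr0 !addr0; ring.
have n4 : (4 : C) != 0 by rewrite pnatr_eq0.
have sing (x y c d n m : C) : n * x ^+ 4 + m * c ^+ 4 = 0 ->
    4 * (n * (x ^+ 3 * y) + m * (c ^+ 3 * d)) = 0 ->
    (n != 0) || (m != 0) -> x * d - c * y != 0 -> x = 0 \/ c = 0.
  move=> E0 /eqP; rewrite mulf_eq0 (negPf n4) /= => /eqP E1 nm D.
  have En : n * (x ^+ 3 * c ^+ 3 * (x * d - c * y)) = 0.
    transitivity ((n * x ^+ 4 + m * c ^+ 4) * (c ^+ 3 * d)
       - (n * (x ^+ 3 * y) + m * (c ^+ 3 * d)) * c ^+ 4); first by ring.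
    by rewrite E0 E1 !mul0r subrr.
  have Em : m * (x ^+ 3 * c ^+ 3 * (x * d - c * y)) = 0.
    transitivity ((n * (x ^+ 3 * y) + m * (c ^+ 3 * d)) * x ^+ 4
       - (n * x ^+ 4 + m * c ^+ 4) * (x ^+ 3 * y)); first by ring.
    by rewrite E0 E1 !mul0r subrr.
  have : x ^+ 3 * c ^+ 3 * (x * d - c * y) = 0.
    case/orP: nm => n0; apply: (mulfI n0); by rewrite ?En ?Em mulr0.
  move/eqP; rewrite mulf_eq0 (negPf D) orbF mulf_eq0 !expf_eq0 /=.
  by case/orP => /eqP; [left | right].
have A1 : mu 0 1 = 0 \/ mu 1 1 = 0.
  have P0 : V (mu 0 1) (mu 0 0) (mu 1 1) (mu 1 0) (nu 0 0) (nu 0 1)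
     = V (mu 0 1) (mu 0 0) (mu 1 1) (mu 1 0) (nu 1 0) (nu 1 1) * 'X^4.
    apply/eqP; rewrite -subr_eq0; apply/eqP/poly_all0 => t.
    rewrite hornerD hornerN hornerM !VE hornerXn.
    have := cr (pt t 1); rewrite pt_eq0 oner_eq0 andbF => /(_ isT).
    rewrite !mul2E !(pt0E, pt1E) expr1n !mulr1 => E.
    rewrite [mu 0 1 + _]addrC [mu 1 1 + _]addrC E; ring.
  have c0 := congr1 (fun p : {poly C} => p`_0) P0.
  have c1 := congr1 (fun p : {poly C} => p`_1) P0.
  move: c0 c1; rewrite !coefMXn /= V0 V1 => c0 c1.
  apply: sing c0 c1 _ _.
    rewrite -negb_and; apply/negP=> /andP[/eqP E /eqP E'].
    by move: dn; rewrite E E' !mul0r subrr eqxx.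
  by apply: contra_neq dm => E; rewrite -[RHS]oppr0 -E; ring.
have A2 : mu 0 0 = 0 \/ mu 1 0 = 0.
  have P0 : V (mu 0 0) (mu 0 1) (mu 1 0) (mu 1 1) (nu 1 0) (nu 1 1)
     = V (mu 0 0) (mu 0 1) (mu 1 0) (mu 1 1) (nu 0 0) (nu 0 1) * 'X^4.
    apply/eqP; rewrite -subr_eq0; apply/eqP/poly_all0 => t.
    rewrite hornerD hornerN hornerM !VE hornerXn.
    have := cr (pt 1 t); rewrite pt_eq0 oner_eq0 => /(_ isT).
    rewrite !mul2E !(pt0E, pt1E) expr1n !mulr1 => ->; ring.
  have c0 := congr1 (fun p : {poly C} => p`_0) P0.
  have c1 := congr1 (fun p : {poly C} => p`_1) P0.
  move: c0 c1; rewrite !coefMXn /= V0 V1 => c0 c1.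
  apply: sing c0 c1 _ _; last by rewrite [mu 1 0 * _]mulrC.
  rewrite -negb_and; apply/negP=> /andP[/eqP E /eqP E'].
  by move: dn; rewrite E E' !mulr0 subrr eqxx.
case: A1 => E1; case: A2 => E2; [|by left|by right|].
  by move: dm; rewrite E1 E2 !mul0r subrr eqxx.
by move: dm; rewrite E1 E2 !mulr0 subrr eqxx.
Qed.

Lemma deck_power4 S : deck (power4 C) S ->
  exists s d, [/\ S = mx2 s 0 0 d, s != 0, d != 0 & s ^+ 4 = d ^+ 4].
Proof.
move=> [Su hS].
have mc : moebius_conj S 1%:M (power4 C) (power4 C).
  split=> //; first exact: unitmx1.
  by move=> q q0; rewrite pevalM peval_const mul1mx peval_precomp; apply: hS.
have p10 : pt (1 : C) 0 != 0 by rewrite pt_eq0 oner_eq0.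
have p11 : pt (1 : C) 1 != 0 by rewrite pt_eq0 oner_eq0.
have dS : S 0 0 * S 1 1 - S 0 1 * S 1 0 != 0 by rewrite -det2E -unit2.
have [[E01 E10]|[E00 E11]] := power4_conj mc; last first.
  have [_ _ [e _ E]] := hS _ p10.
  have := congr1 (fun v : 'cV_2 => v 1 0) E.
  rewrite !power4_ev sclE !(pt0E, pt1E) !mul2E !(pt0E, pt1E) E11.
  rewrite mulr1 mulr0 addr0 expr0n mulr0 => /eqP; rewrite expf_eq0 /= => /eqP E10.
  by move: dS; rewrite E00 E10 mul0r mulr0 subrr eqxx.
move: dS; rewrite E01 mul0r subr0 mulf_eq0 negb_or => /andP[s0 d0].
exists (S 0 0), (S 1 1); split=> //; first by apply: mx2P; rewrite !mx2E.
have [_ _ [e _ E]] := hS _ p11.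
have := (congr1 (fun v : 'cV_2 => v 0 0) E, congr1 (fun v : 'cV_2 => v 1 0) E).
rewrite !power4_ev !sclE !(pt0E, pt1E) !mul2E !(pt0E, pt1E) E01 E10.
by rewrite !mulr1 addr0 add0r expr1n => -[-> ->].
Qed.

Lemma nf_diag a b s d q : s ^+ 4 = d ^+ 4 ->
  peval (nf a b) (mx2 s 0 0 d *m q) = d ^+ 4 *: (peval (nf a b) q *m mx2 s 0 0 d).
Proof.
move=> sd; have s5 : s ^+ 5 = d ^+ 4 * s by rewrite exprSr sd.
rewrite !nf_ev !mul2E !mx2E !mul0r addr0 add0r !exprMn s5 sd.
by apply: mx2P; rewrite sclE !mul2E !mx2E; ring.
Qed.

(** The deck group consists of the diagonal matrices with fourth powers of the entries
    equal, and [nf_diag] shows that [diag (s, d)] has monodromy [diag (d, s)] up to a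
    factor. This is a symmetry of [octa], and it determines [diag (s, d)] up to a
    factor. *)
Lemma nf_galois_lift a b : a != 0 -> galois_lift (power4 C) (curve a b) (nf a b).
Proof.
move=> a0; have [q1 q10 u1] := unit_nf_exists b a0.
have curve_f1 q : f1 (peval (nf a b) q) =
    (q 0 0 * q 1 0 * (q 0 0 ^+ 4 - q 1 0 ^+ 4)) *:
      sextic_of (peval (curve a b) (peval (power4 C) q)).
  by rewrite -sextic_f1c nf_curveE sextic_Z.
have diag_unit (s d : C) : s != 0 -> d != 0 -> mx2 s 0 0 d \in unitmx.
  by move=> s0 d0; rewrite unit2 det2E !mx2E mulr0 subr0 mulf_neq0.
have unitS (s d : C) q : s != 0 -> d != 0 -> s ^+ 4 = d ^+ 4 ->
    peval (nf a b) q \in unitmx -> peval (nf a b) (mx2 s 0 0 d *m q) \in unitmx.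
  move=> s0 d0 sd u; rewrite nf_diag // unitmxZ ?unitfE ?expf_neq0 //.
  by rewrite unitmx_mul u diag_unit.
split.
- split.
    exists q1 => //; rewrite -sextic_f1c sextic_eq0; apply/eqP=> E.
    have := qval_f1c (peval (nf a b) q1); rewrite E -(scale0r 0) qvalZ expr0n mul0r.
    move/esym/eqP; apply/negP; rewrite mulf_neq0 ?pnatr_eq0 // expf_neq0 //.
    by rewrite -unit2.
  move=> q q0; rewrite curve_f1 scaler_eq0 negb_or => /andP[k0 n0].
  exact: proj_eqZ.
- move=> S /deck_power4[s [d [-> s0 d0 sd]]].
  have [rho rhoE] := root_exists (s * d)^-1 (isT : (0 < 2)%N).
  have rho0 : rho != 0.
    apply/eqP=> r0; move: rhoE; rewrite r0 expr0n => /esym/eqP.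
    by rewrite invr_eq0 mulf_eq0 (negPf s0) (negPf d0).
  have dT : \det (rho *: mx2 d 0 0 s) = 1.
    by rewrite detZ rhoE det2E !mx2E mulr0 subr0 [d * s]mulrC mulVf // mulf_neq0.
  exists (rho *: mx2 d 0 0 s).
    split=> //.
    have -> : act (rho *: mx2 d 0 0 s) (octa C) = (rho ^+ 4 * s ^+ 4) *: octa C.
      apply: meval_inj => z; rewrite act_ev mevalZ !octa_ev.
      rewrite (inv2E (det1_unit dT)) dT invr1 scale1r !mul2E !mx2E !sclE !mx2E /oct.
      transitivity ((rho ^+ 2 * (s * d)) * (rho ^+ 4 * (z 0 0 * z 1 0
         * (s ^+ 4 * z 0 0 ^+ 4 - d ^+ 4 * z 1 0 ^+ 4)))); first by ring.
      by rewrite rhoE mulVf ?mulf_neq0 // sd; ring.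
    apply: proj_eqZ; first by rewrite mulf_neq0 ?expf_neq0.
    apply/eqP=> /(congr1 (fun f => f.@(pt 2 1))); rewrite octa_ev meval0 /oct.
    rewrite pt0E pt1E => /eqP; apply/negP.
    have -> : 2 * 1 * (2 ^+ 4 - 1 ^+ 4) = 30%:R :> C by ring.
    by rewrite pnatr_eq0.
  move=> q q0 u u'.
  pose k := rho^-1 * (d ^+ 4 * (s * d))^-1.
  have k0 : k != 0.
    by rewrite mulf_neq0 // invr_eq0 // !mulf_neq0 ?expf_neq0.
  suff -> : invmx (peval (nf a b) (mx2 s 0 0 d *m q)) *m peval (nf a b) q
      = k *: (rho *: mx2 d 0 0 s).
    apply: proj_eqZ => //; apply/eqP=> /matrixP/(_ 0 0); rewrite sclE mx2E mxE => /eqP.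
    by rewrite mulf_eq0 (negPf rho0) (negPf d0).
  apply: (can_inj (mulKmx u')); rewrite mulKVmx // nf_diag // -scalemxAl -mulmxA.
  rewrite scalerA -[in RHS]scalemxAr.
  have -> : mx2 s 0 0 d *m mx2 d 0 0 s = (s * d)%:M.
    by apply: mx2P; rewrite mul2E !mx2E !mxE /= ?mulr0n ?mulr1n; ring.
  rewrite -scalemxAr mul_mx_scalar !scalerA -[LHS]scale1r; congr (_ *: _).
  by rewrite /k; field; rewrite rho0 s0 d0.
move=> S S' T dS dS' hT hT'.
have [s [d [SE s0 d0 sd]]] := deck_power4 dS.
have [s' [d' [SE' s0' d0' sd']]] := deck_power4 dS'.
have G q' (t e : C) : t != 0 -> e != 0 -> t ^+ 4 = e ^+ 4 -> q' != 0 ->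
   peval (nf a b) q' \in unitmx ->
   lift_monodromy (nf a b) (mx2 t 0 0 e) T ->
   exists2 c, c != 0 & mx2 t 0 0 e *m T = c%:M.
  move=> t0 e0 te q'0 u mono.
  have [c c0 E] := lift_monodromyE q'0 mono u (unitS _ _ _ t0 e0 te u).
  exists (c / e ^+ 4); first by rewrite mulf_neq0 // invr_eq0 expf_neq0.
  move: E; rewrite nf_diag // -scalemxAl -mulmxA => E.
  apply: (can_inj (mulKmx u)); rewrite mul_mx_scalar mulrC -scalerA -E scalerA.
  by rewrite mulVf ?expf_neq0 // scale1r.
rewrite SE in hT *; rewrite SE' in hT' *.
have [c c0 E] := G _ _ _ s0 d0 sd q10 u1 hT.
have [c' c0' E'] := G _ _ _ s0' d0' sd' q10 u1 hT'.
have n0 (t e : C) : t != 0 -> mx2 t 0 0 e != 0.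
  by move=> t0; apply: contra_neq t0 => /matrixP/(_ 0 0); rewrite mx2E mxE.
split; try exact: n0.
exists (c / c'); first by rewrite mulf_neq0 // invr_eq0.
have Tu : T \in unitmx.
  have : mx2 s 0 0 d *m T \in unitmx by rewrite E unit2 det_scalar expf_neq0.
  by rewrite unitmx_mul => /andP[].
apply: (can_inj (mulmxK Tu)); rewrite -scalemxAl E E' scale_scalar_mx divfK //.
Qed.

End Orbits.


(** * Finitely many parameters in each class *)

Section Finiteness.
Variable C : numClosedFieldType.
Implicit Types (q : 'cV[C]_2) (A B : 'M[C]_2) (a b : C).

Local Notation nf a b := (normal_form (plane (1 - a) a (1 - b) b)).

Lemma nf_entries a b q : [/\ peval (nf a b) q 0 0 = q 0 0 ^+ 5,
  peval (nf a b) q 0 1 = (1 - a) * (q 0 0 ^+ 4 * q 1 0) + a * q 1 0 ^+ 5,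
  peval (nf a b) q 1 0 = q 0 0 * q 1 0 ^+ 4 &
  peval (nf a b) q 1 1 = (1 - b) * (q 0 0 ^+ 4 * q 1 0) + b * q 1 0 ^+ 5].
Proof. by rewrite nf_ev !mx2E. Qed.

(** The second pair comes from the other factor [(1 - b) x^4 + a y^4] of [det g]: its
    zeros may be moved to [x^4 = y^4] instead of those of [x^4 - y^4]. *)
Definition partners a b : seq (C * C) :=
  [:: (a, b); ((b - 1) / (b - a), b / (b - a))].

(** With [u], [v] and [w] the factors by which a diagonal equivalence multiplies the
    coefficients, eliminating [v] and [w] leaves a quadratic equation for [u], one of
    whose roots is [1]. *)
Lemma solve_diag a b u v w : a - b != 0 -> u * (1 - a) + v * a = 1 ->
  w * (1 - b) + u * b = 1 -> w * v = u ^+ 2 -> (v * a, u * b) \in partners a b.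
Proof.
move=> ab E1 E2 E3.
have va : v * a = 1 - u * (1 - a) by apply: (addrI (u * (1 - a))); rewrite E1; ring.
have : (u - 1) * (u * (a - b) + 1) = 0.
  transitivity (u ^+ 2 * (a * (1 - b)) - (v * a) * (w * (1 - b))).
    have -> : w * (1 - b) = 1 - u * b by apply: (addIr (u * b)); rewrite E2; ring.
    by rewrite va; ring.
  by rewrite -E3; ring.
have ba : b - a != 0 by rewrite -opprB oppr_eq0.
move/eqP; rewrite mulf_eq0 subr_eq0 => /orP[/eqP u1|/eqP uE].
  by rewrite va u1 !mul1r subKr mem_head.
have uV : u = (b - a)^-1.
  apply: (mulIf ba); rewrite mulVf //; apply/eqP; rewrite -subr_eq0; apply/eqP.
  by rewrite -[RHS]oppr0 -uE; ring.
rewrite va uV !inE; apply/orP; right; apply/eqP; congr (_, _); field.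
  exact: ba.
exact: ba.
Qed.

(* Unification must not unfold the entries of the normal form. *)
Opaque normal_form plane.

Lemma nf_form_neq0 a b : exists p : 'I_2 * 'I_2, nf a b p.1 p.2 != 0.
Proof.
exists (0, 0); apply/eqP=> E; have := congr1 (fun f => f.@(pt 1 0)) E.
rewrite meval0 -pevalE nf_ev mx2E pt0E expr1n => /eqP.
by rewrite oner_eq0.
Qed.

(** Both sides are matrices of forms of the same degree without common zero, so that
    the factor of proportionality is a form of degree zero. *)
Lemma equiv_const a b a' b' mu A B : a != 0 -> mu \in unitmx -> A \in unitmx ->
  B \in unitmx ->
  same_map (mpolyC_mx A *m precomp mu (nf a b) *m (mpolyC_mx B)^T) (nf a' b') ->
  exists k, forall q, peval (nf a' b') q = k *: (A *m peval (nf a b) (mu *m q) *m B^T).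
Proof.
move=> a0 muu Au Bu sm; have hg := pmap_nf b a0.
pose G := mpolyC_mx A *m precomp mu (nf a b) *m (mpolyC_mx B)^T.
have BTu : B^T \in unitmx by rewrite unitmx_tr.
have GE q : peval G q = A *m peval (nf a b) (mu *m q) *m B^T.
  rewrite pevalM pevalM peval_const peval_precomp; congr (_ *m _).
  by apply/matrixP=> i j; rewrite !mxE mevalC.
have hG i j : G i j \is 5.-homog.
  rewrite mxE; apply: rpred_sum => k _; rewrite ![_^T _ _]mxE [mpolyC_mx _ _ _]mxE.
  rewrite mulrC mul_mpolyC rpredZ // mxE; apply: rpred_sum => l _.
  rewrite [mpolyC_mx _ _ _]mxE mul_mpolyC rpredZ // mxE.
  by apply: lin_subst_homog; apply: nf_homog.
have nG q : q != 0 -> peval G q != 0.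
  move=> q0; rewrite GE; have := pmap_neq0 hg (unitmx_mul_neq0 muu q0).
  apply: contra_neq => E; rewrite -[peval (nf a b) _](mulKmx Au).
  by rewrite -[A *m _](mulmxK BTu) E mul0mx mulmx0.
have pG := pmap_of_neq0 hG nG.
pose f (p : 'I_2 * 'I_2) := G p.1 p.2; pose f' (p : 'I_2 * 'I_2) := nf a' b' p.1 p.2.
have hf p : f p \is 5.-homog by apply: hG.
have hf' p : f' p \is 5.-homog by apply: nf_homog.
have zf q : q != 0 -> exists p, (f p).@(q) != 0.
  by move=> q0; have [i [j ne]] := pmap_nozero pG q0; exists (i, j).
have [|_ [k hk kE]] := prop_common hf zf hf' (nf_form_neq0 a' b').
  move=> p p'; apply/eqP; rewrite -subr_eq0; apply/eqP.
  apply: (@form_eq0 _ (5 + 5)); first by apply: rpredB; apply: dhomogM.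
  move=> q q0; have [_ _ [c _ E]] := sm q q0.
  have Ep r : (f r).@(q) = c * (f' r).@(q).
    by have := congr1 (fun M : 'M_2 => M r.1 r.2) E; rewrite /= sclE !pevalE.
  by rewrite mevalB !mevalM !Ep; ring.
move: hk; rewrite subnn => /homog0_const; set c := fcoef 0 k 0 => kc.
exists c => q; rewrite -GE; apply/matrixP=> i j.
by rewrite sclE !pevalE -[nf a' b' i j]/(f' (i, j)) kE kc mevalM mevalC.
Qed.

(** By [power4_conj] the source is transformed by a diagonal or an antidiagonal matrix.
    The identity of matrices at the points [(1, 0)], [(0, 1)] and [(1, 1)] then makes
    [A] and [B] diagonal in the first case; in the second case it makes [B] antidiagonal
    and determines the rows of [A] up to scalars. What remains is a quadratic equation,
    as in [solve_diag]. *)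
Lemma equiv_partners a b a' b' : a != 0 -> a - b != 0 ->
  moebius_PSL2_equiv (power4 C) (nf a b) (power4 C) (nf a' b') ->
  (a', b') \in partners a b.
Proof.
move=> a0 ab [mu [nu [mc [A [B [dA hB sm]]]]]].
have [muu _ _] := mc; have Au := det1_unit dA.
have [Bu _] := f1c_S4star hB.
have [k E] := equiv_const a0 muu Au Bu sm.
have {}dA : A 0 0 * A 1 1 - A 0 1 * A 1 0 = 1 by rewrite -det2E.
have dm : mu 0 0 * mu 1 1 - mu 0 1 * mu 1 0 != 0 by rewrite -det2E -unit2.
have eval x y x' y' : mu *m pt x y = pt x' y' ->
    let e i j := k * ((A i 0 * x' ^+ 5 + A i 1 * (x' * y' ^+ 4)) * B j 0
      + (A i 0 * ((1 - a) * (x' ^+ 4 * y') + a * y' ^+ 5)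
         + A i 1 * ((1 - b) * (x' ^+ 4 * y') + b * y' ^+ 5)) * B j 1) in
    [/\ x ^+ 5 = e 0 0, (1 - a') * (x ^+ 4 * y) + a' * y ^+ 5 = e 0 1,
        x * y ^+ 4 = e 1 0 & (1 - b') * (x ^+ 4 * y) + b' * y ^+ 5 = e 1 1].
  move=> muq /=; have := E (pt x y); rewrite muq.
  have := nf_entries a' b' (pt x y); have := nf_entries a b (pt x' y').
  rewrite !pt0E !pt1E.
  move: (peval (nf a' b') (pt x y)) (peval (nf a b) (pt x' y')) => G' G.
  case=> g00 g01 g10 g11 [<- <- <- <-] ->.
  by rewrite !sclE !mul2E !(mxE trmx_key) g00 g01 g10 g11.
have [[m01 m10]|[m00 m11]] := power4_conj mc.
(* The points [(1, 0)], [(0, 1)] and [(1, 1)] give the equations [p], [r] and [s]. *)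
- set al := mu 0 0 in dm; set be := mu 1 1 in dm.
  have {}dm : al * be != 0 by move: dm; rewrite m01 mul0r subr0.
  have [al0 be0] : al != 0 /\ be != 0 by move: dm; rewrite mulf_eq0 negb_or => /andP[].
  have muE x y : mu *m pt x y = pt (al * x) (be * y).
    by apply: cv2P; rewrite mul2E !(pt0E, pt1E) ?m01 ?m10 mul0r ?addr0 ?add0r.
  have /= [p1 p2 p3 p4] := eval _ _ _ _ (muE 1 0).
  have /= [r1 r2 r3 r4] := eval _ _ _ _ (muE 0 1).
  have /= [s1 s2 s3 s4] := eval _ _ _ _ (muE 1 1).
  have P1 : k * (A 0 0 * al ^+ 5 * B 0 0) = 1 by transitivity (1 ^+ 5 : C); [rewrite p1; ring|rewrite expr1n].
  have nz : k * A 0 0 * B 0 0 != 0.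
    by apply: contraTneq (oner_neq0 C) => Z; rewrite negbK -P1;
       apply/eqP; transitivity (k * A 0 0 * B 0 0 * al ^+ 5); [ring | rewrite Z mul0r].
  have [[k0 A00] B00] : (k != 0 /\ A 0 0 != 0) /\ B 0 0 != 0.
    by move: nz; rewrite !mulf_eq0 !negb_or => /andP[/andP[]].
  have A10 : A 1 0 = 0.
    have n : k * al ^+ 5 * B 0 0 != 0 by rewrite !mulf_neq0 ?expf_neq0.
    apply: (mulIf n); rewrite mul0r; transitivity (1 * 0 ^+ 4 : C); last by rewrite expr0n mulr0.
    by rewrite p3; ring.
  have B10 : B 1 0 = 0.
    have n : k * al ^+ 5 * A 0 0 != 0 by rewrite !mulf_neq0 ?expf_neq0.
    apply: (mulIf n); rewrite mul0r.
    transitivity ((1 - a') * (1 ^+ 4 * 0) + a' * 0 ^+ 5 : C); first by rewrite p2; ring.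
    by rewrite expr0n /=; ring.
  have A11 : A 1 1 != 0.
    by apply: contraTneq (oner_neq0 C) => Z; rewrite -dA Z A10 !mulr0 subrr eqxx.
  have B01 : B 0 1 = 0.
    apply/eqP; apply: contraT => n.
    have E1 : b = 0.
      have n1 : k * A 1 1 * be ^+ 5 * B 0 1 != 0 by rewrite !mulf_neq0 ?expf_neq0.
      apply: (mulIf n1); rewrite mul0r; transitivity (0 * 1 ^+ 4 : C); last by rewrite mul0r.
      by rewrite r3 A10; ring.
    have : a = 0.
      have n1 : k * A 0 0 * be ^+ 5 * B 0 1 != 0 by rewrite !mulf_neq0 ?expf_neq0.
      apply: (mulIf n1); rewrite mul0r; transitivity (0 ^+ 5 : C); last by rewrite expr0n.
      by rewrite r1 E1; ring.
    by move/eqP; rewrite (negPf a0).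
  have A01 : A 0 1 = 0.
    have n : k * al * be ^+ 4 * B 0 0 != 0 by rewrite !mulf_neq0 ?expf_neq0.
    apply: (mulIf n); rewrite mul0r.
    transitivity (1 ^+ 5 - k * (A 0 0 * al ^+ 5 * B 0 0)); first by rewrite s1 B01; ring.
    by rewrite P1 expr1n subrr.
  have P3 : k * (A 1 1 * al * be ^+ 4 * B 0 0) = 1.
    by transitivity (1 * 1 ^+ 4 : C); [rewrite s3 A10 B01; ring | rewrite expr1n mulr1].
  have AA : A 1 1 * be ^+ 4 = A 0 0 * al ^+ 4.
    have n : k * al * B 0 0 != 0 by rewrite !mulf_neq0.
    apply: (mulIf n); transitivity (k * (A 1 1 * al * be ^+ 4 * B 0 0)); first by ring.
    by rewrite P3 -P1; ring.
  have a'E : a' = k * A 0 0 * be ^+ 5 * B 1 1 * a.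
    transitivity ((1 - a') * (0 ^+ 4 * 1) + a' * 1 ^+ 5 : C).
      by rewrite expr0n expr1n /=; ring.
    by rewrite r2 A01 B10; ring.
  have b'E : b' = k * A 1 1 * be ^+ 5 * B 1 1 * b.
    transitivity ((1 - b') * (0 ^+ 4 * 1) + b' * 1 ^+ 5 : C).
      by rewrite expr0n expr1n /=; ring.
    by rewrite r4 A10 B10; ring.
  have uE : k * A 1 1 * be ^+ 5 * B 1 1 = k * A 0 0 * al ^+ 4 * be * B 1 1.
    by transitivity (k * (A 1 1 * be ^+ 4) * be * B 1 1); [ring | rewrite AA; ring].
  rewrite a'E b'E; apply: (@solve_diag _ _ _ _ (k * A 1 1 * al ^+ 4 * be * B 1 1)) => //.
  + rewrite uE; transitivity ((1 - a') * (1 ^+ 4 * 1) + a' * 1 ^+ 5 : C).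
      by rewrite s2 A01 B10; ring.
    by rewrite !expr1n; ring.
  + transitivity ((1 - b') * (1 ^+ 4 * 1) + b' * 1 ^+ 5 : C).
      by rewrite s4 A10 B10; ring.
    by rewrite !expr1n; ring.
  + by rewrite expr2 {1}uE; ring.
set al := mu 0 1 in dm; set be := mu 1 0 in dm.
have {}dm : al * be != 0 by move: dm; rewrite m00 mul0r sub0r oppr_eq0.
have [al0 be0] : al != 0 /\ be != 0 by move: dm; rewrite mulf_eq0 negb_or => /andP[].
have muE x y : mu *m pt x y = pt (al * y) (be * x).
  by apply: cv2P; rewrite mul2E !(pt0E, pt1E) ?m00 ?m11 mul0r ?addr0 ?add0r.
have /= [p1 p2 p3 p4] := eval _ _ _ _ (muE 1 0).
have /= [r1 r2 r3 r4] := eval _ _ _ _ (muE 0 1).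
have /= [s1 s2 s3 s4] := eval _ _ _ _ (muE 1 1).
have P1 : k * be ^+ 5 * B 0 1 * (A 0 0 * a + A 0 1 * b) = 1.
  by transitivity (1 ^+ 5 : C); [rewrite p1; ring|rewrite expr1n].
have [[k0 B01] e0] : (k != 0 /\ B 0 1 != 0) /\ A 0 0 * a + A 0 1 * b != 0.
  split; [split|]; apply/eqP=> Z; move/eqP: P1;
    by rewrite Z !(mul0r, mulr0) eq_sym oner_eq0.
have P3 : A 1 0 * a + A 1 1 * b = 0.
  have n : k * be ^+ 5 * B 0 1 != 0 by rewrite !mulf_neq0 ?expf_neq0.
  apply: (mulIf n); rewrite mul0r; transitivity (1 * 0 ^+ 4 : C); last by rewrite expr0n mulr0.
  by rewrite p3; ring.
have B11 : B 1 1 = 0.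
  have n : k * be ^+ 5 * (A 0 0 * a + A 0 1 * b) != 0 by rewrite !mulf_neq0 ?expf_neq0.
  apply: (mulIf n); rewrite mul0r.
  transitivity ((1 - a') * (1 ^+ 4 * 0) + a' * 0 ^+ 5 : C); first by rewrite p2; ring.
  by rewrite expr0n /=; ring.
have B00 : B 0 0 = 0.
  have n : k * al ^+ 5 != 0 by rewrite !mulf_neq0 ?expf_neq0.
  have E0 : A 0 0 * B 0 0 = 0.
    apply: (mulIf n); rewrite mul0r; transitivity (0 ^+ 5 : C); last by rewrite expr0n.
    by rewrite r1; ring.
  have E1 : A 1 0 * B 0 0 = 0.
    apply: (mulIf n); rewrite mul0r; transitivity (0 * 1 ^+ 4 : C); last by rewrite mul0r.
    by rewrite r3; ring.
  transitivity (A 1 1 * (A 0 0 * B 0 0) - A 0 1 * (A 1 0 * B 0 0)).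
    by rewrite -[LHS]mul1r -dA; ring.
  by rewrite E0 E1 !mulr0 subrr.
have Q1 : A 0 0 * (1 - a) + A 0 1 * (1 - b) = 0.
  have n : k * al ^+ 4 * be * B 0 1 != 0 by rewrite !mulf_neq0 ?expf_neq0.
  apply: (mulIf n); rewrite mul0r.
  transitivity (1 ^+ 5 - k * be ^+ 5 * B 0 1 * (A 0 0 * a + A 0 1 * b)).
    by rewrite s1 B00; ring.
  by rewrite P1 expr1n subrr.
have Q3 : k * al ^+ 4 * be * B 0 1 * (A 1 0 * (1 - a) + A 1 1 * (1 - b)) = 1.
  transitivity (1 * 1 ^+ 4 - k * be ^+ 5 * B 0 1 * (A 1 0 * a + A 1 1 * b)).
    by rewrite s3 B00; ring.
  by rewrite P3 mulr0 subr0 expr1n mulr1.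
set e := A 0 0 * a + A 0 1 * b in P1 e0.
set f := A 1 0 * (1 - a) + A 1 1 * (1 - b) in Q3.
have D00 : A 0 0 * (a - b) = e * (1 - b).
  by rewrite -[RHS]subr0 -(mulr0 b) -Q1 /e; ring.
have D01 : A 0 1 * (a - b) = - (e * (1 - a)).
  by rewrite -[RHS]addr0 -(mulr0 a) -Q1 /e; ring.
have D10 : A 1 0 * (a - b) = - (f * b).
  by rewrite -[RHS]addr0 -(mulr0 (1 - b)) -P3 /f; ring.
have D11 : A 1 1 * (a - b) = f * a.
  by rewrite -[RHS]subr0 -(mulr0 (1 - a)) -P3 /f; ring.
have ef : e * be ^+ 4 = f * al ^+ 4.
  have n : k * be * B 0 1 != 0 by rewrite !mulf_neq0.
  apply: (mulIf n); transitivity (k * be ^+ 5 * B 0 1 * e); first by ring.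
  by rewrite P1 -Q3; ring.
pose V := k * al ^+ 5 * B 1 0 * e / (a - b).
pose W := k * al * be ^+ 4 * B 1 0 * f / (a - b).
pose u := k * al ^+ 5 * B 1 0 * f / (a - b).
have uE : u = k * al * be ^+ 4 * B 1 0 * e / (a - b).
  rewrite /u; congr (_ / _); transitivity (k * al * B 1 0 * (f * al ^+ 4)); first by ring.
  by rewrite -ef; ring.
have div x y : x * (a - b) = y -> x = y / (a - b) by move=> <-; rewrite mulfK.
have a'E : a' = V * (1 - b).
  transitivity ((1 - a') * (0 ^+ 4 * 1) + a' * 1 ^+ 5 : C).
    by rewrite expr0n expr1n /=; ring.
  by rewrite r2 B11 (div _ _ D00) /V; ring.
have b'E : b' = - (u * b).
  transitivity ((1 - b') * (0 ^+ 4 * 1) + b' * 1 ^+ 5 : C).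
    by rewrite expr0n expr1n /=; ring.
  by rewrite r4 B11 (div _ _ D10) /u; ring.
have F1 : V * (1 - b) - u * (1 - a) = 1.
  transitivity ((1 - a') * (1 ^+ 4 * 1) + a' * 1 ^+ 5 : C); last by rewrite !expr1n; ring.
  by rewrite s2 B11 (div _ _ D00) (div _ _ D01) /V uE; ring.
have F2 : W * a - u * b = 1.
  transitivity ((1 - b') * (1 ^+ 4 * 1) + b' * 1 ^+ 5 : C); last by rewrite !expr1n; ring.
  by rewrite s4 B11 (div _ _ D10) (div _ _ D11) /W /u; ring.
have F3 : W * V = u ^+ 2 by rewrite expr2 {1}uE /W /V /u; ring.
rewrite a'E b'E; clearbody u V W.
have Va : V * (1 - b) = 1 + u * (1 - a) by apply: (addIr (- (u * (1 - a)))); rewrite F1; ring.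
have : (u + 1) * (u * (b - a) + 1) = 0.
  transitivity ((V * (1 - b)) * (W * a) - u ^+ 2 * (a * (1 - b))).
    have -> : W * a = 1 + u * b by apply: (addIr (- (u * b))); rewrite F2; ring.
    by rewrite Va; ring.
  by rewrite -F3; ring.
move/eqP; rewrite mulf_eq0 addr_eq0 => /orP[/eqP u1|/eqP u2].
  by rewrite Va u1 !mulN1r opprK subKr mem_head.
have ba : b - a != 0 by rewrite -opprB oppr_eq0.
have uV : u = - (b - a)^-1.
  apply: (mulIf ba); rewrite mulNr mulVf //; apply/eqP; rewrite -subr_eq0 opprK.
  by rewrite u2.
rewrite Va uV !inE; apply/orP; right; apply/eqP; congr (_, _); field.
  exact: ba.
exact: ba.
Qed.

Transparent normal_form plane.

End Finiteness.

(** * The Galois lifts of a cyclic covering of degree four *)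

Theorem theorem6p1 (R : realType) :
  [/\ (* the covering *)
      forall phi : 'cV[{mpoly R[i][2]}]_2,
        galois_covering 4 phi -> deck_cyclic phi ->
        exists mu nu : 'M[R[i]]_2, moebius_conj mu nu phi (power4 R[i]),
      (* its Galois lifts *)
      forall (phi : 'cV[{mpoly R[i][2]}]_2) (F : 'rV[{mpoly R[i][2]}]_7)
          (n : nat) (g : 'M[{mpoly R[i][2]}]_2),
        galois_covering 4 phi -> deck_cyclic phi ->
        sextic_curve F -> pmap_deg n g -> galois_lift phi F g ->
        [/\ n = 5%N,
            exists a2 a4 b2 b4 : R[i],
              perp_alt (plane a2 a4 b2 b4) /\
              moebius_PSL2_equiv phi g
                (power4 R[i]) (normal_form (plane a2 a4 b2 b4))
          & generally_ramified F]
    & (* (a4, b4) are two free parameters: they determine the plane, generic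
         values of them occur, and they are determined by the class of g up to
         finitely many values *)
      (forall a4 b4 : R[i], exists! p : R[i] * R[i],
         perp_alt (plane p.1 a4 p.2 b4)) /\
      exists2 D : {mpoly R[i][2]}, D != 0 &
        forall a2 a4 b2 b4 : R[i],
          D.@[fun k : 'I_2 => if k == 0 then a4 else b4] != 0 ->
          perp_alt (plane a2 a4 b2 b4) ->
          let g := normal_form (plane a2 a4 b2 b4) in
          [/\ pmap_deg 5 g,
              exists2 F, sextic_curve F & galois_lift (power4 R[i]) F g
            & exists s : seq (R[i] * R[i]), forall a2' a4' b2' b4' : R[i],
                perp_alt (plane a2' a4' b2' b4') ->
                moebius_PSL2_equiv (power4 R[i]) g (power4 R[i])
                  (normal_form (plane a2' a4' b2' b4')) ->
                (a4', b4') \in s]].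
Proof.
split; first exact: covering_normal.
  exact: classification.
split.
  move=> a4 b4; exists (1 - a4, 1 - b4); split=> [|p /perp_altE[<- <-]].
    exact/perp_altE.
  by rewrite -surjective_pairing.
exists (generic (var0 R[i]) (var1 R[i])); first exact: generic_neq0.
move=> a2 a4 b2 b4 gen /perp_altE[-> ->] g.
have {}gen : generic a4 b4 != 0.
  move: gen; rewrite generic_morph /= /var0 /var1 !mevalXU.
  exact.
have [a0 ab _ _] := generic_parts gen.
split.
- exact: pmap_nf.
- exists (curve a4 b4); [exact: curve_sextic | exact: nf_galois_lift].
- exists (partners a4 b4) => a2' a4' b2' b4' /perp_altE[-> ->].
  exact: equiv_partners.
Qed.
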